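(* Let $X$ be a Banach sequence lattice. Then for every $n$ and every index set $J\subset\mathbb{N}_0^n$, $$K(B_{X_n},J)\ge\frac16\inf_{m\in\mathbb{N}}\Big(\frac{1}{\big(e\|\mathbf{Q}_{\Lambda(m,n),J(m)}\|\big)^{1/m}}\cdot\frac{1}{\boldsymbol{\lambda}\big(\mathcal{P}_{J(m)^\flat}(X_n)\big)^{1/m}}\Big).$$
   Context: $X$ is a Banach space of complex sequences with the ideal property; $X_n$ is $\mathbb{C}^n$ with $\|z\|=\|\sum_{k\le n}|z_k|e_k\|_X$, $B_{X_n}$ its open unit ball. $\Lambda(m,n)=\{\alpha\in\mathbb{N}_0^n:|\alpha|=m\}$, $J(m)=J\cap\Lambda(m,n)$, and for $I\subset\Lambda(m,n)$, $I^\flat=\{\alpha\in\Lambda(m-1,n):\alpha+e_k\in I\text{ for some }k\}$. $\mathcal{P}_I(X_n)$: polynomials $\sum_{\alpha\in I}c_\alpha z^\alpha$ with sup norm over $B_{X_n}$; for $I\subset I'$, $\mathbf{Q}_{I',I}:\mathcal{P}_{I'}(X_n)\to\mathcal{P}_I(X_n)$ keeps coefficients indexed by $I$ and annihilates the rest. $\boldsymbol{\lambda}$: projection constant. $K(B_{X_n},J)$ is the Bohr radius: the supremum of $r\in(0,1)$ with $\sup_{z\in rB_{X_n}}\sum_{\alpha\in J}|c_\alpha(f)z^\alpha|\le\sup_{B_{X_n}}|f|$ for all bounded holomorphic $f$ on $B_{X_n}$ whose Taylor coefficients $c_\alpha(f)=\partial^\alpha f(0)/\alpha!$ vanish outside $J$.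 *)

(* Defs.v *)
(* Complex numbers are mathcomp-real-closed's
   [R[i]] over an abstract [R : realType]; we use the alias [R[i]^o] so that the
   complex numbers carry MathComp-Analysis' normed-module structure over themselves
   (so that [differentiable] / [derive] below are COMPLEX derivatives). *)
From HB Require Import structures.
From mathcomp Require Import all_boot all_order all_algebra.
From mathcomp Require Import all_classical all_reals all_analysis.
From mathcomp Require Import complex.
Set Implicit Arguments. Unset Strict Implicit. Unset Printing Implicit Defensive.
Import Order.TTheory GRing.Theory Num.Theory.
Import numFieldNormedType.Exports.
Local Open Scope classical_set_scope.
Local Open Scope ring_scope.

Notation Cx R := ((complex R)^o).

Definition cabs {R : realType} (z : Cx R) : R := ComplexField.Normc.normc (z : R[i]).

Definition cR {R : realType} (x : R) : Cx R := Complex x 0.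

(** Banach sequence lattices.  [inX] is the set X of complex sequences,
    [nX] its norm (only meaningful on X). *)
Definition is_banach_seq_lattice (R : realType)
    (inX : set (nat -> Cx R)) (nX : (nat -> Cx R) -> R) : Prop :=
  (inX (fun _ => 0) /\
   (forall x y, inX x -> inX y -> inX (fun k => x k + y k)) /\
   (forall (a : Cx R) x, inX x -> inX (fun k => a * x k))) /\
  ((forall x, inX x -> 0 <= nX x) /\
   (forall x, inX x -> nX x = 0 -> x = (fun _ => 0)) /\
   (forall (a : Cx R) x, inX x -> nX (fun k => a * x k) = cabs a * nX x) /\
   (forall x y, inX x -> inX y -> nX (fun k => x k + y k) <= nX x + nX y)) /\
  (forall u : nat -> (nat -> Cx R), (forall p, inX (u p)) ->
     (forall eps : R, 0 < eps -> exists N, forall p q, (N <= p)%N -> (N <= q)%N ->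
         nX (fun k => u p k - u q k) < eps) ->
     exists x, inX x /\ forall eps : R, 0 < eps -> exists N, forall p, (N <= p)%N ->
         nX (fun k => u p k - x k) < eps) /\
  (forall x y, inX x -> (forall k, cabs (y k) <= cabs (x k)) ->
     inX y /\ nX y <= nX x) /\
  (forall j, inX (fun k => if k == j then 1 else 0)).

Definition normXn (R : realType) (nX : (nat -> Cx R) -> R) (n : nat)
    (z : 'rV[Cx R]_n) : R :=
  nX (fun k => match @insub nat (fun k => k < n)%N 'I_n k with
               | Some i => cR (cabs (z ord0 i))
               | None => 0 end).

Definition ballXn (R : realType) (nX : (nat -> Cx R) -> R) (n : nat) (r : R) :
  set 'rV[Cx R]_n := [set z | normXn nX z < r].
Arguments ballXn {R} nX n r.

Definition mi (n : nat) := {ffun 'I_n -> nat}.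

Definition deg (n : nat) (a : mi n) : nat := (\sum_(i < n) a i)%N.

Definition zpow (R : realType) (n : nat) (z : 'rV[Cx R]_n) (a : mi n) : Cx R :=
  \prod_(i < n) z ord0 i ^+ a i.

Definition incr (n : nat) (a : mi n) (k : 'I_n) : mi n :=
  [ffun i => (a i + (i == k))%N].

Definition Lambda (n m : nat) : set (mi n) := [set a | deg a = m].
Arguments Lambda : clear implicits.

Definition Jm (n : nat) (J : set (mi n)) (m : nat) : set (mi n) := J `&` Lambda n m.

Definition flat (n m : nat) (I : set (mi n)) : set (mi n) :=
  [set b | deg b = m.-1 /\ exists k : 'I_n, I (incr b k)].

Definition holomorphic_on (R : realType) (n : nat) (U : set 'rV[Cx R]_n)
    (f : 'rV[Cx R]_n -> Cx R) : Prop :=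
  forall z, U z -> differentiable f z.

Definition pderiv (R : realType) (n : nat) (i : 'I_n) (f : 'rV[Cx R]_n -> Cx R) :
  'rV[Cx R]_n -> Cx R := fun x => derive f x (delta_mx 0 i).

Definition dalpha (R : realType) (n : nat) (a : mi n) (f : 'rV[Cx R]_n -> Cx R) :
  'rV[Cx R]_n -> Cx R :=
  foldr (fun i g => iter (a i) (pderiv i) g) f (enum 'I_n).

Definition taylor_coef (R : realType) (n : nat) (f : 'rV[Cx R]_n -> Cx R) (a : mi n) :
  Cx R := dalpha a f 0 / (\prod_(i < n) (a i)`!)%:R.

Definition bohr_ineq (R : realType) (nX : (nat -> Cx R) -> R) (n : nat)
    (J : set (mi n)) (r : R) : Prop :=
  forall f : 'rV[Cx R]_n -> Cx R,
    holomorphic_on (ballXn nX n 1) f ->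
    (exists M : R, forall w, ballXn nX n 1 w -> cabs (f w) <= M) ->
    (forall a, ~ J a -> taylor_coef f a = 0) ->
    forall M : R, (forall w, ballXn nX n 1 w -> cabs (f w) <= M) ->
    (* sup_{z in r B} sum_{alpha in J} |c_alpha(f) z^alpha| <= sup_B |f| *)
    forall z, ballXn nX n r z ->
      (\esum_(a in J) (cabs (taylor_coef f a * zpow z a))%:E <= M%:E)%E.
Arguments bohr_ineq {R} nX n J r.

Definition bohr_radius (R : realType) (nX : (nat -> Cx R) -> R) (n : nat)
    (J : set (mi n)) : R :=
  sup [set r : R | 0 < r < 1 /\ bohr_ineq nX n J r].
Arguments bohr_radius {R} nX n J.

(** P_I(X_n): polynomials sum_{alpha in I} c_alpha z^alpha (I finite), given by
    their coefficient functions supported in I, with the sup norm over B_{X_n}. *)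
Definition supported (n : nat) (R : realType) (I : set (mi n)) (c : mi n -> Cx R) :
  Prop := forall a, ~ I a -> c a = 0.

Definition peval (R : realType) (n : nat) (I : set (mi n)) (c : mi n -> Cx R)
    (z : 'rV[Cx R]_n) : Cx R := \sum_(a \in I) c a * zpow z a.

Definition polynorm (R : realType) (nX : (nat -> Cx R) -> R) (n : nat)
    (I : set (mi n)) (c : mi n -> Cx R) : R :=
  sup [set cabs (peval I c z) | z in ballXn nX n 1].

(** Norm of Q_{I',I} : P_{I'}(X_n) -> P_I(X_n) (keep coefficients in I), I ⊆ I'. *)
Definition normQ (R : realType) (nX : (nat -> Cx R) -> R) (n : nat)
    (I' I : set (mi n)) : R :=
  inf [set C : R | 0 <= C /\
        forall c : mi n -> Cx R, supported I' c ->
          polynorm nX I c <= C * polynorm nX I' c].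
Arguments normQ {R} nX n I' I.

(** Projection constant of E = (P_I(X_n), polynorm):
    lambda(E) = sup over Banach spaces Y and isometric linear embeddings j : E -> Y
    of lambda(j E, Y) = inf { ||P|| : P : Y -> Y bounded linear projection onto j E }. *)
Definition rel_proj_const (R : realType) (n : nat) (I : set (mi n))
    (Y : completeNormedModType (Cx R)) (j : (mi n -> Cx R) -> Y) : R :=
  inf [set C : R | 0 <= C /\ exists P : {linear Y -> Y},
         (forall y, exists c, supported I c /\ P y = j c) /\
         (forall c, supported I c -> P (j c) = j c) /\
         (forall y, complex.Re `|P y| <= C * complex.Re `|y|)].

Definition proj_const_P (R : realType) (nX : (nat -> Cx R) -> R) (n : nat)
    (I : set (mi n)) : R :=
  sup [set l : R | exists (Y : completeNormedModType (Cx R))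
                         (j : (mi n -> Cx R) -> Y),
         (forall (t : Cx R) c d, supported I c -> supported I d ->
             j (fun a => t * c a + d a) = t *: j c + j d) /\
         (forall c, supported I c -> complex.Re `|j c| = polynorm nX I c) /\
         l = rel_proj_const I j].
Arguments proj_const_P {R} nX n I.

Definition bound_term (R : realType) (nX : (nat -> Cx R) -> R) (n : nat)
    (J : set (mi n)) (m : nat) : R :=
  ((expR 1 * normQ nX n (Lambda n m) (Jm J m)) `^ (m%:R^-1))^-1 *
  ((proj_const_P nX n (flat m (Jm J m))) `^ (m%:R^-1))^-1.
Arguments bound_term {R} nX n J m.

(* Main.v *)
(* For [f] bounded by [M] on the ball, Wiener's trick on complex lines gives
   [|f_m| <= 2 (M - |f(0)|)] for the homogeneous parts of degree [m > 0].  An [m]-homogeneous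
   polynomial [P] with coefficients in [J(m)] satisfies
   [sum |c_a z^a| <= 4^(m-1) e |Q| lambda |P|], after which
   [|f(0)| + sum_m 2 4^(m-1) / 6^m (M - |f(0)|) <= M].

   For the unconditional bound, embed [P_(J(m)^flat)] isometrically into the bounded functions on
   the ball and take a projection of norm close to [lambda].  Applied to the indicators of a fine
   finite partition of the ball it gives polynomials [p_w] with [sum_w p_w(z) g_w] of norm at most
   [lambda max |g_w|] and [sum_w w^b coef_b(p_w)] close to [1].  By Euler's identity
   [sum |c_a z^a|] is a sum over [k], [b] and [w] of products of a coefficient of [(d_k P)(w .) / m] and
   one of [z_k p_w(z .)], up to a small error.  Khinchine's inequality on the torus (constant
   [2^(m-1)], used twice) replaces these products of coefficients by products of values; choosing
   phases, the resulting sum is a value of a polynomial whose norm is controlled by [|Q|], [lambda]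
   and the polarization constant [(1 + 1/m)^m <= e].

   Cauchy's theorem is obtained by Goursat's bisection, for dyadic trapezoid sums. *)

Require Import Defs.
From HB Require Import structures.
From mathcomp Require Import all_boot all_order all_algebra.
From mathcomp Require Import all_classical all_reals all_analysis.
From mathcomp Require Import complex ring lra zify.
Set Implicit Arguments. Unset Strict Implicit. Unset Printing Implicit Defensive.
Import Order.TTheory GRing.Theory Num.Theory.
Import numFieldNormedType.Exports.
Local Open Scope classical_set_scope.
Local Open Scope ring_scope.

(** * Complex absolute values *)

(** Peeling one variable [z_k] off each monomial is what brings in [J(m)^flat] and lowers the degree
    in Khinchine's inequality to [m - 1]; its two uses cost [2^(m-1)] each, whence [4^(m-1)]. The
    price is a directional derivative of [P], paid for by the polarization constant. The polynomial
    assembled from the phases has monomials outside [J(m)], and discarding these costs [|Q|].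

    The projection acts on arbitrary bounded functions, where no integral kernel is at hand, so it
    is tested on step functions only: a finite partition turns it into finitely many polynomials
    [p_w], with an error that vanishes with the mesh. Contour and torus integrals are likewise
    finite sums over roots of unity of order [2^q]; identities such as orthogonality are then exact,
    and only Cauchy's formula requires [q] to grow.

    Real suprema and infima return 0 on bad sets. A nonpositive right-hand side is harmless because
    the Bohr radius is at least 0, and a positive one certifies that the constants in it are
    genuine. *)

Lemma leq_add4 (a b c d : nat) : let s := (a + b + c + d)%N in
  [/\ (a <= s)%N, (b <= s)%N, (c <= s)%N & (d <= s)%N].
Proof. by split; lia. Qed.

Section ComplexModulus.
Variable R : realType.
Local Notation C := (Cx R).
Implicit Types (z w : C) (x y : R).

Lemma norm_cabs z : `|z| = (cabs z)%:C%C.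
Proof. by case: z. Qed.

Lemma cabs_ge0 z : 0 <= cabs z.
Proof. by case: z => a b; rewrite sqrtr_ge0. Qed.

Lemma cabs0 : cabs (0 : C) = 0.
Proof. exact: ComplexField.Normc.normc0. Qed.

Lemma cabs1 : cabs (1 : C) = 1.
Proof. exact: ComplexField.Normc.normc1. Qed.

Lemma cabsM z w : cabs (z * w) = cabs z * cabs w.
Proof. exact: ComplexField.Normc.normcM. Qed.

Lemma cabsV z : cabs z^-1 = (cabs z)^-1.
Proof. exact: ComplexField.Normc.normcV. Qed.

Lemma cabsD z w : cabs (z + w) <= cabs z + cabs w.
Proof. exact: le_normcD. Qed.

Lemma cabsN z : cabs (- z) = cabs z.
Proof. exact: normcN. Qed.

Lemma cabsC z w : cabs (z - w) = cabs (w - z).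
Proof. by rewrite -cabsN opprB. Qed.

Lemma cabsB z w : cabs (z - w) <= cabs z + cabs w.
Proof. by rewrite -(cabsN w) cabsD. Qed.

Lemma cabs_eq0 z : (cabs z == 0) = (z == 0).
Proof.
apply/eqP/eqP => [/ComplexField.Normc.eq0_normc //|->]; exact: cabs0.
Qed.

Lemma cabs_gt0 z : (0 < cabs z) = (z != 0).
Proof. by rewrite lt_def cabs_eq0 cabs_ge0 andbT. Qed.

Lemma cabsX z k : cabs (z ^+ k) = cabs z ^+ k.
Proof. by elim: k => [|k IH]; rewrite ?expr0 ?cabs1 // !exprS cabsM IH. Qed.

Lemma cabs_cR x : cabs (cR x) = `|x|.
Proof. by rewrite /cabs /cR /= expr0n /= addr0 sqrtr_sqr. Qed.

Lemma cR0 : cR (0 : R) = 0. Proof. by []. Qed.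
Lemma cR1 : cR (1 : R) = 1. Proof. by []. Qed.
Lemma cRD x y : cR (x + y) = cR x + cR y.
Proof. by apply/eqP; rewrite eq_complex /= addr0 !eqxx. Qed.
Lemma cRN x : cR (- x) = - cR x.
Proof. by apply/eqP; rewrite eq_complex /= oppr0 !eqxx. Qed.
Lemma cRM x y : cR (x * y) = cR x * cR y.
Proof. by apply/eqP; rewrite eq_complex /= !mulr0 !mul0r subr0 addr0 !eqxx. Qed.

Lemma cR_nat k : cR (k%:R : R) = k%:R.
Proof. by elim: k => [//|k IH]; rewrite -addn1 !natrD cRD IH. Qed.

Lemma cRV x : cR x^-1 = (cR x)^-1.
Proof.
have [->|x0] := eqVneq x 0; first by rewrite invr0 cR0 invr0.
have cx0 : cR x != 0 by rewrite -cabs_eq0 cabs_cR normr_eq0.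
by apply: (mulfI cx0); rewrite -cRM !divff.
Qed.

Lemma cabs_nat k : cabs (k%:R : C) = k%:R.
Proof.
by rewrite -cR_nat cabs_cR normr_nat.
Qed.

Lemma cabs_sum (I : Type) (r : seq I) (P : pred I) (F : I -> C) :
  cabs (\sum_(i <- r | P i) F i) <= \sum_(i <- r | P i) cabs (F i).
Proof.
elim/big_rec2: _ => [|i x z _ le]; first by rewrite cabs0.
by rewrite (le_trans (cabsD _ _)) // lerD2l.
Qed.

Lemma eq_ler x y : x = y -> x <= y.
Proof. by move=> ->. Qed.

Lemma cabs_prod (I : Type) (r : seq I) (P : pred I) (F : I -> C) :
  cabs (\prod_(i <- r | P i) F i) = \prod_(i <- r | P i) cabs (F i).
Proof.
by elim/big_rec2: _ => [|i x z _ le]; rewrite ?cabs1 // cabsM le.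
Qed.

Lemma ReD z w : complex.Re (z + w) = complex.Re z + complex.Re w.
Proof. by case: z; case: w. Qed.

Lemma cabs_Re z : `|complex.Re z| <= cabs z.
Proof.
case: z => a b; rewrite /cabs /= -sqrtr_sqr ler_sqrt ?addr_ge0 ?sqr_ge0 //.
by rewrite lerDl sqr_ge0.
Qed.

Lemma cabs_Im z : `|complex.Im z| <= cabs z.
Proof.
case: z => a b; rewrite /cabs /= -sqrtr_sqr ler_sqrt ?addr_ge0 ?sqr_ge0 //.
by rewrite lerDr sqr_ge0.
Qed.

Lemma cabs_ReIm z : cabs z <= `|complex.Re z| + `|complex.Im z|.
Proof.
case: z => a b; have e : Complex a b = cR a + cR b * 'i%C :> C.
  by apply/eqP; rewrite eq_complex /= !(mulr0,mulr1,mul0r,mul1r,subr0,addr0,add0r,oppr0) !eqxx.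
rewrite [X in cabs X]e (le_trans (cabsD _ _)) // cabsM !cabs_cR.
suff -> : cabs ('i%C : C) = 1 by rewrite mulr1.
by rewrite /cabs /= expr0n expr1n add0r sqrtr1.
Qed.

End ComplexModulus.

(** * Goursat's theorem *)

Section Goursat.
Variable R : realType.
Local Notation C := (Cx R).
Implicit Types (F G : C -> C) (g : R -> C).

(** A nonstrict epsilon-delta form that also covers [w = z], so that it can be inserted directly
    into estimates; [has_cderivP] identifies it with the library derivative. *)
Definition has_cderiv F (z d : C) := forall e : R, 0 < e -> exists2 dl : R, 0 < dl &
  forall w, cabs (w - z) < dl -> cabs (F w - F z - d * (w - z)) <= e * cabs (w - z).

Definition cdiff F z := exists d, has_cderiv F z d.

Definition trap F (a b : C) : C := (F a + F b) / 2 * (b - a).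

(* Dyadic trapezoid sums for [F(w) dw] along the path [g] over [x, x + h]; they replace
   contour integrals throughout, and [bsum] is the one around the image under [E] of a square. *)
Definition psum F g (x h : R) (q : nat) : C :=
  \sum_(t < 2 ^ q) trap F (g (x + h * (t%:R / (2 ^ q)%:R)))
                          (g (x + h * (t.+1%:R / (2 ^ q)%:R))).

Definition bsum F (E : R -> R -> C) (x y h : R) (q : nat) : C :=
  psum F (E^~ y) x h q + psum F (E (x + h)) y h q
  - psum F (E^~ (y + h)) x h q - psum F (E x) y h q.

Lemma psum_split F g x h q :
  psum F g x h q.+1 = psum F g x (h / 2) q + psum F g (x + h / 2) (h / 2) q.
Proof.
have N0 : (2 ^ q)%:R != 0 :> R by rewrite pnatr_eq0 expn_eq0.
have N1 : (2 ^ q)%:R + (2 ^ q)%:R != 0 :> R.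
  by rewrite -natrD pnatr_eq0 addnn double_eq0 expn_eq0.
rewrite /psum; have -> : (2 ^ q.+1 = 2 ^ q + 2 ^ q)%N by rewrite expnS mul2n addnn.
rewrite big_split_ord /=; congr (_ + _); apply: eq_bigr => t _;
  congr (trap F (g _) (g _)); rewrite ?natrD -?addn1 ?natrD; field => //;
  by rewrite N0 N1.
Qed.

(** Each inner edge is traversed twice in opposite directions and cancels. A half edge carries half
    of the nodes, so the level drops from [q.+1] to [q] and the identity is exact. *)
Lemma bsum_split F E x y h q :
  bsum F E x y h q.+1 = bsum F E x y (h / 2) q + bsum F E (x + h / 2) y (h / 2) q
  + bsum F E x (y + h / 2) (h / 2) q + bsum F E (x + h / 2) (y + h / 2) (h / 2) q.
Proof.
have e2 : forall u : R, u + h / 2 + h / 2 = u + h by move=> u; field.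
rewrite /bsum !psum_split !e2; ring.
Qed.

Lemma psumB F G g x h q :
  psum (fun z => F z - G z) g x h q = psum F g x h q - psum G g x h q.
Proof. rewrite /psum -sumrB; apply: eq_bigr => t _; rewrite /trap; by field. Qed.

Lemma bsumB F G E x y h q :
  bsum (fun z => F z - G z) E x y h q = bsum F E x y h q - bsum G E x y h q.
Proof. rewrite /bsum !psumB; ring. Qed.

(** The trapezoid rule is exact for affine functions on every chord, with antiderivative
    [a w + d w^2 / 2]; the sum telescopes and depends on the end points only. *)
Lemma psum_affine (a d : C) g x h q :
  psum (fun z => a + d * z) g x h q =
  (a * g (x + h) + d / 2 * g (x + h) ^+ 2) - (a * g x + d / 2 * g x ^+ 2).
Proof.
have N0 : (2 ^ q)%:R != 0 :> R by rewrite pnatr_eq0 expn_eq0.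
pose f (t : nat) := a * g (x + h * (t%:R / (2 ^ q)%:R)) +
  d / 2 * g (x + h * (t%:R / (2 ^ q)%:R)) ^+ 2.
have e1 : x + h * ((2 ^ q)%:R / (2 ^ q)%:R) = x + h by rewrite divff // mulr1.
have e0 : x + h * (0%:R / (2 ^ q)%:R) = x by rewrite mul0r mulr0 addr0.
transitivity (f (2 ^ q)%N - f 0%N); last by rewrite /f e1 e0.
rewrite -telescope_sumr // big_mkord.
apply: eq_bigr => t _; rewrite /trap /f; by field.
Qed.

Lemma psum_le F g x h q (eta L : R) :
  0 <= h -> 0 <= eta ->
  (forall u, 0 <= u <= h -> cabs (F (g (x + u))) <= eta) ->
  (forall u v, 0 <= u <= h -> 0 <= v <= h ->
     cabs (g (x + u) - g (x + v)) <= L * `|u - v|) ->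
  cabs (psum F g x h q) <= eta * (L * h).
Proof.
move=> h0 eta0 hF hg.
have N0 : (0 : R) < (2 ^ q)%:R by rewrite ltr0n expn_gt0.
have inu (t : nat) : (t <= 2 ^ q)%N -> 0 <= h * (t%:R / (2 ^ q)%:R) <= h.
  move=> tN; rewrite mulr_ge0 ?divr_ge0 //= ler_piMr // ler_pdivrMr // mul1r ler_nat //.
apply: le_trans (cabs_sum _ _ _) _.
apply: (@le_trans _ _ (\sum_(t < 2 ^ q) eta * (L * (h / (2 ^ q)%:R)))); last first.
  rewrite sumr_const card_ord -mulr_natl -mulrCA; apply: eq_ler; field; exact: lt0r_neq0.
apply: ler_sum => t _; rewrite /trap cabsM.
have h1 := inu t (ltnW (ltn_ord t)); have h2 := inu t.+1 (ltn_ord t).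
apply: ler_pM => //; rewrite ?cabs_ge0 //.
  rewrite cabsM cabsV cabs_nat ler_pdivrMr ?ltr0n //.
  apply: le_trans (cabsD _ _) _; have := hF _ h1; have := hF _ h2; lra.
apply: le_trans (hg _ _ h2 h1) _; apply: eq_ler; congr (_ * _).
have -> : h * (t.+1%:R / (2 ^ q)%:R) - h * (t%:R / (2 ^ q)%:R) = h / (2 ^ q)%:R :> R.
  rewrite -addn1 natrD; field; exact: lt0r_neq0.
by rewrite ger0_norm // divr_ge0 // ltW.
Qed.

(** Affine functions sum to 0 around the boundary, so [F] may be replaced by its difference from
    one; each of the four sides then contributes at most [eta L h]. *)
Lemma bsum_le F E x y h q (a d : C) (eta L : R) :
  0 <= h -> 0 <= eta ->
  (forall u v, 0 <= u <= h -> 0 <= v <= h ->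
     cabs (F (E (x + u) (y + v)) - (a + d * E (x + u) (y + v))) <= eta) ->
  (forall u v u' v', 0 <= u <= h -> 0 <= v <= h -> 0 <= u' <= h -> 0 <= v' <= h ->
     cabs (E (x + u) (y + v) - E (x + u') (y + v')) <= L * (`|u - u'| + `|v - v'|)) ->
  cabs (bsum F E x y h q) <= 4 * (eta * (L * h)).
Proof.
move=> h0 eta0 hF hE.
have : bsum (fun z => a + d * z) E x y h q = 0 by rewrite /bsum !psum_affine; ring.
move=> aff0; have -> : bsum F E x y h q = bsum (fun z => F z - (a + d * z)) E x y h q.
  by rewrite bsumB aff0 subr0.
set G := fun z => _.
have i0 : 0 <= (0 : R) <= h by rewrite lexx h0.
have ih : 0 <= h <= h by rewrite lexx h0.
have e0 : forall u : R, u + 0 = u by move=> u; rewrite addr0.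
have k1 v : 0 <= v <= h -> cabs (psum G (E^~ (y + v)) x h q) <= eta * (L * h).
  move=> hv; apply: psum_le => // [u hu|u u' hu hu']; first exact: hF.
  by apply: le_trans (hE _ _ _ _ hu hv hu' hv) _; rewrite subrr normr0 addr0.
have k2 u : 0 <= u <= h -> cabs (psum G (E (x + u)) y h q) <= eta * (L * h).
  move=> hu; apply: psum_le => // [v hv|v v' hv hv']; first exact: hF.
  by apply: le_trans (hE _ _ _ _ hu hv hu hv') _; rewrite subrr normr0 add0r.
rewrite /bsum.
have := k1 0 i0; have := k1 h ih; have := k2 0 i0; have := k2 h ih; rewrite !e0.
move=> j1 j2 j3 j4; apply: le_trans (cabsB _ _) _.
apply: le_trans (lerD (le_trans (cabsB _ _) (lerD (cabsD _ _) (lexx _))) (lexx _)) _.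
lra.
Qed.

(** [E] is any Lipschitz map of the unit square, which allows it to be a homotopy between two
    circles. If the conclusion fails, repeated quartering produces squares shrinking to a point
    whose sums stay above [e h^2], against the affine approximation of [F] at the image of that
    point. *)
Lemma goursat F (E : R -> R -> C) (L : R) :
  0 < L ->
  (forall u v u' v', 0 <= u <= 1 -> 0 <= v <= 1 -> 0 <= u' <= 1 -> 0 <= v' <= 1 ->
     cabs (E u v - E u' v') <= L * (`|u - u'| + `|v - v'|)) ->
  (forall u v, 0 <= u <= 1 -> 0 <= v <= 1 -> cdiff F (E u v)) ->
  forall e : R, 0 < e -> exists q0 : nat, forall q, (q0 <= q)%N ->
    cabs (bsum F E 0 0 1 q) <= e.
Proof.
move=> L0 hE hF e e0; apply: contrapT => nex.
(* Badness asks for large sums at arbitrarily high levels [q], so that the thresholds of four good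
   quarters merge into one threshold for the whole square. *)
pose bad x y h := forall q0 : nat, exists2 q, (q0 <= q)%N &
  e * h ^+ 2 < cabs (bsum F E x y h q).
have bad0 : bad 0 0 1.
  move=> q0; apply: contrapT => nq; apply: nex; exists q0 => q hq.
  by rewrite leNgt; apply/negP => hlt; apply: nq; exists q => //; rewrite expr1n mulr1.
have split_bad x y h : bad x y h -> exists p : R * R,
   [/\ bad p.1 p.2 (h / 2), (p.1 == x) || (p.1 == x + h / 2) &
       (p.2 == y) || (p.2 == y + h / 2)].
  move=> hb; apply: contrapT => np.
  have good x' y' : (x' == x) || (x' == x + h / 2) -> (y' == y) || (y' == y + h / 2) ->
    exists q0 : nat, forall q, (q0 <= q)%N -> cabs (bsum F E x' y' (h / 2) q) <= e * (h / 2) ^+ 2.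
    move=> hx hy; apply: contrapT => nq; apply: np; exists (x', y'); split=> //= q0.
    apply: contrapT => nn; apply: nq; exists q0 => q hq; rewrite leNgt; apply/negP => hlt.
    by apply: nn; exists q.
  have [||q1 h1] := good x y; rewrite ?eqxx ?orbT //.
  have [||q2 h2] := good (x + h / 2) y; rewrite ?eqxx ?orbT //.
  have [||q3 h3] := good x (y + h / 2); rewrite ?eqxx ?orbT //.
  have [||q4 h4] := good (x + h / 2) (y + h / 2); rewrite ?eqxx ?orbT //.
  (* The whole square at level [q.+1] consists of quarters at level [q], hence the successor. *)
  have [[|q]] := hb (q1 + q2 + q3 + q4).+1 => // hq.
  rewrite bsum_split ltNge => /negP; apply.
  have {h1}h1 := h1 q ltac:(lia); have {h2}h2 := h2 q ltac:(lia).
  have {h3}h3 := h3 q ltac:(lia); have {h4}h4 := h4 q ltac:(lia).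
  have e4 : e * (h / 2) ^+ 2 = e * h ^+ 2 / 4 by field.
  rewrite !e4 in h1 h2 h3 h4.
  apply: le_trans (cabsD _ _) _.
  apply: le_trans (lerD (le_trans (cabsD _ _) (lerD (cabsD _ _) (lexx _))) (lexx _)) _.
  lra.
pose hk (k : nat) : R := 2^-1 ^+ k.
have hk0 k : 0 < hk k by rewrite exprn_gt0 // invr_gt0.
have hkS k : hk k.+1 = hk k / 2 by rewrite /hk exprS mulrC.
have [nxt hnxt] : {nxt : nat * (R * R) -> R * R & forall kp,
   bad kp.2.1 kp.2.2 (hk kp.1) ->
   [/\ bad (nxt kp).1 (nxt kp).2 (hk kp.1.+1),
    kp.2.1 <= (nxt kp).1 <= kp.2.1 + hk kp.1.+1 &
    kp.2.2 <= (nxt kp).2 <= kp.2.2 + hk kp.1.+1]}.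
  apply: (@choice _ _ (fun kp p' => bad kp.2.1 kp.2.2 (hk kp.1) ->
   [/\ bad p'.1 p'.2 (hk kp.1.+1),
    kp.2.1 <= p'.1 <= kp.2.1 + hk kp.1.+1 &
    kp.2.2 <= p'.2 <= kp.2.2 + hk kp.1.+1])) => -[k [x y]] /=.
  have [hb|hnb] := pselect (bad x y (hk k)); last by exists (0, 0).
  have [[x' y'] /= [h1 h2 h3]] := split_bad _ _ _ hb; exists (x', y') => _ /=.
  have := hk0 k.+1; rewrite hkS => hp.
  split=> //; [case/orP: h2 => /eqP ->|case/orP: h3 => /eqP ->]; lra.
pose s := fix s k := if k is k'.+1 then nxt (k', s k') else (0, 0) : R * R.
have sbad k : bad (s k).1 (s k).2 (hk k).
  by elim: k => [//|k IH] /=; have [] := hnxt (k, s k) IH.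
have [s1 s2] : (forall k, (s k).1 <= (s k.+1).1 <= (s k).1 + hk k.+1) /\
               (forall k, (s k).2 <= (s k.+1).2 <= (s k).2 + hk k.+1).
  by split=> k; have [] := hnxt (k, s k) (sbad k).
have nest (u : nat -> R) : u 0%N = 0 -> (forall k, u k <= u k.+1 <= u k + hk k.+1) ->
   exists c, 0 <= c <= 1 /\ forall k, 0 <= u k /\ u k + hk k <= 1 /\ u k <= c <= u k + hk k.
  move=> u0 us.
  have up k l : u k <= u (l + k)%N.
    elim: l => [//|l IH]; apply: le_trans IH _; by have /andP[] := us (l + k)%N.
  have dn k l : u (l + k)%N + hk (l + k)%N <= u k + hk k.
    elim: l => [//|l IH]; apply: le_trans IH; rewrite addSn.
    have := us (l + k)%N; rewrite hkS; lra.
  have cross k l : u k <= u l + hk l.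
    have := up k l; have := dn l k; rewrite addnC; have := hk0 (l + k)%N; lra.
  have hs : has_sup (range u).
    split; first by exists (u 0%N), 0%N.
    by exists (u 0%N + hk 0%N) => _ [k _ <-]; exact: cross.
  exists (sup (range u)).
  have ub k : u k <= sup (range u) by apply: ub_le_sup; [case: hs|exists k].
  have lb k : sup (range u) <= u k + hk k.
    apply: ge_sup; first by case: hs.
    by move=> _ [l _ <-]; exact: cross.
  have hk00 : hk 0%N = 1 by rewrite /hk expr0.
  split; first by have := ub 0%N; have := lb 0%N; rewrite u0 hk00 add0r => -> ->.
  move=> k; split; first by have := up 0%N k; rewrite addn0 u0.
  split; first by have := dn 0%N k; rewrite addn0 u0 hk00 add0r.
  by rewrite ub lb.
have [//|x [hx1 hx]] := nest (fun k => (s k).1) _ s1.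
have [//|y [hy1 hy]] := nest (fun k => (s k).2) _ s2.
have [d hd] := hF x y hx1 hy1.
(* In a square of side [h] the images stay within [2 L h] of [E x y], so [bsum_le] will give
   [4 (2 e' L h) (L h) = 8 e' L^2 h^2], which is half of [e h^2]. *)
pose e' := e / (16 * L ^+ 2).
have e'0 : 0 < e' by rewrite divr_gt0 // mulr_gt0 // exprn_gt0.
have [dl dl0 hdl] := hd e' e'0.
have [k hkk] : exists k, 2 * L * hk k < dl.
  have /(_ (2 * L / dl))[k hk'] : forall t : R, exists k : nat, t < 2 ^+ k.
    move=> t; exists (Num.truncn `|t|).+1; apply: le_lt_trans (ler_norm _) _.
    apply: lt_trans (truncnS_gt _) _; rewrite -natrX ltr_nat; exact: ltn_expl.
  exists k; move: hk'; rewrite /hk ltr_pdivrMr // => hk'.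
  by rewrite exprVn ltr_pdivrMr ?exprn_gt0 // [dl * _]mulrC.
have [x0 [x1 x2]] := hx k; have [y0 [y1 y2]] := hy k.
have [q _] := sbad k 0%N; rewrite ltNge => /negP; apply.
have inx u : 0 <= u <= hk k -> 0 <= (s k).1 + u <= 1 by move=> hu; lra.
have iny u : 0 <= u <= hk k -> 0 <= (s k).2 + u <= 1 by move=> hu; lra.
apply: le_trans (@bsum_le F E (s k).1 (s k).2 (hk k) q
   (F (E x y) - d * E x y) d (e' * (2 * L * hk k)) L _ _ _ _) _.
- exact: ltW.
- have := hk0 k => hk0k; apply: mulr_ge0; first exact: ltW.
  by apply: mulr_ge0; [lra|exact: ltW].
- move=> u v hu hv.
  have hdist : cabs (E ((s k).1 + u) ((s k).2 + v) - E x y) <= 2 * L * hk k.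
    apply: le_trans (hE _ _ _ _ (inx _ hu) (iny _ hv) hx1 hy1) _.
    have n1 : `|(s k).1 + u - x| <= hk k by rewrite ler_norml; lra.
    have n2 : `|(s k).2 + v - y| <= hk k by rewrite ler_norml; lra.
    by rewrite -mulrA mulrCA ler_pM2l //; lra.
  set z := E _ _.
  have -> : F z - (F (E x y) - d * E x y + d * z) = F z - F (E x y) - d * (z - E x y).
    by ring.
  apply: le_trans (hdl _ (le_lt_trans hdist hkk)) _.
  by rewrite ler_pM2l.
- move=> u v u' v' hu hv hu' hv'.
  apply: le_trans (hE _ _ _ _ (inx _ hu) (iny _ hv) (inx _ hu') (iny _ hv')) _.
  have eb (a b b' : R) : a + b - (a + b') = b - b' by ring.
  by rewrite !eb.
have -> : 4 * (e' * (2 * L * hk k) * (L * hk k)) = e * hk k ^+ 2 / 2.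
  rewrite /e'; field; exact: lt0r_neq0.
have : 0 < e * hk k ^+ 2 by rewrite mulr_gt0 // exprn_gt0.
lra.
Qed.

End Goursat.

(** * Circle averages *)

Section Circle.
Variable R : realType.
Local Notation C := (Cx R).
Implicit Types (F G : C -> C).

Lemma mean_value_le (f df : R -> R) (a b K : R) : a <= b ->
  (forall x, a <= x <= b -> is_derive x 1 f (df x)) ->
  (forall x, a <= x <= b -> `|df x| <= K) -> `|f b - f a| <= K * (b - a).
Proof.
move=> ab hd hK.
have [||c cab ->] := @MVT_segment R f df a b ab.
- by move=> x; rewrite in_itv /= => /andP[h1 h2]; apply: hd; rewrite !ltW.
- apply: derivable_within_continuous => x; rewrite in_itv /= => hx.
  by have [] := hd x hx.
rewrite normrM [`|b - a|]ger0_norm ?subr_ge0 // ler_wpM2r ?subr_ge0 //.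
by apply: hK; move: cab; rewrite in_itv.
Qed.

Lemma lipschitz_cos (x y : R) : `|cos x - cos y| <= `|x - y|.
Proof.
wlog xy : x y / y <= x.
  by move=> H; have [/H //|/ltW/H] := leP y x; rewrite distrC [X in _ <= X]distrC.
rewrite [X in _ <= X]ger0_norm ?subr_ge0 // -[X in _ <= X]mul1r.
apply: (@mean_value_le cos (fun x => - sin x)) => // z _.
by rewrite normrN sin_max.
Qed.

Lemma lipschitz_sin (x y : R) : `|sin x - sin y| <= `|x - y|.
Proof.
have e z : sin z = cos (z - pi / 2) :> R by rewrite cosBpihalf.
rewrite !e; apply: le_trans (lipschitz_cos _ _) _.
by apply: eq_ler; congr `|_|; ring.
Qed.

Definition unitc (t : R) : C := Complex (cos (2 * pi * t)) (sin (2 * pi * t)).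

Lemma unitcD s t : unitc (s + t) = unitc s * unitc t.
Proof.
apply/eqP; rewrite eq_complex /= mulrDr cosD sinD eqxx /= [cos _ * sin _ + _]addrC.
by rewrite addrC.
Qed.

Lemma unitc0 : unitc 0 = 1.
Proof. by rewrite /unitc mulr0 cos0 sin0. Qed.

Lemma unitc1 : unitc 1 = 1.
Proof. by rewrite /unitc mulr1 mulr_natl cos2pi sin2pi. Qed.

Lemma unitc_half : unitc 2^-1 = -1.
Proof.
by rewrite /unitc mulrAC divff // mul1r cospi sinpi; apply/eqP; rewrite eq_complex /= oppr0 !eqxx.
Qed.

Lemma cabs_unitc t : cabs (unitc t) = 1.
Proof. by rewrite /cabs /= cos2Dsin2 sqrtr1. Qed.

Lemma unitc_neq0 t : unitc t != 0.
Proof. by rewrite -cabs_eq0 cabs_unitc oner_eq0. Qed.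

Lemma unitcX t k : unitc t ^+ k = unitc (k%:R * t).
Proof.
elim: k => [|k IH]; first by rewrite mul0r unitc0.
by rewrite exprS IH -unitcD -addn1 natrD mulrDl mul1r addrC.
Qed.

(** Twice the sharp constant [2 pi]: the bounds for the cosine and the sine are simply added. *)
Definition unitc_lip : R := 4 * pi.

Lemma unitc_lip_gt0 : 0 < unitc_lip.
Proof. by rewrite mulr_gt0 // pi_gt0. Qed.

Lemma lipschitz_unitc s t : cabs (unitc s - unitc t) <= unitc_lip * `|s - t|.
Proof.
apply: le_trans (cabs_ReIm _) _ => /=.
have p0 : 0 < 2 * pi :> R by rewrite mulr_gt0 // pi_gt0.
have e : `|2 * pi * s - 2 * pi * t| = 2 * pi * `|s - t|.
  by rewrite -mulrBr normrM gtr0_norm.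
have := lipschitz_cos (2 * pi * s) (2 * pi * t).
have := lipschitz_sin (2 * pi * s) (2 * pi * t).
by rewrite !e /unitc_lip; lra.
Qed.

Definition omega (q : nat) : C := unitc (2 ^ q)%:R^-1.

Lemma pow2_gt0 q : (0 : R) < (2 ^ q)%:R.
Proof. by rewrite ltr0n expn_gt0. Qed.

Lemma pow2_neq0 q : (2 ^ q)%:R != 0 :> R.
Proof. exact/lt0r_neq0/pow2_gt0. Qed.

Lemma omegaX q k : omega q ^+ k = unitc (k%:R / (2 ^ q)%:R).
Proof. by rewrite unitcX. Qed.

Lemma omega_order q : omega q ^+ (2 ^ q) = 1.
Proof. by rewrite omegaX divff ?pow2_neq0 // unitc1. Qed.

(** The order divides [2 ^ q], hence is [2 ^ k]; with [k < q] the power of exponent [2 ^ q.-1] would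
    be 1, but it is [exp (pi i) = -1]. *)
Lemma omega_prim q : (2 ^ q).-primitive_root (omega q).
Proof.
have [m hm] := @prim_order_exists _ (2 ^ q) (omega q) ltac:(by rewrite expn_gt0) (omega_order q).
case/(dvdn_pfactor _ _ (isT : prime 2)) => k kq em; rewrite em in hm.
move: kq; rewrite leq_eqVlt => /orP[/eqP kq|kq]; first by rewrite kq in hm.
have hm1 := prim_expr_order hm.
have : omega q ^+ (2 ^ q.-1) = -1.
  case: q {hm em hm1} kq => [//|q] _; rewrite omegaX -unitc_half /= expnS natrM; congr unitc; field.
  by rewrite pow2_neq0.
have -> : (2 ^ q.-1 = 2 ^ k * 2 ^ (q.-1 - k))%N by rewrite -expnD subnKC //; lia.
rewrite exprM hm1 expr1n => /eqP.
by rewrite eq_sym eqr_oppLR -subr_eq0 opprK (_ : 1 + 1 = 2%:R) // pnatr_eq0.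
Qed.

Lemma omega_neq0 q : omega q != 0.
Proof. exact: unitc_neq0. Qed.

Lemma cabs_omega q : cabs (omega q) = 1.
Proof. exact: cabs_unitc. Qed.

Lemma sum_omega q (k : nat) : ~~ (2 ^ q %| k)%N ->
  \sum_(t < 2 ^ q) (omega q ^+ k) ^+ t = 0.
Proof.
rewrite (prim_order_dvd (omega_prim q)) => h.
apply: (@mulfI _ (omega q ^+ k - 1)); first by rewrite subr_eq0.
by rewrite -subrX1 mulr0 -exprM mulnC exprM omega_order expr1n subrr.
Qed.

(* The trapezoid sum of [dw / (w - c)] around a circle: it plays the role of [2 pi i]. *)
Definition cnorm (q : nat) : C := (2 ^ q)%:R * (omega q - (omega q)^-1) / 2.

Lemma omegaV q : (omega q)^-1 = unitc (- (2 ^ q)%:R^-1).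
Proof.
apply: (mulIf (omega_neq0 q)); rewrite mulVf ?omega_neq0 // -unitcD addNr.
by rewrite unitc0.
Qed.

Lemma cabs_cnorm q : cabs (cnorm q) = (2 ^ q)%:R * `|sin (2 * pi / (2 ^ q)%:R)|.
Proof.
have -> : cnorm q = (2 ^ q)%:R * Complex 0 (sin (2 * pi / (2 ^ q)%:R)).
  rewrite /cnorm -mulrA; congr (_ * _); rewrite omegaV /omega /unitc mulrN cosN sinN.
  apply: (@mulIf _ 2) => //; rewrite mulfVK // mulr_natr mulr2n.
  by apply/eqP; rewrite eq_complex /= subrr addr0 opprK !eqxx.
by rewrite cabsM cabs_nat /cabs /= expr0n add0r sqrtr_sqr.
Qed.

(** By the double-angle formula [N |sin (2 pi / N)|] does not decrease when [N] doubles, and it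
    equals 4 at [N = 4]. A bound away from 0 suffices, so the limit [2 pi] is never computed. *)
Lemma cnorm_ge q : (2 <= q)%N -> 4 <= cabs (cnorm q).
Proof.
case: q => [//|[//|q]] _; elim: q => [|q IH].
  rewrite cabs_cnorm (_ : 2 * pi / _ = pi / 2); last by field.
  by rewrite sin_pihalf normr1 mulr1 ler_nat.
apply: le_trans IH _; rewrite !cabs_cnorm [(2 ^ q.+3)%N]expnS natrM.
set N := (2 ^ q.+2)%:R; have N0 : N != 0 := pow2_neq0 _.
have -> : 2 * pi / N = (2 * pi / (2 * N)) *+ 2 by rewrite mulr2n; field.
rewrite sin_mulr2n -mulr_natl !normrM normr_nat.
set s := `|sin _|; have := cos_max (2 * pi / (2 * N)); set c := `|cos _| => hc.
have s0 : 0 <= s by exact: normr_ge0.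
have c0 : 0 <= c by exact: normr_ge0.
have NN : 0 < N by exact: pow2_gt0.
rewrite (_ : 2 * N * s = N * (2 * s)); last by ring.
by rewrite !ler_pM2l // ler_piMl.
Qed.

Lemma cnorm_le q : cabs (cnorm q) <= unitc_lip.
Proof.
rewrite /cnorm !cabsM cabsV !cabs_nat omegaV.
have := lipschitz_unitc (2 ^ q)%:R^-1 (- (2 ^ q)%:R^-1).
have N0 := pow2_gt0 q.
have i0 : 0 < (2 ^ q)%:R^-1 :> R by rewrite invr_gt0.
rewrite (_ : `|_ - _| = 2 * (2 ^ q)%:R^-1); last first.
  by rewrite opprK gtr0_norm; [ring|rewrite addr_gt0].
move=> h; rewrite ler_pdivrMr //.
apply: le_trans (ler_wpM2l (ltW N0) h) _; apply: eq_ler; field.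
exact: lt0r_neq0.
Qed.

Definition circ (c : C) (r t : R) : C := c + cR r * unitc t.

Definition cavg F (c : C) (r : R) (q : nat) : C :=
  (\sum_(t < 2 ^ q) F (c + cR r * omega q ^+ t)) / (2 ^ q)%:R.

(** In [trap] the kernel [1 / (w - c)] cancels the radius: the two end values get the weights
    [(om - 1) / 2] and [(1 - om^-1) / 2], which add up to [(om - om^-1) / 2] after a cyclic shift of
    the nodes. No limit in [q] is involved. *)
Lemma psum_circ F (c : C) (r : R) q : r != 0 ->
  psum (fun w => F w / (w - c)) (circ c r) 0 1 q = cnorm q * cavg F c r q.
Proof.
move=> r0; rewrite /psum.
have N0 : (2 ^ q)%:R != 0 :> C by rewrite -cabs_eq0 cabs_nat pow2_neq0.
have cr0 : cR r != 0 :> C by rewrite -cabs_eq0 cabs_cR normr_eq0.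
have w0 := omega_neq0 q.
pose f (t : nat) := F (c + cR r * omega q ^+ t).
transitivity (\sum_(t < 2 ^ q) (f t * (omega q - 1) / 2 + f t.+1 * (1 - (omega q)^-1) / 2)).
  apply: eq_bigr => t _; rewrite /trap /circ !add0r !mul1r -!omegaX -!/(f _) /f exprS.
  have : omega q ^+ t != 0 by rewrite expf_neq0.
  have e x : c + x - c = x :> C by ring.
  rewrite /= !e; set a := F (c + cR r * (omega q * _)); set b := F _.
  move: a b (omega q ^+ t) (omega q) (cR r : C) w0 cr0 => a b wt w r' w0 r'0 wt0.
  by field; rewrite r'0 w0 wt0.
have shift : \sum_(t < 2 ^ q) f t.+1 = \sum_(t < 2 ^ q) f t.
  rewrite -(big_mkord xpredT (fun t => f t.+1)) -(big_mkord xpredT f).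
  apply/eqP; rewrite -subr_eq0 -sumrB telescope_sumr //.
  by rewrite /f omega_order expr0 subrr.
rewrite big_split /= -!mulr_suml shift /cavg /cnorm -/(f _).
by field; rewrite w0 N0.
Qed.

Lemma cavg_le F (c : C) (r : R) q (M : R) : 0 <= r -> (forall w, cabs (w - c) = r -> cabs (F w) <= M) ->
  cabs (cavg F c r q) <= M.
Proof.
move=> r0 h; rewrite /cavg cabsM cabsV cabs_nat ler_pdivrMr ?pow2_gt0 //.
apply: le_trans (cabs_sum _ _ _) _.
apply: (@le_trans _ _ (\sum_(t < 2 ^ q) M)).
  apply: ler_sum => t _; apply: h; rewrite addrC addKr cabsM cabs_cR cabsX cabs_omega.
  by rewrite expr1n mulr1 ger0_norm.
by rewrite sumr_const card_ord mulr_natr.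
Qed.

Lemma psum_circ_le F (c : C) (r : R) q (M : R) : 0 <= r -> 0 <= M ->
  (forall w, cabs (w - c) = r -> cabs (F w) <= M) ->
  cabs (psum F (circ c r) 0 1 q) <= M * (unitc_lip * r).
Proof.
move=> r0 M0 h; rewrite -[unitc_lip * r]mulr1; apply: psum_le => // [u _|u v _ _].
  by apply: h; rewrite /circ addrC addKr cabsM cabs_cR cabs_unitc mulr1 ger0_norm.
rewrite /circ !add0r opprD addrACA subrr add0r -mulrBr cabsM cabs_cR ger0_norm //.
by rewrite mulrAC mulrC ler_wpM2r // lipschitz_unitc.
Qed.

End Circle.

(** * Complex derivatives *)

Section Cauchy.
Variable R : realType.
Local Notation C := (Cx R).
Implicit Types (F G g : C -> C).

Lemma complex_gt0 (e : C) : 0 < e -> exists2 x : R, 0 < x & e = cR x.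
Proof. by case: e => a b /andP[/= /eqP -> a0]; exists a. Qed.

Lemma cR_gt0 (x : R) : ((0 : C) < cR x) = (0 < x).
Proof. exact: (ltcR 0 x). Qed.

Lemma norm_le_cR (z : C) (x : R) : (`|z| <= cR x) = (cabs z <= x).
Proof. by rewrite norm_cabs; exact: lecR. Qed.

Lemma norm_lt_cR (z : C) (x : R) : (`|z| < cR x) = (cabs z < x).
Proof. by rewrite norm_cabs; exact: ltcR. Qed.

Lemma has_cderiv_cvg F z d :
  has_cderiv F z d <-> (fun t => t^-1 *: (F (t%:A + z) - F z)) @ (0 : C)^' --> d.
Proof.
have tA (t : C) : t%:A = t by rewrite /GRing.scale /= mulr1.
split=> [hd|/cvgrPdist_le hd].
  apply/cvgrPdist_le => e /complex_gt0[x x0 ->].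
  have [dl dl0 h] := hd x x0; apply/nbhs_ballP; exists (cR dl); first by rewrite /= cR_gt0.
  move=> t; rewrite -ball_normE /= sub0r normrN norm_lt_cR => tdl t0.
  rewrite norm_le_cR cabsC tA.
  have tn : 0 < cabs t by rewrite cabs_gt0.
  have := h (t + z); rewrite addrK => /(_ tdl).
  have -> : t^-1 *: (F (t + z) - F z) - d = (F (t + z) - F z - d * t) / t.
    by rewrite /GRing.scale /=; field.
  by rewrite cabsM cabsV ler_pdivrMr.
move=> e e0.
have /hd/nbhs_ballP[b /= /complex_gt0[dl dl0 ->] hb] : (0 : C) < cR e by rewrite cR_gt0.
exists dl => // w hw; have [->|wz] := eqVneq w z.
  by rewrite !subrr mulr0 subrr cabs0 mulr0.
have wz0 : w - z != 0 by rewrite subr_eq0.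
have := hb (w - z); rewrite -ball_normE /= sub0r normrN norm_lt_cR => /(_ hw wz0).
rewrite tA subrK norm_le_cR cabsC => h.
have -> : F w - F z - d * (w - z) = ((w - z)^-1 *: (F w - F z) - d) * (w - z).
  by rewrite /GRing.scale /=; field.
by rewrite cabsM ler_wpM2r ?cabs_ge0.
Qed.

Lemma has_cderivP F z d : has_cderiv F z d <-> is_derive z 1 F d.
Proof.
split=> [/has_cderiv_cvg hd|hF].
  by apply: DeriveDef; [apply/cvg_ex; exists d|exact: cvg_lim].
have [/cvg_ex[d' hd'] <-] := hF; apply/has_cderiv_cvg.
by rewrite (_ : 'D_1 F z = d') //; exact: cvg_lim.
Qed.

Lemma cdiffP F z : cdiff F z <-> derivable F z 1.
Proof.
split=> [[d /has_cderivP[]//]|h]; exists ('D_1 F z).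
by apply/has_cderivP; exact: DeriveDef.
Qed.

Lemma cdiff_cst (c z : C) : cdiff (fun _ => c) z.
Proof. by apply/cdiffP; exact: derivable_cst. Qed.

Lemma cdiff_id (z : C) : cdiff id z.
Proof. by apply/cdiffP; exact: derivable_id. Qed.

Lemma cdiffD F G z : cdiff F z -> cdiff G z -> cdiff (fun w => F w + G w) z.
Proof. by move=> /cdiffP f /cdiffP g; apply/cdiffP; exact: (derivableD f g). Qed.

Lemma cdiffN F z : cdiff F z -> cdiff (fun w => - F w) z.
Proof. by move=> /cdiffP f; apply/cdiffP; exact: (derivableN f). Qed.

Lemma cdiffB F G z : cdiff F z -> cdiff G z -> cdiff (fun w => F w - G w) z.
Proof. by move=> f g; apply: cdiffD f (cdiffN g). Qed.

Lemma cdiffM F G z : cdiff F z -> cdiff G z -> cdiff (fun w => F w * G w) z.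
Proof. by move=> /cdiffP f /cdiffP g; apply/cdiffP; exact: (derivableM f g). Qed.

Lemma cdiffV F z : F z != 0 -> cdiff F z -> cdiff (fun w => (F w)^-1) z.
Proof. by move=> h /cdiffP f; apply/cdiffP; exact: (derivableV h f). Qed.

Lemma cdiffX F z k : cdiff F z -> cdiff (fun w => F w ^+ k) z.
Proof.
move=> f; elim: k => [|k IH].
  by rewrite (_ : (fun w => F w ^+ 0) = (fun _ => 1)); [exact: cdiff_cst|exact/funext].
rewrite (_ : (fun w => F w ^+ k.+1) = (fun w => F w * F w ^+ k)); first exact: cdiffM.
by apply/funext => w; rewrite exprS.
Qed.

Lemma cdiff_sum (I : Type) (r : seq I) (P : pred I) (F : I -> C -> C) z :
  (forall i, cdiff (F i) z) -> cdiff (fun w => \sum_(i <- r | P i) F i w) z.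
Proof.
move=> h; elim: r => [|i r IH].
  rewrite (_ : (fun w => _) = (fun _ => 0)); first exact: cdiff_cst.
  by apply/funext => w; rewrite big_nil.
rewrite (_ : (fun w => _) = (fun w => (if P i then F i w else 0) + \sum_(i <- r | P i) F i w)).
  by apply: cdiffD => //; case: (P i); [exact: h|exact: cdiff_cst].
by apply/funext => w; rewrite big_cons; case: (P i); rewrite ?add0r.
Qed.

Lemma cdiff_near F G z (dl : R) : 0 < dl -> (forall w, cabs (w - z) < dl -> F w = G w) ->
  cdiff F z -> cdiff G z.
Proof.
move=> dl0 FG [d hd]; exists d => e /hd[dl' dl'0 h]; exists (Num.min dl dl').
  by rewrite lt_min dl0.
move=> w; rewrite lt_min => /andP[h1 h2]; rewrite -!FG // ?h // subrr cabs0 //.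
Qed.

Definition ccont F (z : C) := forall e : R, 0 < e -> exists2 dl : R, 0 < dl &
  forall w, cabs (w - z) < dl -> cabs (F w - F z) <= e.

Lemma has_cderiv_cont F z d : has_cderiv F z d -> ccont F z.
Proof.
move=> hd e e0; have [dl dl0 h] := hd 1 ltr01.
have K0 : 0 < 1 + cabs d by rewrite ltr_wpDr ?cabs_ge0.
exists (Num.min dl (e / (1 + cabs d))); first by rewrite lt_min dl0 divr_gt0.
move=> w; rewrite lt_min ltr_pdivlMr // => /andP[/h h1 h2].
have -> : F w - F z = (F w - F z - d * (w - z)) + d * (w - z) by ring.
apply: le_trans (cabsD _ _) _; rewrite cabsM; have := cabs_ge0 (w - z); nra.
Qed.

(** Goursat's theorem for [g w / (w - z)] and a homotopy [E] from a small circle about [z] to the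
    circle about 0. On the small circle the sum is [cnorm] times an average of [g], close to [g z]
    by continuity. Asking only for continuity at [z] makes the formula apply to functions with a
    removable singularity there. *)
Lemma cauchy_formula g (z : C) (r rho : R) : cabs z < r -> r < rho ->
  (forall w, cabs w < rho -> w != z -> cdiff g w) -> ccont g z ->
  forall e : R, 0 < e -> exists q0 : nat, forall q, (q0 <= q)%N ->
  cabs (psum (fun w => g w / (w - z)) (circ 0 r) 0 1 q - cnorm R q * g z) <= e.
Proof.
move=> zr rrho hg gc e e0.
have r0 : 0 < r by apply: le_lt_trans zr; exact: cabs_ge0.
have L0 := unitc_lip_gt0 R.
have [|dl dl0 hdl] := gc (e / (2 * unitc_lip R)); first by rewrite divr_gt0 // mulr_gt0.
(* The first bound puts the small circle where [g] is close to [g z]; the second gives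
   [cabs z + a <= r], which keeps the homotopy inside the disc of radius [r]. *)
have [a [a0 ad ar]] : exists a : R, [/\ 0 < a, a <= dl / 2 & a <= (r - cabs z) / 2].
  exists (Num.min (dl / 2) ((r - cabs z) / 2)); rewrite lt_min !divr_gt0 ?subr_gt0 //.
  by split=> //; rewrite ge_min lexx ?orbT.
pose rad (s : R) := (1 - s) * a + s * r.
pose E (s t : R) : C := z * cR (1 - s) + cR (rad s) * unitc t.
have radB s : 0 <= s <= 1 -> a <= rad s <= r.
  have := cabs_ge0 z => z0 /andP[s0 s1]; rewrite /rad; have ra : 0 <= r - a by lra.
  have := mulr_ge0 s0 ra; have : 0 <= (1 - s) * (r - a) by rewrite mulr_ge0 // subr_ge0.
  by move=> k1 k2; apply/andP; split; lra.
have hE u v u' v' : 0 <= u <= 1 -> 0 <= v <= 1 -> 0 <= u' <= 1 -> 0 <= v' <= 1 ->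
  cabs (E u v - E u' v') <= (cabs z + r + r * unitc_lip R) * (`|u - u'| + `|v - v'|).
  move=> hu hv hu' hv'.
  have -> : E u v - E u' v' = z * cR (u' - u) + cR (rad u - rad u') * unitc v
     + cR (rad u') * (unitc v - unitc v').
    have eB x y : cR (x - y) = cR x - cR y :> C by rewrite cRD cRN.
    by rewrite /E !eB; ring.
  apply: le_trans (cabsD _ _) _; apply: le_trans (lerD (cabsD _ _) (lexx _)) _.
  rewrite !cabsM !cabs_cR cabs_unitc mulr1 [`|u' - u|]distrC.
  have -> : rad u - rad u' = (r - a) * (u - u') by rewrite /rad; ring.
  have [h1 h2] := andP (radB _ hu').
  rewrite normrM [`|r - a|]ger0_norm; last by lra.
  rewrite [`|rad u'|]ger0_norm; last by lra.
  have := lipschitz_unitc v v'; have := normr_ge0 (u - u'); have := normr_ge0 (v - v').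
  have := cabs_ge0 z; have := cabs_ge0 (unitc v - unitc v').
  move: `|u - u'| `|v - v'| (cabs (unitc v - _)) (cabs z) ar => x y c k ar c0 k0 y0 x0 hc.
  have k3 : rad u' * c <= r * (unitc_lip R * y) by apply: ler_pM => //; lra.
  have k4 : 0 <= k * y by rewrite mulr_ge0.
  have k5 : 0 <= r * unitc_lip R * x by apply: mulr_ge0 => //; apply: mulr_ge0; exact: ltW.
  have k6 : 0 <= r * y by apply: mulr_ge0 => //; exact: ltW.
  have k7 : 0 <= a * x by apply: mulr_ge0 => //; exact: ltW.
  have -> : (k + r + r * unitc_lip R) * (x + y) = (k * x + (r - a) * x + r * (unitc_lip R * y)) +
    (k * y + r * y + a * x + r * unitc_lip R * x) by ring.
  by rewrite -[X in X <= _]addr0; apply: lerD; [exact: lerD|rewrite !addr_ge0].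
(* The homotopy avoids [z] because [rad s - s |z| = (1 - s) a + s (r - |z|)] is positive. *)
have Ez s t : 0 <= s <= 1 -> 0 < cabs (E s t - z).
  move=> hs; have -> : E s t - z = cR (rad s) * unitc t - z * cR s.
    by rewrite /E cRD cRN cR1; ring.
  have hh : cabs (cR (rad s) * unitc t) <= cabs (cR (rad s) * unitc t - z * cR s) + cabs (z * cR s).
    by apply: le_trans (cabsD _ _); rewrite subrK.
  have [h1 h2] := andP (radB _ hs).
  move: hh; rewrite !cabsM !cabs_cR cabs_unitc mulr1 !ger0_norm; [|lra|lra].
  rewrite /rad; nra.
have Erho s t : 0 <= s <= 1 -> cabs (E s t) < rho.
  move=> hs; apply: le_lt_trans rrho; apply: le_trans (cabsD _ _) _.
  have [h1 h2] := andP (radB _ hs).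
  rewrite !cabsM !cabs_cR cabs_unitc mulr1 !ger0_norm; [|lra|lra].
  rewrite /rad; have := cabs_ge0 z; nra.
pose F w := g w / (w - z).
have hF u v : 0 <= u <= 1 -> 0 <= v <= 1 -> cdiff F (E u v).
  move=> hu _; have Ez0 : E u v - z != 0 by rewrite -cabs_gt0 Ez.
  apply: cdiffM; first by apply: hg; [exact: Erho|rewrite -subr_eq0].
  by apply: cdiffV => //; apply: cdiffB; [exact: cdiff_id|exact: cdiff_cst].
have LL : 0 < cabs z + r + r * unitc_lip R.
  have := cabs_ge0 z; have := mulr_gt0 r0 L0; lra.
have [|q0 hq0] := goursat LL hE hF (e := e / 2); first by rewrite divr_gt0.
exists q0 => q /hq0; rewrite /bsum !add0r.
(* The two sides of the square along the seam have the same image and cancel, leaving the two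
   circles. *)
have -> : E^~ 1 = E^~ 0 by apply/funext => s; rewrite /E unitc0 unitc1.
have -> : E 1 = circ 0 r.
  by apply/funext => t; rewrite /E /circ /rad !subrr cR0 mulr0 mul0r mul1r !add0r.
have -> : E 0 = circ z a.
  by apply/funext => t; rewrite /E /circ /rad subr0 mul0r mul1r addr0 cR1 mulr1.
rewrite (@psum_circ _ g z a) ?lt0r_neq0 // => h1.
have h2 : cabs (cavg g z a q - g z) <= e / (2 * unitc_lip R).
  have -> : cavg g z a q - g z = cavg (fun w => g w - g z) z a q.
    have N0 : (2 ^ q)%:R != 0 :> C by rewrite -cabs_eq0 cabs_nat pow2_neq0.
    rewrite /cavg sumrB sumr_const card_ord mulrBl -[g z *+ _]mulr_natr.
    rewrite mulfK //. 
  apply: cavg_le => [|w hw]; first exact: ltW.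
  by apply: hdl; rewrite hw; lra.
have -> : psum F (circ 0 r) 0 1 q - cnorm R q * g z =
   (psum F (E^~ 0) 0 1 q + psum F (circ 0 r) 0 1 q - psum F (E^~ 0) 0 1 q -
         cnorm R q * cavg g z a q) + cnorm R q * (cavg g z a q - g z) by ring.
apply: le_trans (cabsD _ _) _; apply: le_trans (lerD h1 (lexx _)) _.
rewrite cabsM; have := ler_pM (cabs_ge0 _) (cabs_ge0 _) (cnorm_le R q) h2.
have -> : unitc_lip R * (e / (2 * unitc_lip R)) = e / 2 by field; rewrite lt0r_neq0.
lra.
Qed.

End Cauchy.

(** * Mean values and Wiener's inequality *)

Section CauchyEstimates.
Variable R : realType.
Local Notation C := (Cx R).
Implicit Types (F G g h : C -> C).

Lemma psumZ (c : C) F (v : R -> C) (x h : R) q :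
  psum (fun z => c * F z) v x h q = c * psum F v x h q.
Proof. rewrite /psum mulr_sumr; apply: eq_bigr => t _; rewrite /trap; by field. Qed.

(* The Cauchy kernels combine: [(1/(w-z) - 1/w) - (z/y)(1/(w-y) - 1/w) =
   z (z-y) / (w (w-z) (w-y))]. *)
Lemma second_difference g (r rho M : R) (z y : C) :
  0 < r < rho -> (forall w, cabs w < rho -> cdiff g w) ->
  (forall w, cabs w <= r -> cabs (g w) <= M) ->
  cabs z <= r / 2 -> cabs y <= r / 2 -> y != 0 ->
  cabs (g z - g 0 - z / y * (g y - g 0)) <= unitc_lip R * M * cabs z * cabs (z - y) / r ^+ 2.
Proof.
move=> /andP[r0 rrho] hg hM hz hy y0.
have L0 := unitc_lip_gt0 R.
have M0 : 0 <= M by apply: le_trans (cabs_ge0 _) (hM 0 _); rewrite cabs0 ltW.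
pose k := cabs (z / y); have k0 : 0 <= k := cabs_ge0 _.
pose B := unitc_lip R * M * cabs z * cabs (z - y) / r ^+ 2.
suff H : 4 * cabs (g z - g 0 - z / y * (g y - g 0)) <= 4 * B by rewrite -(@ler_pM2l _ 4).
apply/ler_addgt0Pr => e e0.
pose e' := e / (2 + 2 * k).
have k2 : 0 < 2 + 2 * k by lra.
have e'0 : 0 < e' by rewrite divr_gt0.
have cf (p : C) : cabs p <= r / 2 -> exists q0 : nat, forall q, (q0 <= q)%N ->
    cabs (psum (fun w => g w / (w - p)) (circ 0 r) 0 1 q - cnorm R q * g p) <= e'.
  move=> hp; apply: (@cauchy_formula R g p r rho) => //; first by lra.
    by move=> w hw _; exact: hg.
  have [|d hd] := hg p; first by lra.
  exact: has_cderiv_cont hd.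
have [q1 h1] := cf z hz; have [q2 h2] := cf y hy.
have [|q3 h3] := cf 0; first by rewrite cabs0 divr_ge0 // ltW.
pose q := (q1 + q2 + q3 + 2)%N.
have [/h1{}h1 /h2{}h2 /h3{}h3 /(@cnorm_ge R) c4] := leq_add4 q1 q2 q3 2; rewrite -/q in h1 h2 h3 c4.
pose P p := psum (fun w => g w / (w - p)) (circ 0 r) 0 1 q.
pose H w := (g w / (w - z) - g w / (w - 0)) - z / y * (g w / (w - y) - g w / (w - 0)).
have eH : psum H (circ 0 r) 0 1 q = (P z - P 0) - z / y * (P y - P 0).
  by rewrite /H psumB psumZ !psumB.
have hH : cabs (psum H (circ 0 r) 0 1 q) <= 4 * B.
  have -> : 4 * B = (4 * M * cabs z * cabs (z - y) / r ^+ 3) * (unitc_lip R * r).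
    by rewrite /B; field; rewrite lt0r_neq0.
  apply: psum_circ_le; first exact: ltW.
    rewrite !(mulr_ge0, cabs_ge0) // ?invr_ge0 ?exprn_ge0 // ltW //.
  move=> w; rewrite subr0 => wr.
  have wz : r / 2 <= cabs (w - z).
    by have := cabsD (w - z) z; rewrite subrK wr; lra.
  have wy : r / 2 <= cabs (w - y).
    by have := cabsD (w - y) y; rewrite subrK wr; lra.
  have w0 : w != 0 by rewrite -cabs_gt0 wr.
  have wz0 : w - z != 0 by rewrite -cabs_gt0; lra.
  have wy0 : w - y != 0 by rewrite -cabs_gt0; lra.
  have -> : H w = g w * z * (z - y) * (w * (w - z) * (w - y))^-1.
    by rewrite /H subr0; field; rewrite w0 wz0 wy0 y0.
  have -> : 4 * M * cabs z * cabs (z - y) / r ^+ 3 =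
    M * cabs z * cabs (z - y) * (r * (r / 2) * (r / 2))^-1 by field; rewrite lt0r_neq0.
  rewrite !cabsM cabsV; apply: ler_pM; rewrite ?invr_ge0 ?mulr_ge0 ?cabs_ge0 //.
    by rewrite !ler_wpM2r ?cabs_ge0 // hM // wr.
  rewrite lef_pV2 ?posrE ?mulr_gt0 ?divr_gt0 ?cabs_gt0 ?mulf_neq0 //.
  rewrite !cabsM wr; have r20 : 0 <= r / 2 by lra.
  apply: ler_pM => //; first by rewrite mulr_ge0 // ltW.
  by apply: ler_wpM2l => //; exact: ltW.
have ee : e = e' + e' + k * (e' + e') by rewrite /e'; field; exact: lt0r_neq0.
rewrite ee.
apply: (@le_trans _ _ (cabs (cnorm R q * (g z - g 0 - z / y * (g y - g 0))))).
  by rewrite cabsM ler_wpM2r // cabs_ge0.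
have -> : cnorm R q * (g z - g 0 - z / y * (g y - g 0)) = psum H (circ 0 r) 0 1 q -
   ((P z - cnorm R q * g z) - (P 0 - cnorm R q * g 0)
    - z / y * ((P y - cnorm R q * g y) - (P 0 - cnorm R q * g 0))).
  by rewrite eH; ring.
apply: le_trans (cabsB _ _) _; apply: lerD => //.
apply: le_trans (cabsB _ _) _; apply: lerD.
  by apply: le_trans (cabsB _ _) _; apply: lerD.
rewrite cabsM; apply: ler_wpM2l => //.
by apply: le_trans (cabsB _ _) _; apply: lerD.
Qed.

(** Limit of [second_difference] as [y] tends to 0, where [(g y - g 0) / y] tends to [d]. One small
    real [y] is used, at the cost of an arbitrary [e]. *)
Lemma second_order g (r rho M : R) (z d : C) :
  0 < r < rho -> (forall w, cabs w < rho -> cdiff g w) ->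
  (forall w, cabs w <= r -> cabs (g w) <= M) ->
  cabs z <= r / 2 -> has_cderiv g 0 d ->
  cabs (g z - g 0 - d * z) <= unitc_lip R * M * cabs z ^+ 2 / r ^+ 2.
Proof.
move=> hr hg hM hz hd; have [r0 rrho] := andP hr.
have L0 := unitc_lip_gt0 R.
have M0 : 0 <= M by apply: le_trans (cabs_ge0 _) (hM 0 _); rewrite cabs0 ltW.
have z0 := cabs_ge0 z.
pose A := unitc_lip R * M * cabs z / r ^+ 2.
have A0 : 0 <= A.
  apply: mulr_ge0; last by rewrite invr_ge0 exprn_ge0 // ltW.
  by apply: mulr_ge0 => //; apply: mulr_ge0 => //; exact: ltW.
apply/ler_addgt0Pr => e e0.
have [|dl dl0 hdl] := hd (e / (2 * (cabs z + 1))).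
  by rewrite divr_gt0 // mulr_gt0 // ltr_wpDl.
(* Replacing [|z - y|] by [|z|] costs at most [A y], and the difference quotient at [y] costs at
   most [e / 2]. *)
have [y [y0 ydl yr yA]] : exists y : R, [/\ 0 < y, y < dl, y <= r / 2 & y * (A + 1) <= e / 2].
  exists (Num.min (dl / 2) (Num.min (r / 2) (e / 2 / (A + 1)))).
  have A1 : 0 < A + 1 by lra.
  set u := Num.min (r / 2) _; have u0 : 0 < u by rewrite lt_min !divr_gt0.
  have [u1 u2] : u <= r / 2 /\ u <= e / 2 / (A + 1) by split; rewrite ge_min lexx ?orbT.
  have : Num.min (dl / 2) u <= dl / 2 by rewrite ge_min lexx.
  have : Num.min (dl / 2) u <= u by rewrite ge_min lexx orbT.
  have : 0 < Num.min (dl / 2) u by rewrite lt_min u0 divr_gt0.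
  move: (Num.min _ u) => v v0 vu vd; split=> //; try lra.
  by rewrite -ler_pdivlMr //; lra.
have cy : cabs (cR y) = y by rewrite cabs_cR gtr0_norm.
have y00 : cR y != 0 :> C by rewrite -cabs_gt0 cy.
have := @second_difference g r rho M z (cR y) hr hg hM hz ltac:(by rewrite cy) y00.
have := hdl (cR y); rewrite subr0 cy => /(_ ydl) h1 h2.
have -> : g z - g 0 - d * z = (g z - g 0 - z / cR y * (g (cR y) - g 0)) +
   z / cR y * (g (cR y) - g 0 - d * cR y) by field.
apply: le_trans (cabsD _ _) _; rewrite !cabsM cabsV cy.
have h3 : cabs z / y * cabs (g (cR y) - g 0 - d * cR y) <= e / 2.
  apply: le_trans (ler_wpM2l _ h1) _; first by rewrite divr_ge0 // ltW.
  have -> : cabs z / y * (e / (2 * (cabs z + 1)) * y) = e / 2 * (cabs z / (cabs z + 1)).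
    by field; rewrite !lt0r_neq0 // ltr_wpDl.
  have f : cabs z / (cabs z + 1) <= 1 by rewrite ler_pdivrMr ?ltr_wpDl //; lra.
  by apply: ler_piMr f; lra.
have h4 : unitc_lip R * M * cabs z * cabs (z - cR y) / r ^+ 2 <=
   unitc_lip R * M * cabs z ^+ 2 / r ^+ 2 + A * y.
  have -> : unitc_lip R * M * cabs z ^+ 2 / r ^+ 2 + A * y = A * (cabs z + y).
    by rewrite /A; field; rewrite lt0r_neq0.
  have -> : unitc_lip R * M * cabs z * cabs (z - cR y) / r ^+ 2 = A * cabs (z - cR y).
    by rewrite /A; field; rewrite lt0r_neq0.
  by apply: ler_wpM2l => //; apply: le_trans (cabsB _ _) _; rewrite cy.
have := le_trans h2 h4; have : A * y <= e / 2 by lra.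
lra.
Qed.

(** The second-order expansion at the point [r / 2] gives [|d| r / 2 <= 2 M + unitc_lip M / 4]:
    Cauchy's estimate with a crude constant, whose size is immaterial later. *)
Lemma cderiv_bound g (r rho M : R) (d : C) :
  0 < r < rho -> (forall w, cabs w < rho -> cdiff g w) ->
  (forall w, cabs w <= r -> cabs (g w) <= M) ->
  has_cderiv g 0 d -> cabs d <= (4 + unitc_lip R) * M / r.
Proof.
move=> hr hg hM hd; have [r0 rrho] := andP hr.
have L0 := unitc_lip_gt0 R.
have M0 : 0 <= M by apply: le_trans (cabs_ge0 _) (hM 0 _); rewrite cabs0 ltW.
have cz : cabs (cR (r / 2)) = r / 2 by rewrite cabs_cR gtr0_norm // divr_gt0.
have := @second_order g r rho M (cR (r / 2)) d hr hg hM ltac:(by rewrite cz) hd.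
rewrite cz; set z := cR _ => h.
have h1 : cabs (d * z) <= M + M + unitc_lip R * M * (r / 2) ^+ 2 / r ^+ 2.
  have -> : d * z = g z - g 0 - (g z - g 0 - d * z) by ring.
  apply: le_trans (cabsB _ _) _; apply: lerD => //.
  by apply: le_trans (cabsB _ _) _; apply: lerD; apply: hM; rewrite ?cabs0 ?cz; lra.
move: h1; rewrite cabsM cz ler_pdivlMr //.
have -> : unitc_lip R * M * (r / 2) ^+ 2 / r ^+ 2 = unitc_lip R * M / 4 by field; rewrite lt0r_neq0.
have := mulr_ge0 (ltW L0) M0; lra.
Qed.

(** Cauchy's formula at the centre, with accuracy [4 e] because [cnorm] has modulus at least 4.
    Continuity at 0 and differentiability elsewhere is what will be known of the quotient [H3] in
    Wiener's inequality. *)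
Lemma mean_value_limit h (rho : R) : 1 < rho ->
  (forall w, cabs w < rho -> w != 0 -> cdiff h w) -> ccont h 0 ->
  forall e : R, 0 < e -> exists q0 : nat, forall q, (q0 <= q)%N ->
    cabs (cavg h 0 1 q - h 0) <= e.
Proof.
move=> rho1 hh hc e e0.
have [||q0 hq0] := @cauchy_formula R h 0 1 rho _ rho1 hh hc (4 * e).
- by rewrite cabs0.
- by rewrite mulr_gt0.
exists (q0 + 2)%N => q hq; have := hq0 q (leq_trans (leq_addr _ _) hq).
rewrite psum_circ ?oner_neq0 // -mulrBr cabsM.
have := @cnorm_ge R q (leq_trans (leq_addl _ _) hq); have := cabs_ge0 (cavg h 0 1 q - h 0).
nra.
Qed.

Lemma cabs_1D_unit (s : C) : cabs s = 1 -> cabs (1 + (s + s^-1) / 2) = 1 + complex.Re s.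
Proof.
move=> s1; have s0 : s != 0 by rewrite -cabs_gt0 s1.
have hs : complex.Re s ^+ 2 + complex.Im s ^+ 2 = 1.
  move: s1; case: (s) => a b; rewrite /cabs /= => /(congr1 (fun x => x ^+ 2)).
  by rewrite sqr_sqrtr ?expr1n // addr_ge0 ?sqr_ge0.
have e : s^-1 = Complex (complex.Re s) (- complex.Im s).
  apply: (mulfI s0); rewrite mulfV //; move: hs; case: (s) => a b /= hs.
  by apply/eqP; rewrite eq_complex /=; apply/andP; split; apply/eqP; [rewrite -hs|]; ring.
have -> : 1 + (s + s^-1) / 2 = cR (1 + complex.Re s).
  apply: (@mulIf _ 2) => //; rewrite mulrDl mul1r mulfVK // e.
  rewrite mulr_natr; case: (s) => a b; apply/eqP; rewrite eq_complex /=.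
  by apply/andP; split; apply/eqP; ring.
rewrite cabs_cR ger0_norm //.
have := cabs_Re s; rewrite s1 ler_norml; lra.
Qed.

(* On the unit circle [1 + Re (w ^ m)] is nonnegative with mean 1, and pairing [g] with it
   (after a rotation) yields [|a_0| + |a_m| / 2]. *)
Lemma wiener g (rho M : R) (a : nat -> C) (m : nat) : 1 < rho -> (0 < m)%N ->
  (forall w, cabs w < rho -> cdiff g w) ->
  (forall w, cabs w = 1 -> cabs (g w) <= M) ->
  (forall e : R, 0 < e -> exists2 dl : R, 0 < dl & forall w, cabs w < dl ->
     cabs (g w - \sum_(k < m.+1) a k * w ^+ k) <= e * cabs w ^+ m) ->
  cabs (a 0%N) + cabs (a m) / 2 <= M.
Proof.
move=> rho1 m0 hg hM ha.
have g0 : g 0 = a 0%N.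
  have [dl dl0 /(_ 0)] := ha 1 ltr01; rewrite cabs0 => /(_ dl0).
  rewrite expr0n -[(m == 0)%N]negbK -lt0n m0 /= mulr0 big_ord_recl expr0 mulr1.
  rewrite big1 ?addr0 => [|i _]; last by rewrite expr0n /= mulr0.
  move=> h; apply/eqP; rewrite -subr_eq0 -cabs_eq0 eq_le h cabs_ge0 //.
(* The rotation [u] aligns the arguments of [a 0] and [u^-1 a m], so that their moduli add. *)
have [u u1 hu] : exists2 u : C, cabs u = 1 &
   cabs (a 0%N + u^-1 * a m / 2) = cabs (a 0%N) + cabs (a m) / 2.
  have [a00|a00] := eqVneq (a 0%N) 0.
    by exists 1; rewrite ?cabs1 // a00 cabs0 !add0r invr1 mul1r cabsM cabsV cabs_nat.
  have [am0|am0] := eqVneq (a m) 0.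
    by exists 1; rewrite ?cabs1 // am0 cabs0 !(mulr0, mul0r) !addr0.
  have n0 : 0 < cabs (a 0%N) by rewrite cabs_gt0.
  have nm : 0 < cabs (a m) by rewrite cabs_gt0.
  have cn0 : cR (cabs (a 0%N)) != 0 :> C by rewrite -cabs_gt0 cabs_cR normr_gt0 lt0r_neq0.
  have cnm : cR (cabs (a m)) != 0 :> C by rewrite -cabs_gt0 cabs_cR normr_gt0 lt0r_neq0.
  exists (a m * cR (cabs (a 0%N)) / (a 0%N * cR (cabs (a m)))).
    rewrite cabsM cabsV !cabsM !cabs_cR !gtr0_norm //; field.
    by rewrite !lt0r_neq0.
  have -> : a 0%N + (a m * cR (cabs (a 0%N)) / (a 0%N * cR (cabs (a m))))^-1 * a m / 2 =
     a 0%N * cR (1 + cabs (a m) / cabs (a 0%N) / 2).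
    have -> : cR (1 + cabs (a m) / cabs (a 0%N) / 2) =
       1 + cR (cabs (a m)) / cR (cabs (a 0%N)) / 2 :> C.
      by rewrite cRD !cRM !cRV cR1 cR_nat.
    by field; rewrite a00 am0 cn0 cnm.
  rewrite cabsM cabs_cR ger0_norm; first by field; rewrite lt0r_neq0.
  by rewrite addr_ge0 // !divr_ge0 // ltW.
rewrite -hu.
apply/ler_addgt0Pr => e e0.
have gc : ccont g 0.
  have [|d hd] := hg 0; first by rewrite cabs0 (lt_trans ltr01).
  exact: has_cderiv_cont hd.
have e20 : 0 < e / 2 by rewrite divr_gt0.
have gd w : cabs w < rho -> w != 0 -> cdiff g w by move=> hw _; exact: hg.
have [q1 h1] := mean_value_limit rho1 gd gc e20.
have dX k z : cdiff (fun w : C => w ^+ k) z by apply: cdiffX; exact: cdiff_id.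
(* The terms [w^m] and [w^-m] of the kernel are averaged separately against [g]; this first one
   vanishes at 0, so its average tends to 0. *)
pose H2 (w : C) := g w * w ^+ m.
have d2 w : cabs w < rho -> cdiff H2 w by move=> hw; apply: cdiffM; [exact: hg|exact: dX].
have c2 : ccont H2 0.
  have [|d hd] := d2 0; first by rewrite cabs0 (lt_trans ltr01).
  exact: has_cderiv_cont hd.
have [q2 h2] := mean_value_limit rho1 (fun w hw _ => d2 w hw) c2 e20.
(* [g w / w^m] is singular at 0; once the terms below degree [m] are removed, it extends
   continuously by [a m]. *)
pose H3' (w : C) := (g w - \sum_(k < m) a k * w ^+ k) / w ^+ m.
pose H3 (w : C) := if w == 0 then a m else H3' w.
have d3 w : cabs w < rho -> w != 0 -> cdiff H3 w.
  move=> hw w0; apply: (@cdiff_near R H3' H3 w (cabs w)); first by rewrite cabs_gt0.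
    move=> v hv; rewrite /H3 ifF //; apply/negP => /eqP v0.
    by move: hv; rewrite v0 sub0r cabsN ltxx.
  apply: cdiffM.
    apply: cdiffB; first exact: hg.
    by apply: cdiff_sum => k; apply: cdiffM; [exact: cdiff_cst|exact: dX].
  by apply: cdiffV; [rewrite expf_neq0|exact: dX].
have c3 : ccont H3 0.
  move=> e1 e10; have [dl dl0 hdl] := ha e1 e10; exists dl => // w; rewrite subr0 => hw.
  rewrite {2}/H3 eqxx /H3; case: eqVneq => [_|w0]; first by rewrite subrr cabs0 ltW.
  have wm : w ^+ m != 0 by rewrite expf_neq0.
  have := hdl w hw; rewrite big_ord_recr /= => h.
  have -> : H3' w - a m = (g w - (\sum_(k < m) a k * w ^+ k + a m * w ^+ m)) / w ^+ m.
    by rewrite /H3'; field.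
  by rewrite cabsM cabsV ler_pdivrMr cabsX // exprn_gt0 // cabs_gt0.
have [q3 h3] := mean_value_limit rho1 d3 c3 e20.
pose q := (q1 + q2 + q3 + m)%N; pose N := (2 ^ q)%N.
have [/h1{}h1 /h2{}h2 /h3{}h3 mq] := leq_add4 q1 q2 q3 m; rewrite -/q in h1 h2 h3 mq.
have mN : (m < N)%N.
  by apply: (@leq_trans (2 ^ m)%N); [exact: ltn_expl|rewrite /N leq_exp2l].
have Nc0 : N%:R != 0 :> C by rewrite -cabs_eq0 cabs_nat pow2_neq0.
(* On the roots of unity [w^-m = w^(N-m)], and the removed terms [w^(k-m)] with [k < m] average to
   exactly 0 since [m < N]. *)
have e3 : cavg H3 0 1 q = cavg (fun w => g w * w ^+ (N - m)) 0 1 q.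
  rewrite /cavg; congr (_ / _).
  transitivity (\sum_(t < N) (g (0 + cR 1 * omega R q ^+ t) * (0 + cR 1 * omega R q ^+ t) ^+ (N - m)
      - \sum_(k < m) a k * (omega R q ^+ (N - m + k)) ^+ t)).
    apply: eq_bigr => t _; rewrite cR1 add0r mul1r; have [w ew] : exists w : C, omega R q ^+ t = w by exists (omega R q ^+ t).
    rewrite ew; have w0 : w != 0 by rewrite -ew expf_neq0 // omega_neq0.
    have wN : w ^+ N = 1 by rewrite -ew exprAC omega_order expr1n.
    rewrite /H3 (negbTE w0) /H3' mulrBl mulr_suml.
    have wV : (w ^+ m)^-1 = w ^+ (N - m).
      apply: (mulIf (expf_neq0 m w0)); rewrite mulVf ?expf_neq0 //.
      by transitivity (w ^+ (N - m + m)); [rewrite subnK ?wN // ltnW|exact: exprD].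
    rewrite wV; congr (_ - _); apply: eq_bigr => k _.
    by rewrite -mulrA -exprD addnC -ew exprAC.
  rewrite sumrB exchange_big /= [X in _ - X]big1 ?subr0 // => k _.
  rewrite -mulr_sumr sum_omega ?mulr0 // gtnNdvd //; rewrite -/N.
    by rewrite addn_gt0 subn_gt0 mN.
  by rewrite -ltn_subRL subKn ?ltn_ord // ltnW.
pose wt t := omega R q ^+ (t : nat).
(* This is [1 + Re (u w^m)], hence nonnegative, so the sum of the moduli is the real part of the
   sum, namely [N]. *)
pose p (t : 'I_N) := 1 + (u * wt t ^+ m + (u * wt t ^+ m)^-1) / 2.
have wt1 t : cabs (wt t) = 1 by rewrite cabsX cabs_omega expr1n.
have wt0 t : wt t != 0 by rewrite -cabs_gt0 wt1.
have u0 : u != 0 by rewrite -cabs_gt0 u1.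
have hp t : cabs (p t) = 1 + complex.Re (u * wt t ^+ m).
  by apply: cabs_1D_unit; rewrite cabsM u1 cabsX wt1 expr1n mulr1.
have sp : \sum_t cabs (p t) = N%:R.
  rewrite (eq_bigr (fun t : 'I_N => 1 + complex.Re (u * wt t ^+ m))) // big_split /=.
  rewrite sumr_const card_ord.
  have -> : \sum_(t < N) complex.Re (u * wt t ^+ m) = complex.Re (\sum_(t < N) u * wt t ^+ m).
    by elim/big_rec2: _ => [//|i x y _ ->]; rewrite ReD.
  rewrite -mulr_sumr (eq_bigr (fun t : 'I_N => (omega R q ^+ m) ^+ t)); last first.
    by move=> t _; rewrite /wt exprAC.
  by rewrite sum_omega ?mulr0 ?addr0 // gtnNdvd.
have avg_le : cabs ((\sum_(t < N) g (wt t) * p t) / N%:R) <= M.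
  rewrite cabsM cabsV cabs_nat ler_pdivrMr ?pow2_gt0 //.
  apply: le_trans (cabs_sum _ _ _) _; rewrite -sp mulr_sumr; apply: ler_sum => t _.
  by rewrite cabsM ler_wpM2r ?cabs_ge0 // hM // wt1.
have split_avg : (\sum_(t < N) g (wt t) * p t) / N%:R =
   cavg g 0 1 q + u / 2 * cavg H2 0 1 q + u^-1 / 2 * cavg H3 0 1 q.
  rewrite e3 /cavg -/N !mulrA -!mulrDl !mulr_sumr -!big_split /=; congr (_ / _).
  apply: eq_bigr => t _; rewrite cR1 !add0r !mul1r -/(wt t) /p /H2.
  have wV : (wt t ^+ m)^-1 = wt t ^+ (N - m).
    apply: (mulIf (expf_neq0 m (wt0 t))); rewrite mulVf ?(expf_neq0 m (wt0 t)) //.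
    transitivity (wt t ^+ (N - m + m)); last exact: exprD.
    by rewrite subnK 1?ltnW // /wt exprAC omega_order expr1n.
  rewrite invfM wV; by field.
have -> : a 0%N + u^-1 * a m / 2 = (\sum_(t < N) g (wt t) * p t) / N%:R -
   ((cavg g 0 1 q - g 0) + u / 2 * (cavg H2 0 1 q - H2 0) + u^-1 / 2 * (cavg H3 0 1 q - H3 0)).
  rewrite split_avg g0 /H3 eqxx /H2 expr0n -[(m == 0)%N]negbK -lt0n m0 /= mulr0.
  by field.
apply: le_trans (cabsB _ _) _; apply: lerD avg_le _.
have cu2 : cabs (u / 2) = 2^-1 by rewrite cabsM u1 cabsV cabs_nat mul1r.
have cv2 : cabs (u^-1 / 2) = 2^-1 by rewrite cabsM !cabsV u1 cabs_nat invr1 mul1r.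
apply: le_trans (cabsD _ _) _; apply: le_trans (lerD (cabsD _ _) (lexx _)) _.
rewrite !cabsM in cu2 cv2 *; rewrite cu2 cv2; lra.
Qed.

End CauchyEstimates.

(** * Holomorphic functions of several variables *)

Section SeveralVariables.
Variables (R : realType) (n : nat).
Local Notation C := (Cx R).
Local Notation V := 'rV[C]_n.
Implicit Types (f : V -> C) (z h v : V) (L : 'I_n -> C) (U : set V).

Lemma complex_cauchy (u : nat -> C) :
  (forall e : R, 0 < e -> exists N, forall p q, (N <= p)%N -> (N <= q)%N ->
     cabs (u p - u q) <= e) ->
  exists l, forall e : R, 0 < e -> exists N, forall p, (N <= p)%N -> cabs (u p - l) <= e.
Proof.
move=> hu.
have real_lim (w : nat -> R) : (forall p q, `|w p - w q| <= cabs (u p - u q)) ->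
   exists l, forall e : R, 0 < e -> exists N, forall p, (N <= p)%N -> `|w p - l| <= e.
  move=> hw; have : cvg (w @ \oo).
    apply/cauchy_cvgP/cauchy_exP => e e0.
    have [|N hN] := hu (e / 2); first by rewrite divr_gt0.
    exists (w N); exists N => // p /= Np; rewrite /ball /=.
    apply: le_lt_trans (hw _ _) _; apply: le_lt_trans (hN N p _ _) _ => //; lra.
  move=> /cvg_ex[l /cvgrPdist_le hl]; exists l => e /hl[N _ hN]; exists N => p Np.
  by rewrite distrC; exact: hN.
have ReB (a b : C) : complex.Re (a - b) = complex.Re a - complex.Re b.
  by case: a; case: b.
have ImB (a b : C) : complex.Im (a - b) = complex.Im a - complex.Im b.
  by case: a; case: b.
have [a ha] := real_lim (fun p => complex.Re (u p)) ltac:(by move=> p q; rewrite -ReB cabs_Re).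
have [b hb] := real_lim (fun p => complex.Im (u p)) ltac:(by move=> p q; rewrite -ImB cabs_Im).
exists (Complex a b) => e e0.
have [|N1 h1] := ha (e / 2); first by rewrite divr_gt0.
have [|N2 h2] := hb (e / 2); first by rewrite divr_gt0.
exists (N1 + N2)%N => p Np; apply: le_trans (cabs_ReIm _) _; rewrite ReB ImB /=.
have := h1 p (leq_trans (leq_addr _ _) Np); have := h2 p (leq_trans (leq_addl _ _) Np).
lra.
Qed.

(** A real-valued [l^1] norm, in contrast to the norm on matrices, which takes values in [C];
    [norm_le_nrm] compares the two. *)
Definition nrm h : R := \sum_i cabs (h 0 i).

Lemma nrm_ge0 h : 0 <= nrm h.
Proof. by apply: sumr_ge0 => i _; exact: cabs_ge0. Qed.

Lemma nrm0 : nrm 0 = 0.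
Proof. by rewrite /nrm big1 // => i _; rewrite mxE cabs0. Qed.

Lemma nrm_ge h i : cabs (h 0 i) <= nrm h.
Proof. by rewrite /nrm (bigD1 i) //= lerDl sumr_ge0 // => j _; exact: cabs_ge0. Qed.

Lemma nrm_eq0 h : nrm h = 0 -> h = 0.
Proof.
move=> h0; apply/rowP => i; rewrite mxE; apply/eqP; rewrite -cabs_eq0 eq_le cabs_ge0 -h0.
by rewrite nrm_ge.
Qed.

Lemma nrmD h v : nrm (h + v) <= nrm h + nrm v.
Proof. by rewrite /nrm -big_split /=; apply: ler_sum => i _; rewrite mxE cabsD. Qed.

Lemma nrmZ (a : C) h : nrm (a *: h) = cabs a * nrm h.
Proof. by rewrite /nrm mulr_sumr; apply: eq_bigr => i _; rewrite mxE cabsM. Qed.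

Lemma nrm_delta (i : 'I_n) : nrm (delta_mx 0 i) = 1.
Proof.
rewrite /nrm (bigD1 i) //= mxE !eqxx cabs1 big1 ?addr0 // => j ji.
by rewrite mxE (negbTE ji) andbF cabs0.
Qed.

Lemma norm_le_nrm h : `|h| <= cR (nrm h).
Proof.
rewrite [`|h|]/Num.Def.normr /=.
have [->|/mx_norm_neq0[[i j] ->]] := eqVneq (mx_norm h) 0.
  by rewrite (_ : 0 = cR 0) //; rewrite lecR nrm_ge0.
by rewrite norm_le_cR /= ord1 nrm_ge.
Qed.

Definition dotL L h : C := \sum_i L i * h 0 i.

Lemma dotLB L L' h : dotL (fun i => L i - L' i) h = dotL L h - dotL L' h.
Proof. by rewrite /dotL -sumrB; apply: eq_bigr => i _; rewrite mulrBl. Qed.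

Lemma dotLZ L (a : C) h : dotL L (a *: h) = a * dotL L h.
Proof. by rewrite /dotL mulr_sumr; apply: eq_bigr => i _; rewrite mxE mulrCA. Qed.

Lemma dotL_delta L i : dotL L (delta_mx 0 i) = L i.
Proof.
rewrite /dotL (bigD1 i) //= mxE !eqxx mulr1 big1 ?addr0 // => j ji.
by rewrite mxE (negbTE ji) andbF mulr0.
Qed.

Lemma dotL_le L h (B : R) : (forall i, cabs (L i) <= B) -> cabs (dotL L h) <= B * nrm h.
Proof.
move=> hB; apply: le_trans (cabs_sum _ _ _) _; rewrite /nrm mulr_sumr.
by apply: ler_sum => i _; rewrite cabsM ler_wpM2r ?cabs_ge0.
Qed.

Definition has_fder f z L := forall e : R, 0 < e -> exists2 dl : R, 0 < dl &
  forall h, nrm h < dl -> cabs (f (z + h) - f z - dotL L h) <= e * nrm h.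

Lemma has_fder_line f z v (x : C) L : has_fder f (z + x *: v) L ->
  has_cderiv (fun w => f (z + w *: v)) x (dotL L v).
Proof.
move=> hL e e0; have v0 := nrm_ge0 v; have v1 : 0 < nrm v + 1 by lra.
have [|dl dl0 hdl] := hL (e / (nrm v + 1)); first by rewrite divr_gt0.
exists (dl / (nrm v + 1)); first by rewrite divr_gt0.
move=> w; rewrite ltr_pdivlMr // => hw.
have -> : z + w *: v = z + x *: v + (w - x) *: v by rewrite -addrA -scalerDl [x + _]addrC subrK.
have c0 := cabs_ge0 (w - x).
rewrite [dotL L v * _]mulrC -dotLZ; apply: le_trans (hdl _ _) _; rewrite nrmZ.
  by apply: le_lt_trans hw; rewrite ler_wpM2l // lerDl.
have -> : e / (nrm v + 1) * (cabs (w - x) * nrm v) = e * cabs (w - x) * (nrm v / (nrm v + 1)).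
  by field; rewrite lt0r_neq0.
have hh : nrm v / (nrm v + 1) <= 1 by rewrite ler_pdivrMr //; lra.
by apply: ler_piMr => //; apply: mulr_ge0 => //; exact: ltW.
Qed.

Lemma has_fder_derive f z L i : has_fder f z L -> pderiv i f z = L i.
Proof.
move=> hL; have := @has_fder_line f z (delta_mx 0 i) 0 L; rewrite scale0r addr0 dotL_delta.
move=> /(_ hL)/has_cderiv_cvg hd; rewrite /pderiv /derive.
set F := (fun t : C => _) in hd; rewrite (_ : (fun t => _) = F); first exact: cvg_lim hd.
apply/funext => t; rewrite /F scale0r !addr0 [z + _]addrC.
by rewrite (_ : t%:A = t) // /GRing.scale /= mulr1.
Qed.

(** Bridge from the library notion: the differential is expanded in the standard basis and the
    little-o is turned into epsilon-delta form. *)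
Lemma differentiable_has_fder f z : differentiable f z ->
  has_fder f z (fun i => pderiv i f z).
Proof.
move=> df e e0; have hlin h : 'd f z h = dotL (fun i => pderiv i f z) h.
  rewrite {1}[h]row_sum_delta linear_sum /dotL; apply: eq_bigr => i _.
  by rewrite linearZ /pderiv deriveE // /GRing.scale /= mulrC.
have := diff_locallyxC df; set o := the_littleo _ _ _ _ _ => hl.
have /(_ (cR e)) : forall eps : C, 0 < eps -> \forall x \near nbhs (0 : V), `|o x| <= eps * `|x|.
  exact: littleoP.
rewrite cR_gt0 => /(_ e0)/nbhs_ballP[b /= /complex_gt0[dl dl0 ->] hb].
exists dl => // h hh; have := hb h; rewrite -ball_normE /= sub0r normrN => hb'.
have /hb' : `|h| < cR dl by apply: le_lt_trans (norm_le_nrm h) _; rewrite ltcR.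
have -> : o h = f (z + h) - f z - dotL (fun i => pderiv i f z) h.
  by rewrite hl -hlin; ring.
move=> hle; have := le_trans hle (ler_wpM2l _ (norm_le_nrm h)).
by rewrite -cRM norm_le_cR; apply; rewrite (_ : 0 = cR 0) // lecR ltW.
Qed.

Definition hol U f := forall z, U z -> exists L, has_fder f z L.

Lemma hol_pderiv U f z : hol U f -> U z -> has_fder f z (fun i => pderiv i f z).
Proof.
move=> hf /hf[L hL]; rewrite (_ : (fun i => _) = L) //.
by apply/funext => i; exact: has_fder_derive.
Qed.

Definition nopen U := forall z, U z -> exists2 dl : R, 0 < dl &
  forall h, nrm h < dl -> U (z + h).

(** One-variable estimates on the complex line through [h]. The direction is normalized to
    [nrm v = dl / 2], so that the disc of radius 2 stays in the domain; [h] sits at parameter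
    [2 nrm h / dl], which is at most [1 / 2] when [nrm h <= dl / 4]. *)
Lemma fder_second_order f z L (dl M : R) : 0 < dl ->
  (forall h, nrm h < dl -> exists L, has_fder f (z + h) L) ->
  (forall h, nrm h < dl -> cabs (f (z + h)) <= M) -> has_fder f z L ->
  (forall h, nrm h <= dl / 4 ->
     cabs (f (z + h) - f z - dotL L h) <= 4 * unitc_lip R * M / dl ^+ 2 * nrm h ^+ 2) /\
  (forall h, cabs (dotL L h) <= 2 * (4 + unitc_lip R) * M / dl * nrm h).
Proof.
move=> dl0 hf hM hL.
suff line h : h != 0 ->
   (nrm h <= dl / 4 ->
     cabs (f (z + h) - f z - dotL L h) <= 4 * unitc_lip R * M / dl ^+ 2 * nrm h ^+ 2) /\
   cabs (dotL L h) <= 2 * (4 + unitc_lip R) * M / dl * nrm h.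
  have d0 : dotL L 0 = 0 by rewrite /dotL big1 // => i _; rewrite mxE mulr0.
  split=> h; have [->|/line[]//] := eqVneq h 0; last by rewrite d0 cabs0 nrm0 mulr0.
  by rewrite addr0 subrr d0 subrr cabs0 nrm0 expr0n mulr0.
move=> h0; have hn0 : 0 < nrm h.
  rewrite lt_def nrm_ge0 andbT; apply/negP => /eqP/nrm_eq0 e; by rewrite e eqxx in h0.
pose v := cR (dl / 2 / nrm h) *: h.
have nv : nrm v = dl / 2.
  by rewrite nrmZ cabs_cR ger0_norm ?divr_ge0 // ?ltW // -mulrA mulVf ?mulr1 // lt0r_neq0.
have nxv (w : C) : cabs w < 2 -> nrm (w *: v) < dl by rewrite nrmZ nv => hw; nra.
pose g w := f (z + w *: v).
have hr : 0 < (1 : R) < 2 by rewrite ltr01 ltr1n.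
have gd w : cabs w < 2 -> cdiff g w.
  by move=> /nxv/hf[L' hL']; exists (dotL L' v); exact: has_fder_line hL'.
have gM w : cabs w <= 1 -> cabs (g w) <= M by move=> hw; apply/hM/nxv; lra.
have gd0 : has_cderiv g 0 (dotL L v).
  by apply: has_fder_line; rewrite scale0r addr0.
have e1 : dotL L v = cR (dl / 2 / nrm h) * dotL L h by rewrite dotLZ.
have cx : cabs (cR (2 * nrm h / dl)) = 2 * nrm h / dl.
  by rewrite cabs_cR ger0_norm // divr_ge0 ?mulr_ge0 // ltW.
have xv : cR (2 * nrm h / dl) *: v = h.
  rewrite /v scalerA -cRM (_ : _ * _ = 1) ?cR1 ?scale1r //.
  by field; rewrite !lt0r_neq0.
split=> [hh|].
  have := @second_order R g 1 2 M (cR (2 * nrm h / dl)) _ hr gd gM _ gd0.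
  rewrite cx /g scale0r addr0 xv => H; have {H} := H ltac:(rewrite ler_pdivrMr //; lra).
  rewrite [dotL L v * _]mulrC -dotLZ xv => H; apply: le_trans H _; apply: eq_ler.
  by rewrite expr1n divr1; field; rewrite lt0r_neq0.
have := @cderiv_bound R g 1 2 M _ hr gd gM gd0.
have c0 : 0 < dl / 2 / nrm h by rewrite !divr_gt0.
rewrite e1 cabsM cabs_cR gtr0_norm // => H.
rewrite -(ler_pM2l c0).
apply: le_trans H _; apply: eq_ler; field.
by rewrite !lt0r_neq0.
Qed.

Lemma has_fder_cont f z L : has_fder f z L -> forall e : R, 0 < e ->
  exists2 dl : R, 0 < dl & forall h, nrm h < dl -> cabs (f (z + h) - f z) <= e.
Proof.
move=> hL e e0; have [dl dl0 hdl] := hL 1 ltr01.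
pose B := \sum_i cabs (L i).
have hB i : cabs (L i) <= B.
  by rewrite /B (bigD1 i) //= lerDl sumr_ge0 // => j _; exact: cabs_ge0.
have B0 : 0 <= B by apply: sumr_ge0 => i _; exact: cabs_ge0.
have B1 : 0 < 1 + B by lra.
exists (Num.min dl (e / (1 + B))); first by rewrite lt_min dl0 divr_gt0.
move=> h; rewrite lt_min ltr_pdivlMr // => /andP[/hdl h1 h2].
have -> : f (z + h) - f z = (f (z + h) - f z - dotL L h) + dotL L h by rewrite subrK.
apply: le_trans (cabsD _ _) _; apply: le_trans (lerD h1 (dotL_le h hB)) _; lra.
Qed.

Lemma has_fder_shift f z v L : has_fder f (z + v) L -> has_fder (fun x => f (x + v)) z L.
Proof.
move=> hL e /hL[dl dl0 hdl]; exists dl => // h /hdl.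
by rewrite [z + v + h]addrAC.
Qed.

Lemma has_fderB f g z L L' : has_fder f z L -> has_fder g z L' ->
  has_fder (fun x => f x - g x) z (fun i => L i - L' i).
Proof.
move=> hf hg e e0.
have [|d1 d10 h1] := hf (e / 2); first by rewrite divr_gt0.
have [|d2 d20 h2] := hg (e / 2); first by rewrite divr_gt0.
exists (Num.min d1 d2); first by rewrite lt_min d10.
move=> h; rewrite lt_min => /andP[/h1{}h1 /h2{}h2].
have -> : f (z + h) - g (z + h) - (f z - g z) - dotL (fun i => L i - L' i) h =
  (f (z + h) - f z - dotL L h) - (g (z + h) - g z - dotL L' h) by rewrite dotLB; ring.
apply: le_trans (cabsB _ _) _; apply: le_trans (lerD h1 h2) _; lra.
Qed.

Lemma has_fderZ f (a : C) z L : has_fder f z L ->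
  has_fder (fun x => a * f x) z (fun i => a * L i).
Proof.
move=> hf e e0; have a0 := cabs_ge0 a.
have a1 : 0 < cabs a + 1 by lra.
have [|d1 d10 h1] := hf (e / (cabs a + 1)); first by rewrite divr_gt0.
exists d1 => // h /h1{}h1.
have -> : a * f (z + h) - a * f z - dotL (fun i => a * L i) h =
   a * (f (z + h) - f z - dotL L h).
  by rewrite !mulrBr; congr (_ - _); rewrite /dotL mulr_sumr; apply: eq_bigr => i _; rewrite mulrA.
rewrite cabsM; apply: le_trans (ler_wpM2l a0 h1) _.
rewrite mulrA; apply: ler_wpM2r; first exact: nrm_ge0.
by rewrite mulrCA ler_piMr ?ltW // ltr_pdivrMr //; lra.
Qed.

Lemma sub_via (a b c : C) : a - b = (a - c) - (b - c).
Proof. ring. Qed.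

Lemma add_via (a b c : C) : a - b = (a - c) + (c - b).
Proof. ring. Qed.

Lemma sub3_via (a b c a' b' c' : C) :
  b - a - c = (b' - a' - c') + ((a' - a) - (b' - b) + (c' - c)).
Proof. ring. Qed.

(* The difference quotients of [f] along the i-th axis converge uniformly to the
   partial derivative with a linear rate; the Cauchy estimates transfer this rate
   to their own derivatives. *)
Lemma pderiv_fder U f z i : nopen U -> hol U f -> U z ->
  exists L, has_fder (pderiv i f) z L /\
  forall j (e : R), 0 < e -> exists2 dl : R, 0 < dl & forall t : R, 0 < t < dl ->
    cabs ((cR t)^-1 * (pderiv j f (z + cR t *: delta_mx 0 i) - pderiv j f z) - L j) <= e.
Proof.
move=> oU hf Uz.
have hp z' : U z' -> has_fder f z' (fun j => pderiv j f z') by exact: hol_pderiv.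
have [d1 d10 h1] := oU z Uz.
have [d2 d20 h2] := has_fder_cont (hp z Uz) ltr01.
have [d [d0 dd1 dd2]] : exists d, [/\ 0 < d, d + d <= d1 & d + d <= d2].
  exists (Num.min d1 d2 / 2); rewrite divr_gt0 ?lt_min ?d10 //.
  by rewrite -splitr !ge_min !lexx orbT.
pose M := 1 + cabs (f z).
have M0 : 0 <= M by rewrite addr_ge0 ?cabs_ge0.
have inU h : nrm h < d + d -> U (z + h) by move=> hh; apply: h1; lra.
have fM h : nrm h < d + d -> cabs (f (z + h)) <= M.
  move=> hh; rewrite -[f _](subrK (f z)); apply: le_trans (cabsD _ _) _.
  by rewrite lerD2r h2 //; lra.
have L0 := unitc_lip_gt0 R.
pose A := 4 * unitc_lip R * M / d ^+ 2.
pose M1 := 2 * (4 + unitc_lip R) * M / d.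
have A0 : 0 <= A.
  by apply: mulr_ge0; [apply: mulr_ge0 => //; lra|rewrite invr_ge0 exprn_ge0 // ltW].
have M10 : 0 <= M1.
  by apply: mulr_ge0; [apply: mulr_ge0 => //; lra|rewrite invr_ge0 ltW].
have est h : nrm h < d ->
  (forall k, nrm k <= d / 4 ->
     cabs (f (z + h + k) - f (z + h) - dotL (fun j => pderiv j f (z + h)) k) <= A * nrm k ^+ 2) /\
  (forall k, cabs (dotL (fun j => pderiv j f (z + h)) k) <= M1 * nrm k).
  move=> hh; apply: fder_second_order => // [k hk|k hk|].
  - exists (fun j => pderiv j f (z + h + k)); apply: hp; rewrite -addrA; apply: inU.
    by apply: le_lt_trans (nrmD _ _) _; lra.
  - rewrite -addrA; apply: fM; apply: le_lt_trans (nrmD _ _) _; lra.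
  - by apply/hp/inU; lra.
pose ei : V := delta_mx 0 i.
(* [D t j] is both the [j]-th partial derivative of the quotient [q t] and the [i]-difference
   quotient of the [j]-th partial derivative of [f]; the second reading gives the extra clause of
   the lemma. *)
pose q (t : R) x := (cR t)^-1 * (f (x + cR t *: ei) - f x).
pose D (t : R) j x := (cR t)^-1 * (pderiv j f (x + cR t *: ei) - pderiv j f x).
have nt (t : R) : 0 < t -> nrm (cR t *: ei) = t.
  by move=> t0; rewrite nrmZ nrm_delta mulr1 cabs_cR gtr0_norm.
have qphi t h : 0 < t <= d / 4 -> nrm h < d -> cabs (q t (z + h) - pderiv i f (z + h)) <= A * t.
  move=> /andP[t0 td] hh; have ct0 : cR t != 0 :> C by rewrite -cabs_gt0 cabs_cR normr_gt0 lt0r_neq0.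
  have [H _] := est h hh; have := H (cR t *: ei); rewrite nt // => /(_ td).
  rewrite dotLZ dotL_delta => H1.
  have -> : q t (z + h) - pderiv i f (z + h) =
    (cR t)^-1 * (f (z + h + cR t *: ei) - f (z + h) - cR t * pderiv i f (z + h)).
    by rewrite /q; field.
  rewrite cabsM cabsV cabs_cR gtr0_norm // mulrC ler_pdivrMr //.
  by rewrite -mulrA -expr2.
have qder t h : 0 < t <= d / 4 -> nrm h < d -> has_fder (q t) (z + h) (fun j => D t j (z + h)).
  move=> /andP[t0 td] hh; apply: has_fderZ; apply: has_fderB; last by apply/hp/inU; lra.
  apply: has_fder_shift; apply: hp; rewrite -addrA; apply: inU.
  by apply: le_lt_trans (nrmD _ _) _; rewrite nt //; lra.
have qM t h : 0 < t <= d / 4 -> nrm h < d -> cabs (q t (z + h)) <= M1 + A * (d / 4).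
  move=> ht hh; rewrite -[q _ _](subrK (pderiv i f (z + h))) addrC.
  apply: le_trans (cabsD _ _) _; apply: lerD.
    by have [_ /(_ ei)] := est h hh; rewrite dotL_delta nrm_delta mulr1.
  apply: le_trans (qphi _ _ ht hh) _; apply: ler_wpM2l => //.
  by case/andP: ht.
pose B := 2 * (4 + unitc_lip R) * A / d.
have B0 : 0 <= B.
  by apply: mulr_ge0; [apply: mulr_ge0 => //; lra|rewrite invr_ge0 ltW].
(* Cauchy's estimate for [q t - q s], which is at most [A (t + s)] since both quotients are close to
   the same partial derivative. *)
have Dts t s j : 0 < t <= d / 4 -> 0 < s <= d / 4 -> cabs (D t j z - D s j z) <= B * (t + s).
  move=> ht hs.
  have [|||_ H] := @fder_second_order (fun x => q t x - q s x) z
      (fun j => D t j z - D s j z) d (A * (t + s)) d0.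
  - move=> h hh; eexists; exact: has_fderB (qder _ _ ht hh) (qder _ _ hs hh).
  - move=> h hh.
    rewrite (sub_via _ _ (pderiv i f (z + h))).
    apply: le_trans (cabsB _ _) _; rewrite mulrDr; apply: lerD; exact: qphi.
  - by have := has_fderB (qder t 0 ht ltac:(by rewrite nrm0)) (qder s 0 hs ltac:(by rewrite nrm0)); rewrite addr0.
  have := H (delta_mx 0 j); rewrite dotL_delta nrm_delta mulr1 => H1.
  apply: le_trans H1 _; apply: eq_ler; rewrite /B; field.
  exact: lt0r_neq0.
pose tk k : R := d / 4 / (k.+1)%:R.
have tk0 k : 0 < tk k <= d / 4.
  have d40 : 0 < d / 4 by rewrite divr_gt0.
  apply/andP; split; first by rewrite divr_gt0.
  by rewrite ler_pdivrMr // ler_peMr ?ler1n // ltW.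
have tk_small (e : R) : 0 < e -> exists N, forall p, (N <= p)%N -> tk p <= e.
  move=> e0; exists (Num.truncn (e^-1 * (d / 4))) => p Np.
  rewrite /tk ler_pdivrMr // -ler_pdivrMl //.
  apply: ltW; apply: lt_le_trans (truncnS_gt _) _; by rewrite ler_nat ltnS.
have limD j : exists l, forall t, 0 < t <= d / 4 -> cabs (D t j z - l) <= B * t.
  have [|l hl] := @complex_cauchy (fun k => D (tk k) j z).
    move=> e e0; have B1 : 0 < 2 * (B + 1) by lra.
    have [|N hN] := tk_small (e / (2 * (B + 1))); first by rewrite divr_gt0.
    exists N => p p' /hN hp1 /hN hp2; apply: le_trans (Dts _ _ _ (tk0 _) (tk0 _)) _.
    move: hp1 hp2; rewrite !ler_pdivlMr // => hp1 hp2.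
    have [/andP[t1 _] /andP[t2 _]] := (tk0 p, tk0 p'); lra.
  exists l => t ht; apply/ler_addgt0Pr => e e0.
  have [|N1 hN1] := hl (e / 2); first by rewrite divr_gt0.
  have B1 : 0 < 2 * (B + 1) by lra.
  have [|N2 hN2] := tk_small (e / (2 * (B + 1))); first by rewrite divr_gt0.
  have {hN1}h1' := hN1 _ (leq_addr N2 N1); have {hN2}h2' := hN2 _ (leq_addl N1 N2).
  have h3' := Dts t _ j ht (tk0 (N1 + N2)%N).
  move: h2'; rewrite ler_pdivlMr // => h2'.
  rewrite (add_via _ _ (D (tk (N1 + N2)%N) j z)).
  apply: le_trans (cabsD _ _) _; apply: le_trans (lerD h3' h1') _.
  have /andP[t1 _] := tk0 (N1 + N2)%N; lra.
have {limD}[L hL] := choice limD.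
exists L; split; last first.
  move=> j e e0; have B1 : 0 < B + 1 by lra.
  exists (Num.min (d / 4) (e / (B + 1))); first by rewrite lt_min !divr_gt0.
  move=> t /andP[t0]; rewrite lt_min => /andP[td]; rewrite ltr_pdivlMr // => te.
  have ht : 0 < t <= d / 4 by rewrite t0 /= ltW.
  apply: le_trans (hL _ _ ht) _.
  lra.
pose K := 4 * unitc_lip R * (M1 + A * (d / 4)) / d ^+ 2.
have M20 : 0 <= M1 + A * (d / 4) by rewrite addr_ge0 // mulr_ge0 // divr_ge0 // ltW.
have K0 : 0 <= K.
  by apply: mulr_ge0; [apply: mulr_ge0 => //; lra|rewrite invr_ge0 exprn_ge0 // ltW].
(* The second-order estimate for [q t] has a constant [K] independent of [t]. It therefore survives
   the passage from [q t] to the partial derivative and from [D t] to [L], whose errors are of order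
   [t]. *)
have main h : nrm h <= d / 4 ->
    cabs (pderiv i f (z + h) - pderiv i f z - dotL L h) <= K * nrm h ^+ 2.
  move=> hh; apply/ler_addgt0Pr => e e0; have h0 := nrm_ge0 h.
  pose W := A + A + B * nrm h; have W0 : 0 <= W by rewrite !addr_ge0 // mulr_ge0.
  have W1 : 0 < W + 1 by lra.
  have [N hN] := tk_small (e / (W + 1)) ltac:(by rewrite divr_gt0).
  have {hN} := hN N (leqnn _); set t := tk N; rewrite ler_pdivlMr // => hte.
  have ht : 0 < t <= d / 4 := tk0 N; have /andP[t0 _] := ht.
  have hd' : nrm h < d by lra.
  have n0d : nrm (0 : V) < d by rewrite nrm0.
  have [|||H _] := @fder_second_order (q t) z (fun j => D t j z) d (M1 + A * (d / 4)) d0.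
  - by move=> k hk; eexists; exact: qder ht hk.
  - by move=> k hk; exact: qM.
  - by have := qder t 0 ht n0d; rewrite addr0.
  have {H}H := H h hh.
  rewrite (sub3_via _ _ _ (q t z) (q t (z + h)) (dotL (fun j => D t j z) h)) -dotLB.
  apply: le_trans (cabsD _ _) _; apply: lerD => //.
  apply: le_trans (cabsD _ _) _; apply: le_trans (lerD (cabsB _ _) (lexx _)) _.
  have k1 := qphi t h ht hd'; have := qphi t 0 ht n0d; rewrite addr0 => k2.
  have k3 := @dotL_le (fun j => D t j z - L j) h (B * t) (fun j => hL j t ht).
  apply: le_trans (lerD (lerD k2 k1) k3) _.
  have -> : A * t + A * t + B * t * nrm h = t * W by rewrite /W; ring.
  by apply: le_trans hte; rewrite [t * (W + 1)]mulrDr mulr1 lerDl ltW.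
move=> e e0; have K1 : 0 < K + 1 by lra.
exists (Num.min (d / 4) (e / (K + 1))); first by rewrite lt_min !divr_gt0.
move=> h; rewrite lt_min => /andP[hd']; rewrite ltr_pdivlMr // => he.
apply: le_trans (main _ (ltW hd')) _; rewrite expr2 mulrA; apply: ler_wpM2r; first exact: nrm_ge0.
have := nrm_ge0 h; lra.
Qed.

Lemma pderiv_hol U f i : nopen U -> hol U f -> hol U (pderiv i f).
Proof. by move=> oU hf z Uz; have [L []] := pderiv_fder i oU hf Uz; exists L. Qed.

(** Two limits of the same [i]-difference quotients of the [j]-th partial derivative: the extra
    clause of [pderiv_fder] yields one mixed derivative, the Frechet derivative the other. *)
Lemma pderiv_comm U f z i j : nopen U -> hol U f -> U z ->
  pderiv j (pderiv i f) z = pderiv i (pderiv j f) z.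
Proof.
move=> oU hf Uz.
have [L [hL HL]] := pderiv_fder i oU hf Uz.
have [L' [hL' _]] := pderiv_fder j oU hf Uz.
rewrite (has_fder_derive j hL) (has_fder_derive i hL').
apply/eqP; rewrite -subr_eq0 -cabs_eq0 eq_le cabs_ge0 andbT.
apply/ler_addgt0Pr => e e0; rewrite add0r.
have [|d1 d10 h1] := HL j (e / 2); first by rewrite divr_gt0.
have [|d2 d20 h2] := hL' (e / 2); first by rewrite divr_gt0.
have [t [t0 td1 td2]] : exists t : R, [/\ 0 < t, t < d1 & t < d2].
  exists (Num.min d1 d2 / 2); have m0 : 0 < Num.min d1 d2 by rewrite lt_min d10.
  have [m1 m2] : Num.min d1 d2 <= d1 /\ Num.min d1 d2 <= d2 by split; rewrite ge_min lexx ?orbT.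
  by move: (Num.min d1 d2) m0 m1 m2 => m m0 m1 m2; split; lra.
have ct0 : cR t != 0 :> C by rewrite -cabs_gt0 cabs_cR normr_gt0 lt0r_neq0.
have {h1}h1 := h1 t ltac:(by rewrite t0).
have {h2} := h2 (cR t *: delta_mx 0 i); rewrite nrmZ nrm_delta mulr1 cabs_cR gtr0_norm //.
move=> /(_ td2); rewrite dotLZ dotL_delta => h2.
set X := pderiv j f _ - _ in h1 h2.
have -> : L j - L' i = (cR t)^-1 * (X - cR t * L' i) - ((cR t)^-1 * X - L j) by field.
apply: le_trans (cabsB _ _) _; rewrite cabsM cabsV cabs_cR gtr0_norm //.
have : t^-1 * cabs (X - cR t * L' i) <= e / 2 by rewrite ler_pdivrMl // [t * _]mulrC.
move: h1; lra.
Qed.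

End SeveralVariables.

(** * Multi-indices and Taylor coefficients *)

Section MultiIndices.
Variable n : nat.
Implicit Types (a b : mi n) (K : nat).

(* Multi-indices with all entries at most [K]: sums over index sets are taken over this
   finite type. *)
Definition mE K := {ffun 'I_n -> 'I_K.+1}.

Definition emb K (t : mE K) : mi n := [ffun i => t i : nat].

Lemma emb_inj K : injective (@emb K).
Proof.
move=> s t /ffunP h; apply/ffunP => i; apply: val_inj.
by have := h i; rewrite !ffunE.
Qed.

Lemma le_deg a i : (a i <= deg a)%N.
Proof. by rewrite /deg (bigD1 i) //= leq_addr. Qed.

Definition mE_of K a : mE K := [ffun i => inord (a i)].

Lemma emb_mE_of K a : (deg a <= K)%N -> emb (mE_of K a) = a.
Proof.
by move=> h; apply/ffunP => i; rewrite !ffunE inordK // ltnS (leq_trans (le_deg a i)).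
Qed.

Lemma mE_ofK K (t : mE K) : mE_of K (emb t) = t.
Proof. by apply/ffunP => i; rewrite !ffunE inord_val. Qed.

Lemma deg_incr a k : deg (incr a k) = (deg a).+1.
Proof.
rewrite /deg (eq_bigr (fun i => a i + (i == k))%N); last by move=> i _; rewrite ffunE.
rewrite big_split /= [X in (_ + X)%N](bigD1 k) //= eqxx.
rewrite [X in (_ + (1 + X))%N]big1 ?addn0 ?addn1 // => i /negbTE ->.
by [].
Qed.

Definition decr a k : mi n := [ffun i => (a i - (i == k))%N].

Lemma decrK a k : (0 < a k)%N -> incr (decr a k) k = a.
Proof.
move=> ak; apply/ffunP => i; rewrite !ffunE; case: eqP => [->|_]; last by rewrite subn0 addn0.
by rewrite subnK.
Qed.

Lemma incrK a k : decr (incr a k) k = a.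
Proof. by apply/ffunP => i; rewrite !ffunE addnK. Qed.

Lemma incr_gt0 a k : (0 < incr a k k)%N.
Proof. by rewrite ffunE eqxx addn1. Qed.

(** Reindexing by adding 1 to the [k]-th entry; [d < K] keeps the result inside the box. *)
Lemma sum_incr (W : nmodType) K d (k : 'I_n) (F : mi n -> W) : (d < K)%N ->
  \sum_(t : mE K | (deg (emb t) == d.+1) && (0 < emb t k)%N) F (emb t) =
  \sum_(t : mE K | deg (emb t) == d) F (incr (emb t) k).
Proof.
move=> dK.
rewrite (reindex_onto (fun t : mE K => mE_of K (incr (emb t) k))
                      (fun t : mE K => mE_of K (decr (emb t) k))) /=; last first.
  move=> t /andP[/eqP dt tk].
  have dd : (deg (decr (emb t) k) <= K)%N.
    by have := deg_incr (decr (emb t) k) k; rewrite decrK // dt => -[<-]; exact: ltnW.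
  by rewrite emb_mE_of // decrK // mE_ofK.
have dP (t : mE K) : (deg (emb (mE_of K (incr (emb t) k))) == d.+1) &&
    (0 < emb (mE_of K (incr (emb t) k)) k)%N &&
    (mE_of K (decr (emb (mE_of K (incr (emb t) k))) k) == t) -> deg (emb t) = d.
  move=> /andP[/andP[/eqP h1 h2] /eqP h3].
  have h5 : deg (decr (emb (mE_of K (incr (emb t) k))) k) = d.
    by apply/eqP; rewrite -eqSS -(deg_incr _ k) decrK // h1.
  by rewrite -{1}h3 emb_mE_of // h5 ltnW.
have eP (t : mE K) : deg (emb t) = d -> emb (mE_of K (incr (emb t) k)) = incr (emb t) k.
  by move=> dt; rewrite emb_mE_of // deg_incr dt.
apply: eq_big => [t|t /dP/eP -> //].
apply/idP/eqP => [/dP //|dt].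
by rewrite eP // incrK mE_ofK eqxx incr_gt0 !andbT deg_incr dt.
Qed.

End MultiIndices.

Section Taylor.
Variables (R : realType) (n : nat).
Local Notation C := (Cx R).
Local Notation V := 'rV[C]_n.
Implicit Types (f g : V -> C) (z w : V) (U : set V) (a : mi n).

Lemma zpow_incr z a k : zpow z (incr a k) = z 0 k * zpow z a.
Proof.
rewrite /zpow (eq_bigr (fun i => z ord0 i ^+ a i * z ord0 i ^+ (i == k))); last first.
  by move=> i _; rewrite ffunE exprD.
rewrite big_split /= mulrC (bigD1 k) //= eqxx expr1 [X in _ * X * _]big1 ?mulr1 // => i /negbTE ->.
by rewrite expr0.
Qed.

Lemma zpowZ (x : C) z a : zpow (x *: z) a = x ^+ deg a * zpow z a.
Proof.
rewrite /zpow /deg expr_sum -big_split /=; apply: eq_bigr => i _.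
by rewrite mxE exprMn.
Qed.

Lemma cabs_zpow z a : cabs (zpow z a) = \prod_i cabs (z 0 i) ^+ a i.
Proof. by rewrite cabs_prod; apply: eq_bigr => i _; rewrite cabsX. Qed.

(** [dalpha] along an arbitrary list of coordinates, which makes induction on the list possible. *)
Definition dfold (a : mi n) f (s : seq 'I_n) :=
  foldr (fun i g => iter (a i) (@pderiv R n i) g) f s.

Lemma hol_iter U f i k : nopen U -> hol U f -> hol U (iter k (@pderiv R n i) f).
Proof. by move=> oU hf; elim: k => [//|k IH] /=; exact: pderiv_hol. Qed.

Lemma hol_dfold U f a s : nopen U -> hol U f -> hol U (dfold a f s).
Proof. by move=> oU hf; elim: s => [//|i s IH] /=; exact: hol_iter. Qed.

Lemma pderiv_eq U f g i : nopen U -> hol U f -> (forall z, U z -> f z = g z) ->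
  forall z, U z -> pderiv i f z = pderiv i g z.
Proof.
move=> oU hf fg z Uz; have [L hL] := hf z Uz; rewrite (has_fder_derive i hL).
symmetry; apply: has_fder_derive => e e0.
have [d1 d10 h1] := hL e e0; have [d2 d20 h2] := oU z Uz.
exists (Num.min d1 d2); first by rewrite lt_min d10.
by move=> h; rewrite lt_min => /andP[/h1 k1 /h2 k2]; rewrite -!fg.
Qed.

Lemma iter_pderiv_eq U f g i k : nopen U -> hol U f -> (forall z, U z -> f z = g z) ->
  forall z, U z -> iter k (@pderiv R n i) f z = iter k (@pderiv R n i) g z.
Proof.
move=> oU hf fg; elim: k => [//|k IH] /=.
by apply: (pderiv_eq i oU) => //; exact: hol_iter.
Qed.

Lemma pderiv_iter U f i j k : nopen U -> hol U f -> forall z, U z ->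
  pderiv i (iter k (@pderiv R n j) f) z = iter k (@pderiv R n j) (pderiv i f) z.
Proof.
move=> oU hf; elim: k => [//|k IH] z Uz /=.
have hk := @hol_iter U f j k oU hf.
rewrite (pderiv_comm j i oU hk Uz).
by apply: (pderiv_eq j oU _ IH) => //; exact: pderiv_hol.
Qed.

Lemma pderiv_dfold U f a i s : nopen U -> hol U f -> forall z, U z ->
  pderiv i (dfold a f s) z = dfold a (pderiv i f) s z.
Proof.
move=> oU hf; elim: s => [//|j s IH] z Uz /=.
rewrite (pderiv_iter _ _ _ oU (hol_dfold a s oU hf) Uz).
apply: (iter_pderiv_eq _ _ oU _ IH) => //.
exact/(pderiv_hol _ oU)/hol_dfold.
Qed.

Lemma dfold_incr_notin f a i s : i \notin s -> dfold (incr a i) f s = dfold a f s.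
Proof.
elim: s => [//|j s IH] /=; rewrite inE negb_or => /andP[ij /IH ->].
by rewrite ffunE eq_sym (negbTE ij) addn0.
Qed.

(** The additional derivative commutes past those of the coordinates that follow [i] in the list,
    down to [f] itself. *)
Lemma dfold_incr U f a i s : nopen U -> hol U f -> uniq s -> i \in s -> forall z, U z ->
  dfold (incr a i) f s z = dfold a (pderiv i f) s z.
Proof.
move=> oU hf; elim: s => [//|j s IH] /= /andP[js us].
rewrite inE => /orP[/eqP ij|si] z Uz.
  subst j; rewrite dfold_incr_notin // ffunE eqxx addn1 iterSr.
  apply: (iter_pderiv_eq _ _ oU) => //; first exact/(pderiv_hol _ oU)/hol_dfold.
  by move=> v Uv; apply: (pderiv_dfold _ _ _ oU hf).
have ij : j == i = false by apply/negP => /eqP e; rewrite e si in js.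
rewrite ffunE ij addn0; apply: (iter_pderiv_eq _ _ oU) => //; first exact: hol_dfold.
exact: IH.
Qed.

Lemma dalpha_incr U f a i z : nopen U -> hol U f -> U z ->
  dalpha (incr a i) f z = dalpha a (pderiv i f) z.
Proof.
by move=> oU hf Uz; apply: (dfold_incr _ oU hf) => //; rewrite ?enum_uniq ?mem_enum.
Qed.

Lemma fact_incr a i : (\prod_(j < n) (incr a i j)`! = (a i).+1 * \prod_(j < n) (a j)`!)%N.
Proof.
rewrite (bigD1 i) //= [in RHS](bigD1 i) //= ffunE eqxx addn1 factS -mulnA.
by congr (_ * (_ * _))%N; apply: eq_bigr => j /negbTE ji; rewrite ffunE ji addn0.
Qed.

Lemma taylor_coef_incr U f a i : nopen U -> hol U f -> U 0 ->
  (a i).+1%:R * taylor_coef f (incr a i) = taylor_coef (pderiv i f) a.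
Proof.
move=> oU hf U0; rewrite /taylor_coef (dalpha_incr _ _ oU hf U0) fact_incr natrM.
have p0 : (\prod_(j < n) (a j)`!)%:R != 0 :> C.
  rewrite -cabs_eq0 cabs_nat pnatr_eq0 -lt0n; apply: prodn_gt0 => j; exact: fact_gt0.
have a0 : (a i).+1%:R != 0 :> C by rewrite -cabs_eq0 cabs_nat pnatr_eq0.
by field; rewrite p0 nat1r a0.
Qed.

(** The homogeneous Taylor part of degree [k]. [K] only sizes the box of indices; the value is the
    same for all [K >= k]. *)
Definition hpart K k f w : C :=
  \sum_(t : mE n K | deg (emb t) == k) taylor_coef f (emb t) * zpow w (emb t).

Lemma taylor_coef0 f : taylor_coef f [ffun=> 0%N] = f 0.
Proof.
rewrite /taylor_coef big1 ?divr1; last by move=> i _; rewrite ffunE.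
by rewrite /dalpha; elim: (enum 'I_n) => [//|i s IH] /=; rewrite ffunE.
Qed.

Lemma hpart0 K f w : hpart K 0 f w = f 0.
Proof.
have d0 a : (deg a == 0%N) = (a == [ffun=> 0%N]).
  rewrite /deg sum_nat_eq0; apply/forallP/eqP => [h|-> i]; last by rewrite ffunE.
  by apply/ffunP => i; rewrite ffunE; apply/eqP; exact: h.
have e0 : emb ([ffun=> ord0] : mE n K) = [ffun=> 0%N] by apply/ffunP => i; rewrite !ffunE.
rewrite /hpart (big_pred1 [ffun=> ord0]); last first.
  by move=> t; rewrite d0 -e0 (inj_eq (@emb_inj _ _)).
rewrite e0 /zpow big1 ?mulr1; last by move=> i _; rewrite ffunE expr0.
exact: taylor_coef0.
Qed.

(** Euler's identity, obtained from [taylor_coef_incr] by peeling off one variable; it drives the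
    induction in [taylor_ray]. *)
Lemma hpartS U K k f w : (k < K)%N -> nopen U -> hol U f -> U 0 ->
  k.+1%:R * hpart K k.+1 f w = \sum_(i < n) w 0 i * hpart K k (pderiv i f) w.
Proof.
move=> kK oU hf U0.
transitivity (\sum_(t : mE n K | deg (emb t) == k.+1)
   \sum_(i < n) (emb t i)%:R * (taylor_coef f (emb t) * zpow w (emb t))).
  rewrite /hpart mulr_sumr; apply: eq_bigr => t /eqP <-.
  by rewrite -mulr_suml -natr_sum.
rewrite exchange_big /=; apply: eq_bigr => i _.
transitivity (\sum_(t : mE n K | (deg (emb t) == k.+1) && (0 < emb t i)%N)
   (emb t i)%:R * (taylor_coef f (emb t) * zpow w (emb t))).
  rewrite [RHS]big_mkcondr /=; apply: eq_bigr => t _.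
  by case: ifP => // /negbT; rewrite -eqn0Ngt => /eqP ->; rewrite mul0r.
rewrite (sum_incr i (fun b => (b i)%:R * (taylor_coef f b * zpow w b)) kK).
rewrite /hpart mulr_sumr; apply: eq_bigr => t _.
rewrite -(taylor_coef_incr _ _ oU hf U0) zpow_incr.
have -> : incr (emb t) i i = (emb t i).+1 by rewrite ffunE eqxx addn1.
ring.
Qed.

End Taylor.

(** * Homogeneous parts *)

Section TaylorRay.
Variables (R : realType) (n : nat).
Local Notation C := (Cx R).
Local Notation V := 'rV[C]_n.
Implicit Types (f g : V -> C) (z w : V) (U : set V) (a : mi n).

Lemma is_derive_Re (F : C -> C) (k d : C) (t : R) : has_cderiv F (cR t) d ->
  is_derive t (1 : R) (fun s => complex.Re (k * F (cR s))) (complex.Re (k * d)).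
Proof.
move=> hd; set G := fun s : R => _.
suff cv : (fun s => s^-1 *: (G (s%:A + t) - G t)) @ (0 : R)^' --> complex.Re (k * d).
  by apply: DeriveDef; [apply/cvg_ex; eexists; exact: cv|exact: cvg_lim].
apply/cvgrPdist_le => e e0; have k0 := cabs_ge0 k.
have k1 : 0 < cabs k + 1 by lra.
have [|dl dl0 h] := hd (e / (cabs k + 1)); first by rewrite divr_gt0.
apply/nbhs_ballP; exists dl => //= s; rewrite -ball_normE /= sub0r normrN => sdl s0.
have ns : 0 < `|s| by rewrite normr_gt0.
have := h (cR (s + t)); rewrite -cRN -cRD addrK cabs_cR => /(_ sdl) h1.
have -> : complex.Re (k * d) - s^-1 *: (G (s%:A + t) - G t) =
   - (s^-1 * complex.Re (k * (F (cR (s + t)) - F (cR t) - d * cR s))).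
  have ReZ (x : R) (z : C) : complex.Re (z * cR x) = complex.Re z * x.
    by case: z => u v /=; rewrite mulr0 subr0.
  have ReN (z : C) : complex.Re (- z) = - complex.Re z by case: z.
  rewrite /G [s%:A](_ : _ = s); last by rewrite /GRing.scale /= mulr1.
  rewrite !mulrBr !ReD !ReN mulrA ReZ /GRing.scale /=; field.
  by rewrite s0.
rewrite normrN normrM normfV ler_pdivrMl //.
apply: le_trans (cabs_Re _) _; rewrite cabsM.
apply: le_trans (ler_wpM2l k0 h1) _.
rewrite mulrA [`|s| * e]mulrC; apply: ler_wpM2r => //.
by rewrite mulrCA ler_piMr ?ltW // ltr_pdivrMr //; lra.
Qed.

(** After multiplication by a unimodular [k] that makes [F 1 - F 0] a positive real, the real mean
    value theorem applies to the real part. *)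
Lemma cmean_value (F D : C -> C) (K : R) :
  (forall t : R, 0 <= t <= 1 -> has_cderiv F (cR t) (D (cR t))) ->
  (forall t : R, 0 <= t <= 1 -> cabs (D (cR t)) <= K) -> cabs (F 1 - F 0) <= K.
Proof.
move=> hF hK; have [->|d0] := eqVneq (F 1 - F 0) 0.
  by rewrite cabs0; apply: le_trans (cabs_ge0 _) (hK 0 _); rewrite lexx ler01.
have n0 : 0 < cabs (F 1 - F 0) by rewrite cabs_gt0.
pose k := cR (cabs (F 1 - F 0)) / (F 1 - F 0).
have ck : cabs k = 1.
  by rewrite /k cabsM cabsV cabs_cR gtr0_norm // divff // lt0r_neq0.
have := @mean_value_le R (fun s => complex.Re (k * F (cR s)))
   (fun s => complex.Re (k * D (cR s))) 0 1 K ler01.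
rewrite subr0 mulr1 cR1 cR0 => H.
have e : complex.Re (k * F 1) - complex.Re (k * F 0) = cabs (F 1 - F 0).
  have -> : k * F 1 = k * (F 1 - F 0) + k * F 0 by ring.
  by rewrite ReD addrK /k mulfVK.
rewrite -e; apply: le_trans (ler_norm _) (H _ _) => t ht.
  exact/is_derive_Re/hF.
by apply: le_trans (cabs_Re _) _; rewrite cabsM ck mul1r hK.
Qed.

Lemma has_cderivB (F G : C -> C) x d d' : has_cderiv F x d -> has_cderiv G x d' ->
  has_cderiv (fun s => F s - G s) x (d - d').
Proof. by move=> /has_cderivP h1 /has_cderivP h2; apply/has_cderivP; exact: is_deriveB. Qed.

Lemma has_cderiv_monomial (a : C) k (x : C) :
  has_cderiv (fun s => a * s ^+ k.+1) x (a * (k.+1%:R * x ^+ k)).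
Proof.
elim: k => [|k /has_cderivP IH]; apply/has_cderivP.
  rewrite !mulr1 (_ : (fun s => _) = a *: (id : C -> C)); last first.
    by apply/funext => s; rewrite expr1.
  rewrite [X in is_derive _ _ _ X](_ : a = a *: (1 : C)); first exact: is_deriveZ.
  by rewrite /GRing.scale /= mulr1.
rewrite (_ : (fun s => _) = (fun s => a * s ^+ k.+1) * (id : C -> C)); last first.
  by apply/funext => s; rewrite exprSr mulrA.
rewrite (_ : a * _ = (a * x ^+ k.+1) *: (1 : C) + (id x) *: (a * (k.+1%:R * x ^+ k))).
  exact: is_deriveM.
by rewrite /GRing.scale /= -[k.+2%:R]natr1 exprS; ring.
Qed.

Lemma has_cderiv_powers (c : nat -> C) m (x : C) :
  has_cderiv (fun s => \sum_(k < m.+1) c k * s ^+ k) x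
    (\sum_(k < m) c k.+1 * (k.+1%:R * x ^+ k)).
Proof.
elim: m => [|m IH].
  apply/has_cderivP; rewrite big_ord0 (_ : (fun s => _) = cst (c 0%N)); first exact: is_derive_cst.
  by apply/funext => s; rewrite big_ord1 expr0 mulr1.
have := has_cderivB IH (has_cderiv_monomial (- c m.+1) m x).
rewrite big_ord_recr /= mulNr opprK; congr (has_cderiv _ _ _).
by apply/funext => s; rewrite [RHS]big_ord_recr /= mulNr opprK.
Qed.

Lemma uniform_radius (Q : 'I_n -> R -> Prop) :
  (forall i (d d' : R), d' <= d -> Q i d -> Q i d') ->
  (forall i, exists2 d : R, 0 < d & Q i d) -> exists2 d : R, 0 < d & forall i, Q i d.
Proof.
move=> mono h.
have [d hd] := choice (fun i => let: ex_intro2 d d0 q := h i in ex_intro (fun d => 0 < d /\ Q i d) d (conj d0 q)).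
exists (\big[Num.min/1]_i d i).
  by elim/big_ind: _ => // [x y x0 y0|i _]; [rewrite lt_min x0|have [] := hd i].
move=> i; have [_ q] := hd i; apply: mono q; exact: bigmin_le.
Qed.

(** A Peano expansion on the line through [w], enough for Wiener's inequality without convergence of
    the Taylor series. Induction on [m]: along the segment from 0 to [x w], the derivative of the
    remainder of [f] is a combination of the remainders of its partial derivatives, one order
    lower. *)
Lemma taylor_ray U f w K m : nopen U -> hol U f -> (m <= K)%N ->
  (forall x : C, cabs x <= 1 -> U (x *: w)) ->
  forall e : R, 0 < e -> exists2 dl : R, 0 < dl & forall x : C, cabs x < dl ->
    cabs (f (x *: w) - \sum_(k < m.+1) hpart K k f w * x ^+ k) <= e * cabs x ^+ m.
Proof.
move=> oU + + hU; have U0 : U 0 by rewrite -(scale0r w); apply: hU; rewrite cabs0.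
elim: m f => [|m IH] f hf mK e e0.
  have [L hL] := hf 0 U0; have [dl dl0 hdl] := has_fder_cont hL e0.
  have w0 := nrm_ge0 w; have w1 : 0 < nrm w + 1 by lra.
  exists (dl / (nrm w + 1)) => [|x]; first by rewrite divr_gt0.
  rewrite ltr_pdivlMr // => hx; rewrite big_ord1 !expr0 !mulr1 hpart0.
  have := hdl (x *: w); rewrite add0r nrmZ; apply.
  by have := cabs_ge0 x; nra.
have w0 := nrm_ge0 w; have w1 : 0 < nrm w + 1 by lra.
have [||dl dl0 hdl] := @uniform_radius (fun i (d : R) => forall x : C, cabs x < d ->
   cabs (pderiv i f (x *: w) - \sum_(k < m.+1) hpart K k (pderiv i f) w * x ^+ k)
      <= e / (nrm w + 1) * cabs x ^+ m).
- by move=> i d d' dd' h x hx; apply: h; exact: lt_le_trans dd'.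
- move=> i; apply: IH; [exact: pderiv_hol|exact: ltnW|by rewrite divr_gt0].
exists (Num.min dl 1) => [|x]; first by rewrite lt_min dl0 ltr01.
rewrite lt_min => /andP[xdl x1].
pose P (s : C) := \sum_(k < m.+2) hpart K k f w * x ^+ k * s ^+ k.
pose F (s : C) := f (0 + s *: (x *: w)) - P s.
pose D (s : C) := dotL (fun i => pderiv i f (0 + s *: (x *: w))) (x *: w) -
  \sum_(k < m.+1) hpart K k.+1 f w * x ^+ k.+1 * (k.+1%:R * s ^+ k).
have tin (t : R) : 0 <= t <= 1 -> cabs (cR t * x) <= cabs x.
  move=> /andP[t0 t1]; rewrite cabsM cabs_cR ger0_norm // ler_piMl ?cabs_ge0 //.
have hFD (t : R) : 0 <= t <= 1 -> has_cderiv F (cR t) (D (cR t)).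
  move=> ht; apply: has_cderivB; last first.
    exact: (has_cderiv_powers (fun k => hpart K k f w * x ^+ k)).
  apply: has_fder_line; apply: hol_pderiv hf _.
  by rewrite add0r scalerA; apply: hU; apply: le_trans (tin _ ht) (ltW x1).
have hDK (t : R) : 0 <= t <= 1 -> cabs (D (cR t)) <= e * cabs x ^+ m.+1.
  move=> ht; have tx := tin _ ht.
  (* By [hpartS] the derivative of the polynomial part splits into the expansions of the partial
     derivatives at [t x]. *)
  have -> : D (cR t) = x * \sum_i w 0 i * (pderiv i f ((cR t * x) *: w) -
      \sum_(k < m.+1) hpart K k (pderiv i f) w * (cR t * x) ^+ k).
    rewrite /D add0r dotLZ scalerA /dotL.
    under [in RHS]eq_bigr do rewrite mulrBr.
    rewrite sumrB mulrBr; congr (x * _ - _).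
      by apply: eq_bigr => i _; rewrite mulrC.
    under [X in _ = _ * X]eq_bigr do rewrite mulr_sumr.
    rewrite exchange_big /= mulr_sumr; apply: eq_bigr => k _.
    have kK : (k < K)%N by exact: leq_trans (ltn_ord k) mK.
    under [X in _ = _ * X]eq_bigr do rewrite mulrA.
    rewrite -mulr_suml -(hpartS w kK oU hf U0) exprMn exprS; ring.
  rewrite cabsM exprS mulrCA; apply: ler_wpM2l; first exact: cabs_ge0.
  apply: le_trans (cabs_sum _ _ _) _.
  apply: (@le_trans _ _ (\sum_i cabs (w 0 i) * (e / (nrm w + 1) * cabs x ^+ m))).
    apply: ler_sum => i _; rewrite cabsM; apply: ler_wpM2l; first exact: cabs_ge0.
    apply: le_trans (hdl i _ (le_lt_trans tx xdl)) _.
    apply: ler_wpM2l; first by rewrite divr_ge0 // ltW.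
    by rewrite lerXn2r ?nnegrE ?cabs_ge0.
  rewrite -mulr_suml -/(nrm w) mulrA; apply: ler_wpM2r; first by rewrite exprn_ge0 ?cabs_ge0.
  by rewrite mulrCA ler_piMr ?ltW // ltr_pdivrMr //; lra.
have := cmean_value hFD hDK; rewrite /F scale0r scale1r !add0r.
have -> : P 0 = f 0.
  rewrite /P big_ord_recl big1 ?addr0; last by move=> i _; rewrite expr0n /= mulr0.
  by rewrite !expr0 !mulr1 hpart0.
rewrite subrr subr0; congr (cabs (_ - _) <= _).
by apply: eq_bigr => k _; rewrite expr1n mulr1.
Qed.

Lemma homog_wiener U f w (rho M : R) m : nopen U -> hol U f -> 1 < rho ->
  (forall x : C, cabs x < rho -> U (x *: w)) ->
  (forall z, U z -> cabs (f z) <= M) -> (0 < m)%N ->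
  cabs (f 0) + cabs (hpart m m f w) / 2 <= M.
Proof.
move=> oU hf rho1 hU fM m0.
have := @wiener R (fun x => f (0 + x *: w)) rho M (fun k => hpart m k f w) m rho1 m0.
rewrite hpart0; apply.
- move=> x hx; have [|L hL] := hf (0 + x *: w); first by rewrite add0r; exact: hU.
  by exists (dotL L w); exact: has_fder_line.
- by move=> x hx; apply: fM; rewrite add0r; apply: hU; rewrite hx.
move=> e e0; have [|dl dl0 h] := @taylor_ray U f w m m oU hf (leqnn m) _ e e0.
  by move=> x hx; apply: hU; exact: le_lt_trans rho1.
by exists dl => // x hx; rewrite add0r; exact: h.
Qed.

End TaylorRay.

(** * Averages over the torus *)

Section Torus.
Variables (R : realType) (n q : nat).
Local Notation C := (Cx R).
Local Notation N := (2 ^ q)%N.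
Local Notation om := (omega R q).

Definition conj_c (z : C) : C := conjc z.

Lemma mul_conj (z : C) : z * conj_c z = cR (cabs z ^+ 2).
Proof.
case: z => a b; apply/eqP; rewrite eq_complex /cabs /=.
rewrite sqr_sqrtr ?addr_ge0 ?sqr_ge0 //.
by apply/andP; split; apply/eqP; ring.
Qed.

Lemma conj_cM (z w : C) : conj_c (z * w) = conj_c z * conj_c w.
Proof. exact: (rmorphM (@conjc R)). Qed.

Lemma conj_c_sum (I : Type) (r : seq I) (P : pred I) (F : I -> C) :
  conj_c (\sum_(i <- r | P i) F i) = \sum_(i <- r | P i) conj_c (F i).
Proof. exact: (rmorph_sum (@conjc R)). Qed.

Lemma cR_inj : injective (@cR R).
Proof. by move=> x y []. Qed.

Lemma cR_sum (I : Type) (r : seq I) (P : pred I) (F : I -> R) :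
  cR (\sum_(i <- r | P i) F i) = \sum_(i <- r | P i) cR (F i).
Proof. by elim/big_rec2: _ => [//|i x y _ <-]; rewrite cRD. Qed.

(** The torus is replaced by a grid of roots of unity, on which monomials with exponents below
    [2 ^ q] are still exactly orthogonal. *)
Definition tpt (s : {ffun 'I_n -> 'I_N}) : 'rV[C]_n := \row_i om ^+ s i.

Definition tor (a : mi n) (s : {ffun 'I_n -> 'I_N}) : C := zpow (tpt s) a.

Lemma cabs_tpt s i : cabs (tpt s 0 i) = 1.
Proof. by rewrite mxE cabsX cabs_omega expr1n. Qed.

Lemma cabs_tor a s : cabs (tor a s) = 1.
Proof. by rewrite /tor cabs_zpow big1 // => i _; rewrite cabs_tpt expr1n. Qed.

Lemma tor_neq0 a s : tor a s != 0.
Proof. by rewrite -cabs_gt0 cabs_tor. Qed.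

Lemma conj_tor a s : conj_c (tor a s) = (tor a s)^-1.
Proof.
apply: (mulfI (tor_neq0 a s)); rewrite mul_conj cabs_tor expr1n mulfV //.
exact: tor_neq0.
Qed.

Lemma sum_omega_ratio (a b : nat) : (a < N)%N -> (b < N)%N ->
  \sum_(j < N) (om ^+ j) ^+ a * ((om ^+ j) ^+ b)^-1 = if a == b then N%:R else 0.
Proof.
move=> aN bN; have w0 (j : nat) : om ^+ j != 0 by rewrite expf_neq0 // omega_neq0.
have -> : \sum_(j < N) (om ^+ j) ^+ a * ((om ^+ j) ^+ b)^-1 =
   \sum_(j < N) (om ^+ (a + (N - b))) ^+ j.
  apply: eq_bigr => j _; rewrite [RHS]exprAC exprD; congr (_ * _).
  apply: (mulIf (expf_neq0 b (w0 j))); rewrite mulVf ?(expf_neq0 b (w0 j)) //.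
  transitivity ((om ^+ j) ^+ (N - b + b)); last exact: exprD.
  by rewrite subnK 1?ltnW // exprAC omega_order expr1n.
case: eqP => [->|ab].
  by rewrite subnKC 1?ltnW // omega_order (eq_bigr (fun=> 1)) ?sumr_const ?card_ord // => j _; rewrite expr1n.
apply: sum_omega; apply/negP => /dvdnP[k hk]; apply: ab.
(* The exponent [a + (N - b)] lies strictly between 0 and [2 N]. *)
have k1 : k = 1%N by nia.
by move: hk; rewrite k1; lia.
Qed.

Lemma tor_orth (a b : mi n) : (forall i, (a i < N)%N) -> (forall i, (b i < N)%N) ->
  \sum_s tor a s * (tor b s)^-1 = if a == b then (N ^ n)%:R else 0.
Proof.
move=> aN bN.
transitivity (\prod_(i < n) \sum_(j < N) (om ^+ j) ^+ a i * ((om ^+ j) ^+ b i)^-1).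
  rewrite bigA_distr_bigA /=; apply: eq_bigr => s _.
  rewrite /tor /zpow -prodfV -big_split /=; apply: eq_bigr => i _.
  by rewrite mxE.
rewrite (eq_bigr (fun i => if a i == b i then N%:R else 0)); last first.
  by move=> i _; rewrite sum_omega_ratio.
case: eqP => [->|/eqP ab].
  by rewrite (eq_bigr (fun=> N%:R)) ?prodr_const ?card_ord ?natrX // => i _; rewrite eqxx.
have [i /negbTE hi] : exists i, a i != b i.
  apply/existsP; rewrite -negb_forall; apply: contra ab => /forallP h.
  by apply/eqP/ffunP => i; apply/eqP.
by rewrite (bigD1 i) //= hi mul0r.
Qed.

Definition tavg (h : {ffun 'I_n -> 'I_N} -> R) : R := (\sum_s h s) / (N ^ n)%:R.

Lemma Nn_gt0 : (0 : R) < (N ^ n)%:R.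
Proof. by rewrite ltr0n !expn_gt0. Qed.

Lemma Nnc_neq0 : (N ^ n)%:R != 0 :> C.
Proof. by rewrite -cabs_eq0 cabs_nat lt0r_neq0 // Nn_gt0. Qed.

Lemma tavg_ge0 h : (forall s, 0 <= h s) -> 0 <= tavg h.
Proof. by move=> h0; rewrite divr_ge0 ?ler0n // sumr_ge0. Qed.

Lemma tavg_le h (M : R) : (forall s, h s <= M) -> tavg h <= M.
Proof.
move=> hM; rewrite ler_pdivrMr ?Nn_gt0 //.
apply: le_trans (ler_sum _ (fun s _ => hM s)) _.
by rewrite sumr_const card_ffun !card_ord mulr_natr.
Qed.

Definition tpoly K (G : mE n K -> C) s : C := \sum_t G t * tor (emb t) s.

Lemma parseval K (G : mE n K -> C) : (K < N)%N ->
  tavg (fun s => cabs (tpoly G s) ^+ 2) = \sum_t cabs (G t) ^+ 2.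
Proof.
move=> KN; apply: cR_inj; rewrite /tavg cRM cRV cR_nat !cR_sum.
have eN (t : mE n K) i : (emb t i < N)%N.
  by rewrite ffunE; apply: leq_trans (ltn_ord _) _.
transitivity ((\sum_t \sum_u (G t * conj_c (G u)) * \sum_s tor (emb t) s * (tor (emb u) s)^-1)
   / (N ^ n)%:R : C).
  congr (_ / _); under eq_bigr do rewrite -mul_conj /tpoly conj_c_sum mulr_suml.
  rewrite exchange_big /=; apply: eq_bigr => t _.
  under eq_bigr do rewrite mulr_sumr.
  rewrite exchange_big /=; apply: eq_bigr => u _.
  rewrite mulr_sumr; apply: eq_bigr => s _.
  by rewrite conj_cM conj_tor mulrACA.
rewrite mulr_suml; apply: eq_bigr => t _.
rewrite (bigD1 t) //= [X in (_ + X) / _]big1 => [|u ut].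
  by rewrite tor_orth // eqxx addr0 mulfK ?Nnc_neq0 // mul_conj.
by rewrite tor_orth // (inj_eq (@emb_inj _ _)) eq_sym (negbTE ut) mulr0.
Qed.

Lemma sum_cauchy_schwarz (I : finType) (P : pred I) (a b : I -> R) :
  (\sum_(i | P i) a i * b i) ^+ 2 <= (\sum_(i | P i) a i ^+ 2) * (\sum_(i | P i) b i ^+ 2).
Proof.
set A := \sum_(i | P i) a i ^+ 2; set B := \sum_(i | P i) b i ^+ 2.
set X := \sum_(i | P i) a i * b i.
have A0 : 0 <= A by apply: sumr_ge0 => i _; exact: sqr_ge0.
have B0 : 0 <= B by apply: sumr_ge0 => i _; exact: sqr_ge0.
have key (x y : R) : 0 <= x ^+ 2 * A - 2 * x * y * X + y ^+ 2 * B.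
  have -> : x ^+ 2 * A - 2 * x * y * X + y ^+ 2 * B = \sum_(i | P i) (x * a i - y * b i) ^+ 2.
    rewrite /A /B /X !mulr_sumr -sumrB -big_split /=; apply: eq_bigr => i _; ring.
  by apply: sumr_ge0 => i _; exact: sqr_ge0.
have [B00|B00] := eqVneq B 0.
  have [->|X0] := eqVneq X 0; first by rewrite expr0n B00 mulr0.
  (* For [B = 0] the quadratic form is affine in [y], and this [y] gives it the negative value
     [A - 2 (A + 1)]. *)
  have := key 1 ((A + 1) / X); rewrite B00 mulr0 addr0 mulr1 -mulrA mulfVK //.
  by rewrite expr1n; lra.
have Bp : 0 < B by rewrite lt_def B00.
have := key B X; have -> : B ^+ 2 * A - 2 * B * X * X + X ^+ 2 * B = B * (A * B - X ^+ 2) by ring.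
by rewrite pmulr_rge0 // subr_ge0.
Qed.

Definition addE K (s t : mE n K) : mE n (K + K) := [ffun i => inord (s i + t i)].

Lemma emb_addE K (s t : mE n K) i : emb (addE s t) i = (emb s i + emb t i)%N.
Proof.
rewrite !ffunE inordK // ltnS leq_add //; rewrite -ltnS; exact: ltn_ord.
Qed.

Lemma zpow_addE K (s t : mE n K) (z : 'rV[C]_n) :
  zpow z (emb s) * zpow z (emb t) = zpow z (emb (addE s t)).
Proof.
rewrite /zpow -big_split /=; apply: eq_bigr => i _.
by rewrite -exprD emb_addE.
Qed.

(* A multi-index [u] of degree [2d] has at most [prod (u_i + 1) <= 4^d] predecessors. *)
Lemma card_addE K d (u : mE n (K + K)) (D : pred (mE n K)) :
  (forall t, D t -> deg (emb t) = d) ->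
  (#|[pred st : mE n K * mE n K | [&& D st.1, D st.2 & addE st.1 st.2 == u]]| <= 4 ^ d)%N.
Proof.
move=> hD; set A := [pred st | _].
case: (pickP A) => [st0 st0A|A0]; last by rewrite (eq_card0 A0).
have du : deg (emb u) = (d + d)%N.
  move: st0A; rewrite /A /= => /and3P[/hD h1 /hD h2 /eqP <-].
  rewrite -{1}h1 -h2 /deg -big_split /=; apply: eq_bigr => i _; exact: emb_addE.
  have inj : {in A &, injective (fun st : mE n K * mE n K => st.1)}.
    move=> [s t] [s' t']; rewrite !inE /= => /and3P[_ _ /eqP h] /and3P[_ _ /eqP h'] ss'.
    subst s'; congr (_, _); apply: (@emb_inj n K); apply/ffunP => i.
    have := congr1 (fun v => emb v i) (etrans h (esym h')).
    by rewrite !emb_addE => /addnI.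
  rewrite -(card_in_image inj).
  pose fam := family (fun i : 'I_n => [pred x : 'I_K.+1 | (x < (u i).+1)%N]).
  apply: (@leq_trans #|fam|).
    apply: subset_leq_card; apply/fintype.subsetP => s hs.
    have [[s' t] + ->] := fintype.imageP hs; rewrite inE /= => /and3P[_ _ /eqP hu]; apply/familyP => i; rewrite inE ltnS.
    have := emb_addE s' t i; rewrite hu !ffunE => ->; exact: leq_addr.
  rewrite card_family -[(4 ^ d)%N]/((2 ^ 2) ^ d)%N -expnM mul2n -addnn -du /deg.
  rewrite foldrE big_map big_enum /= expn_sum; apply: leq_prod => i _.
  apply: (@leq_trans (u i).+1); last by rewrite ffunE; exact: ltn_expl.
  apply: leq_trans (_ : size (iota 0 (u i).+1) <= _)%N; last by rewrite size_iota.
  rewrite cardE -(size_map val); apply: uniq_leq_size.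
    by rewrite (map_inj_uniq val_inj) enum_uniq.
  by move=> x /mapP[y hy ->]; move: hy; rewrite mem_enum mem_iota => hy; exact: hy.
Qed.

(** Parseval for the square of the polynomial, whose exponents require [K + K < N]. Each of its
    coefficients is a sum over at most [4 ^ d] pairs, so Cauchy-Schwarz costs this factor; summed
    over all [u], the squares of the products give the squared [l^2] sum. *)
Lemma tpoly_l4 K d (G : mE n K -> C) : (K + K < N)%N ->
  (forall t, G t != 0 -> deg (emb t) = d) ->
  tavg (fun s => cabs (tpoly G s) ^+ 4) <= 4 ^+ d * (\sum_t cabs (G t) ^+ 2) ^+ 2.
Proof.
move=> KN hG; pose D : pred (mE n K) := [pred t | G t != 0].
have hD t : D t -> deg (emb t) = d by exact: hG.
pose H (u : mE n (K + K)) := \sum_(st | [&& D st.1, D st.2 & addE st.1 st.2 == u]) G st.1 * G st.2.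
have sqH s : tpoly G s ^+ 2 = tpoly H s.
  have -> : tpoly G s = \sum_(t | D t) G t * tor (emb t) s.
    rewrite /tpoly [LHS](bigID D) /= [X in _ + X]big1 ?addr0 // => t.
    by rewrite negbK => /eqP ->; rewrite mul0r.
  rewrite expr2 mulr_suml; under eq_bigr do rewrite mulr_sumr.
  rewrite pair_big /= (partition_big (fun st => addE st.1 st.2) xpredT) //=.
  rewrite /tpoly; apply: eq_bigr => u _; rewrite /H mulr_suml.
  apply: eq_big => [st|st]; first by rewrite andbA.
  move=> /andP[_ /eqP <-]; rewrite mulrACA; congr (_ * _).
  exact: zpow_addE.
have -> : tavg (fun s => cabs (tpoly G s) ^+ 4) = \sum_u cabs (H u) ^+ 2.
  rewrite -(@parseval (K + K) H KN); congr (_ / _); apply: eq_bigr => s _.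
  by rewrite -sqH cabsX -exprM.
pose P u (st : mE n K * mE n K) := [&& D st.1, D st.2 & addE st.1 st.2 == u].
apply: (@le_trans _ _ (\sum_u 4 ^+ d * \sum_(st | P u st) (cabs (G st.1) * cabs (G st.2)) ^+ 2)).
  apply: ler_sum => u _.
  apply: (@le_trans _ _ ((\sum_(st | P u st) 1 * (cabs (G st.1) * cabs (G st.2))) ^+ 2)).
    have le1 : cabs (H u) <= \sum_(st | P u st) 1 * (cabs (G st.1) * cabs (G st.2)).
      apply: le_trans (cabs_sum _ _ _) _; apply: ler_sum => st _.
      by rewrite mul1r cabsM.
    by rewrite lerXn2r ?nnegrE ?cabs_ge0 // (le_trans (cabs_ge0 _) le1).
  apply: le_trans (sum_cauchy_schwarz _ _ _) _; apply: ler_wpM2r.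
    by apply: sumr_ge0 => st _; exact: sqr_ge0.
  rewrite (eq_bigr (fun=> 1)) => [|i _]; last by rewrite expr1n.
  by rewrite sumr_const -natrX ler_nat; apply: card_addE.
rewrite -mulr_sumr; apply: ler_wpM2l; first by rewrite exprn_ge0.
rewrite expr2 mulr_suml; under [X in _ <= X]eq_bigr do rewrite mulr_sumr.
rewrite pair_big /= [X in _ <= X](partition_big (fun st => addE st.1 st.2) xpredT) //=.
apply: ler_sum => u _; rewrite [X in _ <= X](bigID (fun st => D st.1 && D st.2)) /=.
rewrite -[X in X <= _]addr0; apply: lerD.
  apply: eq_ler; apply: eq_big => [st|st _]; last by rewrite exprMn.
  by rewrite /P andbA andbC.
by apply: sumr_ge0 => st _; rewrite mulr_ge0 ?sqr_ge0.
Qed.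

Lemma tavg_cauchy_schwarz (a b : {ffun 'I_n -> 'I_N} -> R) :
  tavg (fun s => a s * b s) ^+ 2 <= tavg (fun s => a s ^+ 2) * tavg (fun s => b s ^+ 2).
Proof.
rewrite /tavg exprMn [X in _ <= X]mulrACA -[X in _ <= _ * X]expr2.
apply: ler_wpM2r; first exact: sqr_ge0.
exact: sum_cauchy_schwarz.
Qed.

(* Khinchine's inequality for homogeneous Steinhaus chaoses, by interpolation
   between L^1 and L^4. *)
Lemma tpoly_l2_le_l1 K d (G : mE n K -> C) : (K + K < N)%N ->
  (forall t, G t != 0 -> deg (emb t) = d) ->
  \sum_t cabs (G t) ^+ 2 <= 4 ^+ d * tavg (fun s => cabs (tpoly G s)) ^+ 2.
Proof.
move=> KN hG; set S := \sum_t _; pose x s := cabs (tpoly G s).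
have x0 s : 0 <= x s by exact: cabs_ge0.
pose X k := tavg (fun s => x s ^+ k).
have X0 k : 0 <= X k by apply: tavg_ge0 => s; rewrite exprn_ge0.
have eS : S = X 2%N by rewrite /X /x parseval //; exact: leq_ltn_trans (leq_addr _ _) KN.
have X1 : tavg (fun s => cabs (tpoly G s)) = X 1%N by [].
have h4 : X 4%N <= 4 ^+ d * S ^+ 2 by exact: tpoly_l4.
(* Interpolation by two Cauchy-Schwarz steps, with [x^2 = x^(1/2) x^(3/2)] and [x^3 = x x^2]: [X_2^4
   <= X_1^2 X_3^2 <= X_1^2 X_2 X_4 <= 4^d X_1^2 X_2^3]. *)
have h13 : X 2%N ^+ 2 <= X 1%N * X 3%N.
  have := tavg_cauchy_schwarz (fun s => Num.sqrt (x s)) (fun s => x s * Num.sqrt (x s)).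
  have e1 : (fun s => Num.sqrt (x s) * (x s * Num.sqrt (x s))) = (fun s => x s ^+ 2).
    by apply/funext => s; rewrite mulrCA -expr2 sqr_sqrtr // expr2.
  have e2 : (fun s => Num.sqrt (x s) ^+ 2) = (fun s => x s ^+ 1).
    by apply/funext => s; rewrite sqr_sqrtr.
  have e3 : (fun s => (x s * Num.sqrt (x s)) ^+ 2) = (fun s => x s ^+ 3).
    by apply/funext => s; rewrite exprMn sqr_sqrtr // -exprSr.
  by rewrite e1 e2 e3.
have h24 : X 3%N ^+ 2 <= X 2%N * X 4%N.
  have := tavg_cauchy_schwarz x (fun s => x s ^+ 2).
  have e1 : (fun s => x s * x s ^+ 2) = (fun s => x s ^+ 3).
    by apply/funext => s; rewrite -exprS.
  have e2 : (fun s => (x s ^+ 2) ^+ 2) = (fun s => x s ^+ 4).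
    by apply/funext => s; rewrite -exprM.
  by rewrite e1 e2.
rewrite X1 -eS in h13 h24 *; have S0 : 0 <= S by rewrite eS.
have := X0 1%N; have := X0 3%N; have := X0 4%N.
move: (X 1%N) (X 3%N) (X 4%N) h4 h13 h24 => x1 x3 x4 h4 h13 h24 x40 x30 x10.
have [->|Sn] := eqVneq S 0; first by rewrite mulr_ge0 ?exprn_ge0.
have Sp : 0 < S by rewrite lt_def Sn.
have p4 : 0 <= (4 : R) ^+ d by rewrite exprn_ge0.
have s1 : (S ^+ 2) ^+ 2 <= (x1 * x3) ^+ 2.
  by rewrite lerXn2r ?nnegrE ?sqr_ge0 // mulr_ge0.
have s2 : (x1 * x3) ^+ 2 <= x1 ^+ 2 * (S * (4 ^+ d * S ^+ 2)).
  rewrite exprMn; apply: ler_wpM2l; first exact: sqr_ge0.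
  by apply: le_trans h24 _; apply: ler_wpM2l.
have := le_trans s1 s2.
have -> : (S ^+ 2) ^+ 2 = S * S ^+ 3 by ring.
have -> : x1 ^+ 2 * (S * (4 ^+ d * S ^+ 2)) = (4 ^+ d * x1 ^+ 2) * S ^+ 3 by ring.
by rewrite ler_pM2r // exprn_gt0.
Qed.

(** Cauchy-Schwarz for the coefficients, then Khinchine with constant [2 ^ d] for each factor. *)
Lemma sum_le_tavg K d (G H : mE n K -> C) : (K + K < N)%N ->
  (forall t, G t != 0 -> deg (emb t) = d) -> (forall t, H t != 0 -> deg (emb t) = d) ->
  \sum_t cabs (G t) * cabs (H t) <=
  4 ^+ d * (tavg (fun s => cabs (tpoly G s)) * tavg (fun s => cabs (tpoly H s))).
Proof.
move=> KN hG hH.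
have a0 F : 0 <= tavg (fun s => cabs (tpoly F s)) by apply: tavg_ge0 => s; exact: cabs_ge0.
have p4 : 0 <= (4 : R) ^+ d by rewrite exprn_ge0.
rewrite -(@ler_pXn2r _ 2) ?nnegrE //; last first.
- by apply: mulr_ge0 => //; apply: mulr_ge0; exact: a0.
- by apply: sumr_ge0 => t _; rewrite mulr_ge0 ?cabs_ge0.
apply: le_trans (sum_cauchy_schwarz _ _ _) _.
have s0 (F : mE n K -> C) : 0 <= \sum_t cabs (F t) ^+ 2.
  by apply: sumr_ge0 => t _; exact: sqr_ge0.
apply: le_trans (ler_pM (s0 _) (s0 _) (tpoly_l2_le_l1 KN hG) (tpoly_l2_le_l1 KN hH)) _.
apply: eq_ler; ring.
Qed.

End Torus.

(** * Bounded functions *)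

Section BoundedFunctions.
Variables (R : realType) (T : Type).
Local Notation C := (Cx R).

Definition sup_bounded : {pred (T -> C)} :=
  fun f => `[< exists M : R, forall x, cabs (f x) <= M >].

Lemma sup_boundedP (f : T -> C) :
  reflect (exists M : R, forall x, cabs (f x) <= M) (f \in sup_bounded).
Proof. exact: asboolP. Qed.

Lemma sup_bounded_closed : submod_closed sup_bounded.
Proof.
split=> [|a f g /sup_boundedP[M hM] /sup_boundedP[M' hM']]; apply/sup_boundedP.
  by exists 0 => x; rewrite cabs0.
exists (cabs a * M + M') => x; apply: le_trans (cabsD _ _) _.
by rewrite lerD // cabsM ler_wpM2l ?cabs_ge0.
Qed.

HB.instance Definition _ := GRing.isSubmodClosed.Build C (T -> C) sup_bounded
  sup_bounded_closed.

(** The Banach space [l^infty(T)], later with [T] the unit ball. It is built as a complete normed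
    module because the projection constant ranges over those. *)
Record bfun := Bfun { bfun_val :> T -> C ; bfun_bounded : bfun_val \in sup_bounded }.

HB.instance Definition _ := [isSub for bfun_val].
HB.instance Definition _ := [Choice of bfun by <:].
HB.instance Definition _ := [SubChoice_isSubLmodule of bfun by <:].

Implicit Types f g : bfun.

Lemma bfunD f g x : (f + g) x = f x + g x. Proof. by []. Qed.
Lemma bfunN f x : (- f) x = - f x. Proof. by []. Qed.
Lemma bfunZ (a : C) f x : (a *: f) x = a * f x. Proof. by []. Qed.
Lemma bfun0 x : (0 : bfun) x = 0. Proof. by []. Qed.

Lemma bfun_ext f g : (forall x, f x = g x) -> f = g.
Proof. by move=> h; apply: val_inj; apply/funext. Qed.

Definition supnorm f : R := sup [set cabs (f x) | x in setT].

Lemma supnorm_ge f x : cabs (f x) <= supnorm f.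
Proof.
have /sup_boundedP[M hM] := bfun_bounded f.
by apply: ub_le_sup; [exists M => _ [y _ <-]; exact: hM|exists x].
Qed.

Lemma supnorm_le f (M : R) : 0 <= M -> (forall x, cabs (f x) <= M) -> supnorm f <= M.
Proof.
move=> M0 hM; rewrite /supnorm.
have [[y [x _ _]]|/set0P/negP/negPn/eqP ->] := pselect ([set cabs (f x) | x in setT] !=set0).
  by apply: ge_sup; [exists (cabs (f x)), x|move=> _ [z _ <-]; exact: hM].
by rewrite sup0.
Qed.

Lemma supnorm_ge0 f : 0 <= supnorm f.
Proof.
have [[y [x _ _]]|/set0P/negP/negPn/eqP e] := pselect ([set cabs (f x) | x in setT] !=set0).
  by apply: le_trans (supnorm_ge f x); exact: cabs_ge0.
by rewrite /supnorm e sup0.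
Qed.

Definition bnorm f : C := cR (supnorm f).

Lemma bnormD f g : bnorm (f + g) <= bnorm f + bnorm g.
Proof.
rewrite /bnorm -cRD lecR; apply: supnorm_le => [|x]; first by rewrite addr_ge0 ?supnorm_ge0.
by rewrite bfunD; apply: le_trans (cabsD _ _) _; apply: lerD; exact: supnorm_ge.
Qed.

Lemma supnormZ (a : C) f : supnorm (a *: f) = cabs a * supnorm f.
Proof.
have le b h : supnorm (b *: h) <= cabs b * supnorm h.
  apply: supnorm_le => [|x]; first by rewrite mulr_ge0 ?cabs_ge0 ?supnorm_ge0.
  by rewrite bfunZ cabsM ler_wpM2l ?cabs_ge0 ?supnorm_ge.
apply/eqP; rewrite eq_le le /=; have [->|a0] := eqVneq a 0.
  by rewrite cabs0 mul0r supnorm_ge0.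
have ca : 0 < cabs a by rewrite cabs_gt0.
rewrite -ler_pdivlMl // -cabsV; apply: le_trans (le _ _).
by rewrite scalerA mulVf // scale1r.
Qed.

Lemma bnormZ (a : C) f : bnorm (a *: f) = `|a| * bnorm f.
Proof. by rewrite /bnorm supnormZ cRM norm_cabs. Qed.

Lemma bnorm_eq0 f : bnorm f = 0 -> f = 0.
Proof.
move=> /(@cR_inj _ _ 0) f0; apply: bfun_ext => x; apply/eqP.
by rewrite bfun0 -cabs_eq0 eq_le cabs_ge0 -f0 supnorm_ge.
Qed.

HB.instance Definition _ := Lmodule_isNormed.Build C bfun bnormD bnormZ bnorm_eq0.

Lemma bfun_normE f : `|f| = cR (supnorm f).
Proof. by []. Qed.

(** The filter contains a ball of radius [1 / (k + 1)] about some [u k]. Any two of these balls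
    meet, so the [u k] converge pointwise at a rate independent of the point. *)
Lemma bfun_complete (F : set_system bfun) : ProperFilter F -> cauchy F -> cvg F.
Proof.
move=> FF /cauchyP Fc.
have hk (k : nat) : exists f, F (ball f (cR (k.+1%:R)^-1 : C)).
  by apply: Fc; rewrite cR_gt0 invr_gt0.
have [u hu] := choice hk.
have inter k l : exists f, ball (u k) (cR (k.+1%:R)^-1 : C) f /\ ball (u l) (cR (l.+1%:R)^-1 : C) f.
  by have [f] := filter_ex (filterI (hu k) (hu l)); exists f.
have ballE f (e : R) g : ball f (cR e : C) g -> forall x, cabs (f x - g x) <= e.
  rewrite -ball_normE /= bfun_normE ltcR => /ltW h x.
  by apply: le_trans h; rewrite -bfunN -bfunD; exact: supnorm_ge.
have ukl k l x : cabs (u k x - u l x) <= (k.+1%:R)^-1 + (l.+1%:R)^-1.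
  have [f [/ballE h1 /ballE h2]] := inter k l.
  rewrite (_ : u k x - u l x = (u k x - f x) - (u l x - f x)); last by ring.
  by apply: le_trans (cabsB _ _) _; exact: lerD.
have small (e : R) : 0 < e -> exists N : nat, forall k, (N <= k)%N -> (k.+1%:R)^-1 <= e.
  move=> e0; exists (Num.truncn e^-1) => k Nk.
  rewrite -[e]invrK lef_pV2 ?posrE ?invr_gt0 //.
  by apply: ltW; apply: lt_le_trans (truncnS_gt _) _; rewrite ler_nat ltnS.
have hlim x : exists l, forall k, cabs (u k x - l) <= (k.+1%:R)^-1.
  have [|l hl] := @complex_cauchy R (fun k => u k x).
    move=> e e0; have [|N hN] := small (e / 2); first by rewrite divr_gt0.
    exists N => p q /hN hp /hN hq; apply: le_trans (ukl p q x) _.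
    by apply: le_trans (lerD hp hq) _; rewrite -splitr.
  exists l => k; apply/ler_addgt0Pr => e e0.
  have [|N1 hN1] := hl (e / 2); first by rewrite divr_gt0.
  have [|N2 hN2] := small (e / 2); first by rewrite divr_gt0.
  have {}hN1 := hN1 _ (leq_addr N2 N1); have {}hN2 := hN2 _ (leq_addl N1 N2).
  rewrite (_ : u k x - l = (u k x - u (N1 + N2)%N x) + (u (N1 + N2)%N x - l)); last by ring.
  apply: le_trans (cabsD _ _) _; apply: le_trans (lerD (ukl _ _ _) hN1) _.
  by apply: le_trans (lerD (lerD (lexx _) hN2) (lexx _)) _; rewrite -addrA -splitr.
have [g hg] := choice hlim.
have gb : g \in sup_bounded.
  apply/sup_boundedP; exists (supnorm (u 0%N) + 1) => x.
  rewrite -[g x](subrK (u 0%N x)) addrC; apply: le_trans (cabsD _ _) _.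
  apply: lerD (supnorm_ge _ _) _; rewrite cabsC; apply: le_trans (hg x 0%N) _.
  by rewrite invr1.
apply/cvg_ex; exists (Bfun gb); apply/cvgrPdist_le => e /complex_gt0[y y0 ->].
have [|N hN] := small (y / 2); first by rewrite divr_gt0.
have {}hN := hN N (leqnn _).
apply: filterS (hu N) => f /ballE h; rewrite bfun_normE lecR.
apply: supnorm_le => [|x]; first exact: ltW.
rewrite bfunD bfunN /= (_ : g x - f x = (u N x - f x) - (u N x - g x)); last by ring.
apply: le_trans (cabsB _ _) _; apply: le_trans (lerD (h x) (hg x N)) _.
by apply: le_trans (lerD hN hN) _; rewrite -splitr.
Qed.

HB.instance Definition _ := Uniform_isComplete.Build bfun bfun_complete.

Lemma bfun_sumE (I : Type) (s : seq I) (F : I -> bfun) x :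
  (\sum_(i <- s) F i) x = \sum_(i <- s) F i x.
Proof. by elim/big_rec2: _ => [//|i y z _ <-]. Qed.

End BoundedFunctions.

(** * Finite partitions on which bounded functions are nearly constant *)

Section Cells.
Variables (R : realType) (T : Type).
Local Notation C := (Cx R).

Lemma real_cells (u : T -> R) (M e : R) : 0 < e -> (forall x, `|u x| <= M) ->
  exists (W : finType) (cell : T -> W),
    forall x y, cell x = cell y -> `|u x - u y| <= e.
Proof.
move=> e0 hM; pose v x := (u x + M) / e.
have v0 x : 0 <= v x.
  have h : 0 <= u x + M by have := hM x; rewrite ler_norml => /andP[]; lra.
  by rewrite divr_ge0 // ltW.
pose K := Num.truncn (2 * M / e).
exists 'I_K.+1, (fun x => inord (Num.truncn (v x))) => x y.
have vK z : (Num.truncn (v z) < K.+1)%N.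
  rewrite ltnS; apply: le_truncn; rewrite ler_pM2r ?invr_gt0 //.
  by have := hM z; rewrite ler_norml => /andP[]; lra.
move=> /(congr1 val); rewrite /= !inordK // => h.
have := truncn_itv (v0 x); have := truncn_itv (v0 y); rewrite h -!natr1.
move: (Num.truncn _)%:R => N /andP[a1 a2] /andP[b1 b2].
have -> : u x - u y = (v x - v y) * e by rewrite /v; field; rewrite lt0r_neq0.
by rewrite normrM (gtr0_norm e0) ler_piMl ?(ltW e0) // ler_norml; apply/andP; split; lra.
Qed.

(** Real and imaginary parts of all functions are discretized separately, and the product partition
    controls them at once. The functions will be the monomials of degree [d] on the ball. *)
Lemma complex_cells (I : finType) (phi : I -> T -> C) (M e : R) : 0 < e ->
  (forall i x, cabs (phi i x) <= M) ->
  exists (W : finType) (cell : T -> W),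
    forall x y, cell x = cell y -> forall i, cabs (phi i x - phi i y) <= e.
Proof.
move=> e0 hM; have e2 : 0 < e / 2 by rewrite divr_gt0.
pose part (b : bool) : C -> R := if b then @complex.Re R else @complex.Im R.
have hc (ib : I * bool) : exists Wc : {W : finType & T -> W},
   forall x y, projT2 Wc x = projT2 Wc y ->
   `|part ib.2 (phi ib.1 x)
     - part ib.2 (phi ib.1 y)| <= e / 2.
  have [|W [cell h]] := @real_cells
      (fun x => part ib.2 (phi ib.1 x)) M _ e2.
    move=> x; apply: le_trans (hM ib.1 x).
    by rewrite /part; case: ib.2; [exact: cabs_Re|exact: cabs_Im].
  by exists (existT _ W cell).
have [Wc hWc] := choice hc.
exists {dffun forall ib, projT1 (Wc ib)}, (fun x => [ffun ib => projT2 (Wc ib) x]).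
move=> x y /ffunP h i.
have h1 := hWc (i, true) x y ltac:(by have := h (i, true); rewrite !ffunE).
have h2 := hWc (i, false) x y ltac:(by have := h (i, false); rewrite !ffunE).
apply: le_trans (cabs_ReIm _) _; rewrite /= in h1 h2.
move: h1 h2; case: (phi i x) => a b; case: (phi i y) => c d /=; lra.
Qed.

End Cells.

(** * The spaces of polynomials *)

(** Averaging over roots of unity with weight [om^(N-1) = om^-1] thus isolates the linear
    coefficient of a polynomial. *)
Lemma ndvdn_shift (N k : nat) : (1 < N)%N -> (k < N)%N -> k != 1%N ->
  ~~ (N %| k + (N - 1))%N.
Proof.
move=> N1 kN /eqP k1; apply/negP => /dvdnP[l hl]; apply: k1.
have l1 : l = 1%N by nia.
by move: hl; rewrite l1; lia.
Qed.

Section Lattice.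
Variables (R : realType) (inX : set (nat -> Cx R)) (nX : (nat -> Cx R) -> R) (n : nat).
Local Notation C := (Cx R).
Local Notation V := 'rV[C]_n.
Hypothesis lat : is_banach_seq_lattice inX nX.
Implicit Types (z w u : V) (a : mi n) (c : mi n -> C) (I : set (mi n)).

Definition seq_of z : nat -> C :=
  fun k => if @insub nat (fun k => k < n)%N 'I_n k is Some i then z ord0 i else 0.

Definition unit_seq (j : nat) : nat -> C := fun k => if k == j then 1 else 0.

Lemma inX_unit j : inX (unit_seq j).
Proof. by have [_ [_ [_ [_ h]]]] := lat; exact: h. Qed.

Lemma nX_lattice x y : inX x -> (forall k, cabs (y k) <= cabs (x k)) -> inX y /\ nX y <= nX x.
Proof. by have [_ [_ [_ [h _]]]] := lat; exact: h. Qed.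

Lemma seq_ofE z k : seq_of z k = \sum_(i < n) z ord0 i * unit_seq i k.
Proof.
rewrite /seq_of; case: insubP => [i _ <-|kn].
  rewrite (bigD1 i) //= {1}/unit_seq eqxx mulr1 big1 ?addr0 // => j ji.
  by rewrite /unit_seq (inj_eq val_inj) eq_sym (negbTE ji) mulr0.
rewrite big1 // => i _; rewrite /unit_seq ifF ?mulr0 //.
by apply/negP => /eqP e; rewrite e ltn_ord in kn.
Qed.

Lemma inX_nX_sum (r : seq 'I_n) (x : 'I_n -> nat -> C) : (forall i, inX (x i)) ->
  inX (fun k => \sum_(i <- r) x i k) /\
  nX (fun k => \sum_(i <- r) x i k) <= \sum_(i <- r) nX (x i).
Proof.
have [[X0 [XD XZ]] [[n0 [n1 [nZ nD]]] _]] := lat.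
have nX0 : nX (fun=> 0) = 0.
  have e : (fun k : nat => 0 * (0 : C)) = (fun=> 0) by apply/funext => k; rewrite mul0r.
  by have := nZ 0 _ X0; rewrite e cabs0 mul0r.
move=> hx; elim: r => [|i r [IH1 IH2]].
  rewrite (_ : (fun k => _) = (fun=> 0)); last by apply/funext => k; rewrite big_nil.
  by rewrite big_nil nX0.
rewrite (_ : (fun k => _) = (fun k => x i k + \sum_(i <- r) x i k)); last first.
  by apply/funext => k; rewrite big_cons.
split; first exact: XD.
by rewrite big_cons; apply: le_trans (nD _ _ _ _) _ => //; rewrite lerD2l.
Qed.

Lemma inX_seq_of z : inX (seq_of z).
Proof.
have [[X0 [XD XZ]] _] := lat.
rewrite (_ : seq_of z = fun k => \sum_(i < n) z ord0 i * unit_seq i k); last first.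
  by apply/funext => k; exact: seq_ofE.
by apply: (inX_nX_sum _ (x := fun i k => z ord0 i * unit_seq i k) _).1 => i; apply/XZ/inX_unit.
Qed.

Lemma normXnE z : normXn nX z = nX (seq_of (\row_i cR (cabs (z ord0 i)))).
Proof.
rewrite /normXn; congr nX; apply/funext => k; rewrite /seq_of.
by case: insub => [i|//]; rewrite mxE.
Qed.

(** The ideal property in both directions makes sequences with equal moduli equal in norm. Without
    the moduli the norm is taken of a linear function of [z], from which its axioms are
    inherited. *)
Lemma normXn_seq z : normXn nX z = nX (seq_of z).
Proof.
have e k : cabs (seq_of (\row_i cR (cabs (z ord0 i))) k) = cabs (seq_of z k).
  rewrite /seq_of; case: insub => [i|//].
  by rewrite mxE cabs_cR ger0_norm ?cabs_ge0.
rewrite normXnE; apply/eqP; rewrite eq_le.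
by rewrite !(nX_lattice (inX_seq_of _) _).2 // => k; rewrite e.
Qed.

Lemma normXn_mono z w : (forall i, cabs (z 0 i) <= cabs (w 0 i)) -> normXn nX z <= normXn nX w.
Proof.
move=> h; rewrite !normXn_seq; apply: (nX_lattice (inX_seq_of _) _).2 => k.
by rewrite /seq_of; case: insub => [i|]; [exact: h|exact: lexx].
Qed.

Lemma normXn_ge0 z : 0 <= normXn nX z.
Proof. by have [_ [[n0 _] _]] := lat; rewrite normXn_seq; apply/n0/inX_seq_of. Qed.

Lemma normXnZ (x : C) z : normXn nX (x *: z) = cabs x * normXn nX z.
Proof.
have [_ [[_ [_ [nZ _]]] _]] := lat.
rewrite !normXn_seq -nZ; last exact: inX_seq_of.
by congr nX; apply/funext => k; rewrite /seq_of; case: insub => [i|]; rewrite ?mxE ?mulr0.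
Qed.

Lemma normXnD z w : normXn nX (z + w) <= normXn nX z + normXn nX w.
Proof.
have [_ [[_ [_ [_ nD]]] _]] := lat.
rewrite !normXn_seq; apply: le_trans (nD _ _ (inX_seq_of _) (inX_seq_of _)).
rewrite le_eqVlt; apply/orP; left; apply/eqP; congr nX; apply/funext => k.
by rewrite /seq_of; case: insub => [i|]; rewrite ?mxE ?addr0.
Qed.

Lemma nX_unit_gt0 j : 0 < nX (unit_seq j).
Proof.
have [_ [[n0 [n1 _]] _]] := lat; rewrite lt_def n0 ?andbT; last exact: inX_unit.
apply/negP => /eqP /(n1 _ (inX_unit j)) /(congr1 (fun f => f j)).
by rewrite /unit_seq eqxx => /eqP; rewrite oner_eq0.
Qed.

Lemma normXn_coord z i : cabs (z 0 i) * nX (unit_seq i) <= normXn nX z.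
Proof.
have [_ [[_ [_ [nZ _]]] _]] := lat.
rewrite -nZ; last exact: inX_unit.
rewrite normXn_seq; apply: (nX_lattice (inX_seq_of _) _).2 => k.
rewrite /unit_seq; case: eqP => [->|_]; last by rewrite mulr0 cabs0 cabs_ge0.
by rewrite mulr1 /seq_of (valK i).
Qed.

Local Notation B := (ballXn nX n 1).

Lemma normXn_le_nrm z : normXn nX z <= (\sum_(i < n) nX (unit_seq i)) * nrm z.
Proof.
have [[X0 [XD XZ]] [[n0 [_ [nZ _]]] _]] := lat.
rewrite normXn_seq (_ : seq_of z = fun k => \sum_(i < n) z ord0 i * unit_seq i k); last first.
  by apply/funext => k; exact: seq_ofE.
have [_ h] := inX_nX_sum (index_enum 'I_n) (x := fun i k => z ord0 i * unit_seq i k)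
   (fun i => XZ _ _ (inX_unit i)).
apply: le_trans h _; rewrite mulr_suml; apply: ler_sum => i _.
rewrite nZ; last exact: inX_unit.
by rewrite mulrC; apply: ler_wpM2l; [exact/n0/inX_unit|exact: nrm_ge].
Qed.

Lemma ball_small : exists2 r : R, 0 < r & forall z, nrm z < r -> B z.
Proof.
pose S := \sum_(i < n) nX (unit_seq i).
have S0 : 0 <= S by apply: sumr_ge0 => i _; exact/ltW/nX_unit_gt0.
have S1 : 0 < S + 1 by lra.
exists (S + 1)^-1 => [|z hz]; first by rewrite invr_gt0.
rewrite /ballXn /=; apply: le_lt_trans (normXn_le_nrm z) _.
move: hz; rewrite -[X in _ < X]mul1r ltr_pdivlMr //; have := nrm_ge0 z; rewrite -/S; lra.
Qed.

Lemma ball_0 : B 0.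
Proof. by have [r r0] := ball_small; apply; rewrite nrm0. Qed.

Lemma ball_nopen : nopen B.
Proof.
move=> z Bz; have [r r0 hr] := ball_small.
rewrite /ballXn /= in Bz; have e0 : 0 < 1 - normXn nX z by rewrite subr_gt0.
exists (r * (1 - normXn nX z)) => [|h hh]; first by rewrite mulr_gt0.
have /hr : nrm (cR (1 - normXn nX z)^-1 *: h) < r.
  by rewrite nrmZ cabs_cR gtr0_norm ?invr_gt0 // mulrC ltr_pdivrMr.
rewrite /ballXn /= normXnZ cabs_cR gtr0_norm ?invr_gt0 // mulrC ltr_pdivrMr // mul1r => h1.
by apply: le_lt_trans (normXnD _ _) _; rewrite -ltrBrDl.
Qed.

Lemma ball_bounded : exists2 M : R, 1 <= M & forall z, B z -> forall i, cabs (z 0 i) <= M.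
Proof.
have [M [M1 hM]] : exists M : R, 1 <= M /\ forall i : 'I_n, (nX (unit_seq i))^-1 <= M.
  exists (1 + \sum_(i < n) (nX (unit_seq i))^-1).
  have p0 (i : 'I_n) : 0 <= (nX (unit_seq i))^-1 by rewrite invr_ge0; exact/ltW/nX_unit_gt0.
  split; first by rewrite lerDl sumr_ge0.
  by move=> i; rewrite (bigD1 i) //= addrCA lerDl addr_ge0 // sumr_ge0.
exists M => // z Bz i; apply: le_trans (hM i).
rewrite -[X in _ <= X]mul1r ler_pdivlMr ?nX_unit_gt0 //.
by apply: le_trans (normXn_coord z i) _; exact: ltW.
Qed.

Lemma ball_mono z w : B w -> (forall i, cabs (z 0 i) <= cabs (w 0 i)) -> B z.
Proof. by move=> Bw /normXn_mono h; exact: le_lt_trans h Bw. Qed.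

(** Wiener's inequality asks for holomorphy beyond the unit circle; the midpoint between the norm of
    [w] and 1 provides the room. *)
Lemma ball_line w : B w -> exists2 rho : R, 1 < rho & forall x : C, cabs x < rho -> B (x *: w).
Proof.
rewrite /ballXn /= => Bw; have w0 := normXn_ge0 w.
have w1 : 0 < (1 + normXn nX w) / 2 by lra.
exists ((1 + normXn nX w) / 2)^-1 => [|x].
  by rewrite -[X in X < _]invr1 ltf_pV2 ?posrE //; lra.
rewrite normXnZ -[X in _ < X -> _]mul1r ltr_pdivlMr // => hx.
by apply: le_lt_trans hx; apply: ler_wpM2l; [exact: cabs_ge0|lra].
Qed.

Lemma cabs_zpow_le z a (M : R) : (forall i, cabs (z 0 i) <= M) -> cabs (zpow z a) <= M ^+ deg a.
Proof.
move=> hM; rewrite cabs_zpow /deg expr_sum; apply: ler_prod => i _.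
rewrite exprn_ge0 ?cabs_ge0 //= lerXn2r ?nnegrE ?cabs_ge0 //.
exact: le_trans (cabs_ge0 _) (hM i).
Qed.

Lemma pevalE K d I c z : I `<=` Lambda n d -> (d <= K)%N ->
  peval I c z = \sum_(t : mE n K) (if `[< I (emb t) >] then c (emb t) else 0) * zpow z (emb t).
Proof.
move=> Id dK.
have -> : peval I c z = \sum_(a <- map (@emb n K) (index_enum (mE n K)) | `[< I a >]) c a * zpow z a.
  have eI : I = [set` (fun a => `[< I a >])] by apply/seteqP; split => a /= /asboolP.
  rewrite /peval {1}eI; symmetry; apply: bigfs.
    by rewrite (map_inj_uniq (@emb_inj n K)) index_enum_uniq.
  move=> a /asboolP /Id; rewrite /Lambda /= => da /negP[].
  apply/mapP; exists (mE_of K a); first by rewrite mem_index_enum.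
  by rewrite emb_mE_of // da.
rewrite big_map big_mkcond /=; apply: eq_bigr => t _.
by case: ifP; rewrite // mul0r.
Qed.

Lemma peval_supported K d I c z : I `<=` Lambda n d -> (d <= K)%N -> supported I c ->
  peval I c z = \sum_(t : mE n K) c (emb t) * zpow z (emb t).
Proof.
move=> Id dK hc; rewrite (pevalE _ _ Id dK); apply: eq_bigr => t _.
by case: asboolP => // /hc ->.
Qed.

Lemma pevalZ d I c (x : C) z : I `<=` Lambda n d -> peval I c (x *: z) = x ^+ d * peval I c z.
Proof.
move=> Id; rewrite !(pevalE _ _ Id (leqnn d)) mulr_sumr; apply: eq_bigr => t _.
case: asboolP => [/Id dt|_]; last by rewrite !mul0r mulr0.
by rewrite zpowZ (dt : deg (emb t) = d); ring.
Qed.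

Lemma peval_bounded d I c : I `<=` Lambda n d ->
  exists2 M : R, 0 <= M & forall z, B z -> cabs (peval I c z) <= M.
Proof.
move=> Id; have [M M1 hM] := ball_bounded.
have M0 : 0 <= M by lra.
exists (\sum_(t : mE n d) cabs (if `[< I (emb t) >] then c (emb t) else 0) * M ^+ deg (emb t)).
  by apply: sumr_ge0 => t _; rewrite mulr_ge0 ?cabs_ge0 ?exprn_ge0.
move=> z Bz; rewrite (pevalE _ _ Id (leqnn d)); apply: le_trans (cabs_sum _ _ _) _.
apply: ler_sum => t _; rewrite cabsM; apply: ler_wpM2l; first exact: cabs_ge0.
exact/cabs_zpow_le/hM.
Qed.

Lemma polynorm_ge d I c z : I `<=` Lambda n d -> B z -> cabs (peval I c z) <= polynorm nX I c.
Proof.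
move=> Id Bz; have [M _ hM] := peval_bounded c Id.
by apply: ub_le_sup; [exists M => _ [y By <-]; exact: hM|exists z].
Qed.

Lemma polynorm_le I c (M : R) : (forall z, B z -> cabs (peval I c z) <= M) -> polynorm nX I c <= M.
Proof.
move=> hM; apply: ge_sup; first by exists (cabs (peval I c 0)), 0 => //; exact: ball_0.
by move=> _ [z Bz <-]; exact: hM.
Qed.

Lemma polynorm_ge0 d I c : I `<=` Lambda n d -> 0 <= polynorm nX I c.
Proof. by move=> Id; apply: le_trans (polynorm_ge c Id ball_0); exact: cabs_ge0. Qed.

Lemma coef1M (p r : {poly C}) : (p * r)`_1 = p`_0 * r`_1 + p`_1 * r`_0.
Proof. by rewrite coefM big_ord_recr big_ord1. Qed.

(** The monomial along [eta + x u] as a formal polynomial in [x], so that directional derivatives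
    become coefficients of ['X]. *)
Definition zline (eta u : V) a : {poly C} :=
  \prod_(i < n) ((eta 0 i)%:P + u 0 i *: 'X) ^+ a i.

Lemma horner_zline eta u a x : (zline eta u a).[x] = zpow (eta + x *: u) a.
Proof.
rewrite /zline horner_prod; apply: eq_bigr => i _.
by rewrite horner_exp !hornerE !mxE [x * _]mulrC.
Qed.

Lemma zline_incr eta u a k :
  zline eta u (incr a k) = ((eta 0 k)%:P + u 0 k *: 'X) * zline eta u a.
Proof.
rewrite /zline (eq_bigr (fun i => ((eta 0 i)%:P + u 0 i *: 'X) ^+ a i
   * ((eta 0 i)%:P + u 0 i *: 'X) ^+ (i == k))); last first.
  by move=> i _; rewrite ffunE exprD.
rewrite big_split /= mulrC (bigD1 k) //= eqxx expr1 [X in _ * X * _]big1 ?mulr1 // => i /negbTE ->.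
by rewrite expr0.
Qed.

Lemma zline_coef0 eta u a : (zline eta u a)`_0 = zpow eta a.
Proof. by rewrite -horner_coef0 horner_zline scale0r addr0. Qed.

Lemma zline_coef1 eta u a :
  (zline eta u a)`_1 = \sum_(k < n) (a k)%:R * u 0 k * zpow eta (decr a k).
Proof.
move: {2}(deg a) (erefl (deg a)) => d; elim: d a => [|d IH] a da.
  have a0 i : a i = 0%N by apply/eqP; rewrite -leqn0 -da le_deg.
  rewrite big1 => [|i _]; last by rewrite a0 !mul0r.
  by rewrite /zline big1 ?coefC // => i _; rewrite a0 expr0.
have [j aj] : exists j, (0 < a j)%N.
  apply/existsP; apply: contraPT da => /existsPn h.
  rewrite /deg big1 // => i _; apply/eqP; have := h i; by rewrite -eqn0Ngt.
move: da; rewrite -{1}(decrK aj) deg_incr => -[db].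
rewrite -{1}(decrK aj) zline_incr coef1M IH // zline_coef0.
rewrite !coefD !coefC !coefZ !coefX /= mulr0 addr0 add0r mulr1.
set b := decr a j.
have ea k : (a k)%:R = (b k)%:R + (k == j)%:R :> C.
  by rewrite -(decrK aj) ffunE natrD.
under [RHS]eq_bigr do rewrite ea 2!mulrDl.
rewrite big_split /= mulr_sumr; congr (_ + _).
  apply: eq_bigr => k _; have [bk|bk] := posnP (b k); first by rewrite bk !mul0r mulr0.
  have -> : decr a k = incr (decr b k) j.
    by rewrite -(decrK aj) -/b -[in LHS](decrK bk) -[RHS](incrK _ k); congr decr;
       apply/ffunP => i; rewrite !ffunE; ring.
  by rewrite zpow_incr; ring.
rewrite (bigD1 j) //= eqxx mul1r big1 ?addr0 // => k /negbTE ->.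
by rewrite !mul0r.
Qed.

(* Cauchy's estimate for the derivative of [P (eta + x u)] at [x = 0] on the circle
   of radius [1 / m], where [m = d + 1]: [P] is bounded by [(1 + 1/m)^m A] there. *)
Lemma polarization d I c (A : R) eta u : I `<=` Lambda n d.+1 -> supported I c ->
  (forall z, B z -> cabs (peval I c z) <= A) -> B eta -> B u ->
  cabs (\sum_(k < n) u 0 k *
     \sum_(t : mE n d.+1 | deg (emb t) == d)
        (emb t k).+1%:R * c (incr (emb t) k) * zpow eta (emb t))
  <= d.+1%:R * expR 1 * A.
Proof.
move=> Id hc hA Beta Bu.
pose p : {poly C} := \sum_(t : mE n d.+1) c (emb t) *: zline eta u (emb t).
have px x : p.[x] = peval I c (eta + x *: u).
  rewrite (peval_supported _ Id (leqnn _) hc) horner_sum; apply: eq_bigr => t _.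
  by rewrite hornerZ horner_zline.
have cz (t : mE n d.+1) : deg (emb t) != d.+1 -> c (emb t) = 0.
  by move=> /eqP dt; apply: hc => /Id.
set X := \sum_(k < n) _; have -> : X = p`_1.
  rewrite coef_sum; under [RHS]eq_bigr do rewrite coefZ zline_coef1 mulr_sumr.
  rewrite exchange_big /=; apply: eq_bigr => k _.
  pose F a := c a * ((a k)%:R * u 0 k * zpow eta (decr a k)).
  transitivity (\sum_(t : mE n d.+1 | (deg (emb t) == d.+1) && (0 < emb t k)%N) F (emb t)).
    rewrite (sum_incr k F (ltnSn d)) mulr_sumr; apply: eq_bigr => t _.
    have ek : incr (emb t) k k = (emb t k).+1 by rewrite ffunE eqxx addn1.
    by rewrite /F ek incrK; ring.
  rewrite big_mkcond; apply: eq_bigr => t _.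
  case: ifP => // /negbT; rewrite negb_and -eqn0Ngt => /orP[/cz ->|/eqP ->].
    by rewrite mul0r.
  by rewrite !mul0r mulr0.
pose m : R := d.+1%:R; have m0 : 0 < m by rewrite ltr0n.
pose s : C := cR m^-1.
have cs : cabs s = m^-1 by rewrite cabs_cR gtr0_norm // invr_gt0.
have A0 : 0 <= A by apply: le_trans (cabs_ge0 _) (hA 0 ball_0).
have pA x : cabs x = m^-1 -> cabs p.[x] <= (1 + m^-1) ^+ d.+1 * A.
  move=> xm; rewrite px; have i0 : 0 < 1 + m^-1 by rewrite addr_gt0 // invr_gt0.
  have ci0 : cR (1 + m^-1) != 0 :> C by rewrite -cabs_gt0 cabs_cR normr_gt0 lt0r_neq0.
  have -> : eta + x *: u = cR (1 + m^-1) *: ((cR (1 + m^-1))^-1 *: (eta + x *: u)).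
    by rewrite scalerA divff // scale1r.
  rewrite (pevalZ _ _ _ Id) cabsM cabsX cabs_cR (gtr0_norm i0).
  apply: ler_wpM2l; first by rewrite exprn_ge0 // ltW.
  apply: hA; rewrite /ballXn /= normXnZ cabsV cabs_cR (gtr0_norm i0) ltr_pdivrMl // mulr1.
  apply: le_lt_trans (normXnD _ _) _; rewrite normXnZ xm; apply: ltr_leD => //.
  by rewrite -[X in _ <= X]mulr1; apply: ler_wpM2l; [rewrite invr_ge0 ltW|exact: ltW].
have [q pN N1] : exists2 q, (size p <= 2 ^ q)%N & (1 < 2 ^ q)%N.
  exists (size p).+1; last by rewrite -[1%N](expn0 2) ltn_exp2l.
  by apply: ltnW; apply: (@leq_trans (size p).+1) => //; apply: ltnW; exact: ltn_expl.
set N := (2 ^ q)%N in pN N1 *.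
(* Since [N] is at least the size of [p], the discrete Cauchy formula for its linear coefficient is
   exact. *)
have key : \sum_(j < N) p.[s * omega R q ^+ j] * (omega R q ^+ j) ^+ (N - 1) = N%:R * (s * p`_1).
  transitivity (\sum_(k < N) p`_k * s ^+ k * \sum_(j < N) (omega R q ^+ (k + (N - 1))) ^+ j).
    under eq_bigr do rewrite (horner_coef_wide _ pN) mulr_suml.
    rewrite exchange_big /=; apply: eq_bigr => k _; rewrite mulr_sumr; apply: eq_bigr => j _.
    by rewrite exprMn [(omega R q ^+ (k + _)) ^+ j]exprAC exprD !mulrA.
  rewrite (bigD1 (Ordinal N1)) //= [X in _ + X]big1 ?addr0 => [|k k1].
    rewrite expr1 subnKC ?(ltnW N1) // omega_order (eq_bigr (fun=> 1)).
      by rewrite sumr_const card_ord [RHS]mulrC [s * _]mulrC.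
    by move=> j _; rewrite expr1n.
  by rewrite sum_omega ?mulr0 // ndvdn_shift // -val_eqE.
have N0 : (0 : R) < N%:R by rewrite ltr0n expn_gt0.
have : cabs (N%:R * (s * p`_1)) <= N%:R * ((1 + m^-1) ^+ d.+1 * A).
  rewrite -key; apply: le_trans (cabs_sum _ _ _) _.
  apply: (@le_trans _ _ (\sum_(j < N) (1 + m^-1) ^+ d.+1 * A)).
    apply: ler_sum => j _; rewrite cabsM !cabsX cabs_omega !expr1n mulr1.
    by apply: pA; rewrite cabsM cabsX cabs_omega expr1n mulr1.
  by rewrite sumr_const card_ord mulr_natl.
rewrite !cabsM cabs_nat cs ler_pM2l // ler_pdivrMl // => h.
apply: le_trans h _; rewrite -/m -mulrA; apply: ler_wpM2l; first exact: ltW.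
apply: ler_wpM2r => //.
have -> : expR 1 = expR m^-1 ^+ d.+1 :> R by rewrite -expRM_natl -/m divff // lt0r_neq0.
by rewrite lerXn2r ?nnegrE ?expR_ge0 // ?expR_ge1Dx // addr_ge0 // invr_ge0 ltW.
Qed.

End Lattice.

(** * Discrete Fourier coefficients of bounded functions *)

Section TorusCoefficients.
Variables (R : realType) (n q : nat) (T : Type) (pt : {ffun 'I_n -> 'I_(2 ^ q)} -> T).
Variables (val_T : T -> 'rV[Cx R]_n) (r : R) (d : nat).
Local Notation C := (Cx R).
Hypothesis r0 : 0 < r.
Hypothesis val_pt : forall s, val_T (pt s) = cR r *: tpt R s.
Implicit Types (y : bfun R T) (b : mi n).

(** The Fourier coefficient on a torus of radius [r]; the factor [r^-d] undoes the radius for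
    polynomials of degree [d]. It is a bounded functional on all of [l^infty], as opposed to a
    Taylor coefficient. *)
Definition extract y b : C :=
  (cR r)^-1 ^+ d * ((\sum_s y (pt s) * (tor R b s)^-1) / ((2 ^ q) ^ n)%:R).

Lemma extractD y y' b : extract (y + y') b = extract y b + extract y' b.
Proof.
rewrite /extract -mulrDr -mulrDl -big_split; congr (_ * (_ / _)).
by apply: eq_bigr => s _; rewrite bfunD; exact: mulrDl.
Qed.

Lemma extractZ (a : C) y b : extract (a *: y) b = a * extract y b.
Proof.
rewrite /extract [RHS]mulrCA [a * (_ / _)]mulrA mulr_sumr; congr (_ * (_ / _)).
by apply: eq_bigr => s _; rewrite bfunZ mulrA.
Qed.

Lemma extract_sum (W : finType) (y : W -> bfun R T) b :
  extract (\sum_w y w) b = \sum_w extract (y w) b.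
Proof.
have e0 : extract 0 b = 0 by rewrite -(scale0r 0) extractZ mul0r.
elim/big_rec2: _ => [//|w u v _ <-]; exact: extractD.
Qed.

Lemma extract_le y b : cabs (extract y b) <= r^-1 ^+ d * supnorm y.
Proof.
rewrite /extract cabsM cabsX cabsV cabs_cR (gtr0_norm r0); apply: ler_wpM2l.
  by rewrite exprn_ge0 // invr_ge0 ltW.
rewrite cabsM cabsV cabs_nat; apply: le_trans (ler_wpM2r _ (cabs_sum _ _ _)) _.
  by rewrite invr_ge0 ler0n.
apply: (@tavg_le R n q) => s; rewrite cabsM cabsV cabs_tor invr1 mulr1.
exact: supnorm_ge.
Qed.

Lemma extract_poly K (c : mi n -> C) y (t0 : mE n K) : (K < 2 ^ q)%N ->
  (forall x, y x = \sum_(t : mE n K) c (emb t) * zpow (val_T x) (emb t)) ->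
  (forall a, deg a != d -> c a = 0) -> extract y (emb t0) = c (emb t0).
Proof.
move=> KN hy hc; have cr0 : cR r != 0 :> C by rewrite -cabs_gt0 cabs_cR normr_gt0 lt0r_neq0.
have eN (t : mE n K) i : (emb t i < 2 ^ q)%N.
  by rewrite ffunE; apply: leq_trans (ltn_ord _) _.
have -> : extract y (emb t0) =
   (\sum_(t : mE n K) c (emb t) *
      \sum_(s : {ffun 'I_n -> 'I_(2 ^ q)}) tor R (emb t) s * (tor R (emb t0) s)^-1)
     / ((2 ^ q) ^ n)%:R.
  rewrite /extract mulrA; congr (_ / _).
  under eq_bigr do rewrite hy mulr_suml.
  rewrite exchange_big /= mulr_sumr; apply: eq_bigr => t _.
  rewrite !mulr_sumr; apply: eq_bigr => s _; rewrite val_pt zpowZ -/(tor R _ _).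
  have [dt|/hc ->] := eqVneq (deg (emb t)) d; last by rewrite !mul0r mulr0.
  rewrite dt !mulrA [(cR r)^-1 ^+ d * _]mulrC -2![c _ * _ * _ * _]mulrA mulrA.
  by congr (_ * _); rewrite -mulrA; congr (_ * _); rewrite mulrA -exprMn mulVf // expr1n mul1r.
rewrite (bigD1 t0) //= [X in (_ + X) / _]big1 ?addr0 => [|t tt0].
  by rewrite tor_orth // eqxx mulfK // Nnc_neq0.
by rewrite tor_orth // (inj_eq (@emb_inj _ _)) (negbTE tt0) mulr0.
Qed.

End TorusCoefficients.

(** * Coefficients and projections *)

Section Unconditionality.
Variables (R : realType) (inX : set (nat -> Cx R)) (nX : (nat -> Cx R) -> R) (n : nat).
Local Notation C := (Cx R).
Local Notation V := 'rV[C]_n.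
Hypothesis lat : is_banach_seq_lattice inX nX.
Local Notation B := (ballXn nX n 1).
Implicit Types (a b : mi n) (c : mi n -> C).

(** The conjugate phase of [x], with value 0 at 0 because [0^-1 = 0]. *)
Definition phase (x : C) : C := cR (cabs x) / x.

Lemma phaseM x : phase x * x = cR (cabs x).
Proof.
have [->|x0] := eqVneq x 0; first by rewrite mulr0 cabs0.
by rewrite /phase mulfVK.
Qed.

Lemma cabs_phase x : cabs (phase x) <= 1.
Proof.
have [->|x0] := eqVneq x 0; first by rewrite /phase invr0 mulr0 cabs0.
by rewrite /phase cabsM cabsV cabs_cR ger0_norm ?cabs_ge0 // divff // cabs_eq0.
Qed.

Definition ball_type := {z : V | B z}.
Implicit Types (x : ball_type).

Variables (d : nat) (I : set (mi n)).
Hypothesis Id : I `<=` Lambda n d.+1.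
Local Notation If := (flat d.+1 I).
Local Notation Y := (bfun R ball_type).

Lemma flat_deg : If `<=` Lambda n d.
Proof. by move=> b []. Qed.

Lemma peval_bounded_fun c : (fun x => peval If c (sval x)) \in @sup_bounded R ball_type.
Proof.
have [M _ hM] := peval_bounded lat c flat_deg.
by apply/sup_boundedP; exists M => x; exact/hM/svalP.
Qed.

Definition pfun c : Y := Bfun (peval_bounded_fun c).

Lemma pfun_linear (t : C) c c' : pfun (fun a => t * c a + c' a) = t *: pfun c + pfun c'.
Proof.
apply: bfun_ext => x; rewrite bfunD bfunZ /= !(pevalE _ _ flat_deg (leqnn d)).
rewrite mulr_sumr -big_split /=; apply: eq_bigr => s _.
by case: asboolP => _; ring.
Qed.

Lemma pfun_norm c : complex.Re `|pfun c| = polynorm nX If c.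
Proof.
rewrite bfun_normE /supnorm /polynorm; congr sup; apply/seteqP; split=> y [] /=.
  by move=> [z Bz] _ <-; exists z.
by move=> z Bz <-; exists (exist _ z Bz).
Qed.

Local Notation K := d.+1.

Lemma torus_radius : exists2 r : R, 0 < r &
  forall q (s : {ffun 'I_n -> 'I_(2 ^ q)}), B (cR r *: tpt R s).
Proof.
have [r r0 hr] := ball_small n lat.
have n0 : (0 : R) < n%:R + 1 by rewrite ltr_wpDl.
exists (r / (n%:R + 1)) => [|q s]; first by rewrite divr_gt0.
apply: hr; rewrite nrmZ cabs_cR gtr0_norm ?divr_gt0 //.
rewrite /nrm (eq_bigr (fun=> 1)) => [|i _]; last exact: cabs_tpt.
rewrite sumr_const card_ord mulrAC ltr_pdivrMr // ltr_pM2l //; lra.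
Qed.

Definition bound_proj (L : R) (P : {linear Y -> Y}) :=
  [/\ forall y, exists c, supported If c /\ P y = pfun c,
      forall c, supported If c -> P (pfun c) = pfun c &
      forall y, supnorm (P y) <= L * supnorm y].

Lemma pfun_extract q (r : R) (hr : forall s, B (cR r *: tpt R s)) c (t : mE n K) :
  0 < r -> (K < 2 ^ q)%N -> supported If c ->
  extract (fun s : {ffun 'I_n -> 'I_(2 ^ q)} => exist _ _ (hr s) : ball_type) r d (pfun c) (emb t)
  = c (emb t).
Proof.
move=> r0 KN hc; apply: (extract_poly (val_T := fun x => sval x)) => // [x|a da].
  exact: (peval_supported _ flat_deg (leqnSn d) hc).
by apply: hc => /flat_deg; rewrite /Lambda /= => e; rewrite e eqxx in da.
Qed.

End Unconditionality.

(** * Products of coefficients bounded through a dual polynomial *)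

Section Duality.
Variables (R : realType) (inX : set (nat -> Cx R)) (nX : (nat -> Cx R) -> R) (n : nat).
Local Notation C := (Cx R).
Local Notation V := 'rV[C]_n.
Hypothesis lat : is_banach_seq_lattice inX nX.
Local Notation B := (ballXn nX n 1).
Implicit Types (a b : mi n).

Variables (d : nat) (I : set (mi n)) (c : mi n -> C) (L Q A : R).
Hypothesis Id : I `<=` Lambda n d.+1.
Hypothesis hc : supported I c.
Hypothesis hA : forall z, B z -> cabs (peval I c z) <= A.
Hypothesis Q0 : 0 <= Q.
Hypothesis L0 : 0 <= L.
Hypothesis hQ : forall c', supported (Lambda n d.+1) c' ->
  polynorm nX I c' <= Q * polynorm nX (Lambda n d.+1) c'.
Local Notation K := d.+1.

Variables (W : finType) (coefW : W -> mE n K -> C) (rep : W -> V) (q : nat).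
Hypothesis rep_ball : forall w, B (rep w).
Hypothesis coefW_le : forall (g : W -> C) (M : R) (u : V), 0 <= M -> B u ->
  (forall w, cabs (g w) <= M) ->
  cabs (\sum_(t : mE n K | deg (emb t) == d) (\sum_w g w * coefW w t) * zpow u (emb t))
  <= L * M.
Hypothesis KN : (K + K < 2 ^ q)%N.

(** Coefficients of [D(v) = sum_k v_k sum_w g_k(w) p_w(v)], where [p_w] is the polynomial of degree
    [d] with coefficients [coefW w]. *)
Definition dual_coef (g : 'I_n -> W -> C) a : C :=
  if deg a == K then
    \sum_k (if (0 < a k)%N then \sum_w g k w * coefW w (mE_of K (decr a k)) else 0)
  else 0.

Lemma peval_dual_coef (I' : set (mi n)) g v : I' `<=` Lambda n K ->
  peval I' (dual_coef g) v = \sum_k \sum_(t : mE n K | deg (emb t) == d)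
    (if `[< I' (incr (emb t) k) >] then
       (\sum_w g k w * coefW w t) * zpow v (incr (emb t) k) else 0).
Proof.
move=> I'K; rewrite (pevalE _ _ I'K (leqnn K)).
pose F k a := if `[< I' a >] then
  (\sum_w g k w * coefW w (mE_of K (decr a k))) * zpow v a else 0.
transitivity (\sum_k \sum_(t : mE n K | (deg (emb t) == K) && (0 < emb t k)%N) F k (emb t)).
  rewrite (eq_bigr (fun k => \sum_(t : mE n K)
      if (deg (emb t) == K) && (0 < emb t k)%N then F k (emb t) else 0)); last first.
    by move=> k _; rewrite big_mkcond.
  rewrite exchange_big /=; apply: eq_bigr => t _; rewrite /F /dual_coef.
  case: asboolP => [It|_]; last by rewrite mul0r big1 // => k _; case: ifP.
  rewrite (I'K _ It) eqxx mulr_suml; apply: eq_bigr => k _ /=.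
  by case: ifP; rewrite ?mul0r.
apply: eq_bigr => k _; rewrite (sum_incr k (F k) (ltnSn d)); apply: eq_bigr => t _.
by rewrite /F incrK mE_ofK.
Qed.

(** Coefficients in [v] of [(d_k P)(v w) / K], the product [v w] being coordinatewise and [w]
    standing for [rep w]. *)
Definition polar_coef (k : 'I_n) (w : W) (t : mE n K) : C :=
  if deg (emb t) == d then
    (emb t k).+1%:R / K%:R * c (incr (emb t) k) * zpow (rep w) (emb t) else 0.

(** Coefficients in [v] of [z_k p_w(v z)], restricted to the monomials that land in [I] after
    multiplication by the [k]-th variable. *)
Definition proj_coef (z : V) (k : 'I_n) (w : W) (t : mE n K) : C :=
  if (deg (emb t) == d) && `[< I (incr (emb t) k) >] then
    zpow z (incr (emb t) k) * coefW w t else 0.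

Lemma zpow_mul (v z : V) a : zpow (\row_i (v 0 i * z 0 i)) a = zpow v a * zpow z a.
Proof. by rewrite /zpow -big_split /=; apply: eq_bigr => i _; rewrite mxE exprMn. Qed.

Lemma ball_torus (z : V) (s : {ffun 'I_n -> 'I_(2 ^ q)}) : B z ->
  B (\row_i (tpt R s 0 i * z 0 i)).
Proof. by move=> Bz; apply: (ball_mono lat) Bz _ => i; rewrite mxE cabsM cabs_tpt mul1r. Qed.

(** Phases put into [u] turn the sum of moduli into one directional derivative of [P], to which
    polarization applies; its factor [K] cancels the denominator of [polar_coef]. *)
Lemma polar_coef_le (u : V) w (s : {ffun 'I_n -> 'I_(2 ^ q)}) : B u ->
  \sum_k cabs (u 0 k) * cabs (tpoly (polar_coef k w) s) <= expR 1 * A.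
Proof.
move=> Bu; pose eta : V := \row_i (tpt R s 0 i * rep w 0 i).
have Beta : B eta by exact: ball_torus.
pose X k := \sum_(t : mE n K | deg (emb t) == d)
        (emb t k).+1%:R * c (incr (emb t) k) * zpow eta (emb t).
have K0 : (K%:R : C) != 0 by rewrite -cabs_eq0 cabs_nat pnatr_eq0.
have eX k : tpoly (polar_coef k w) s = X k / K%:R.
  rewrite /tpoly /X mulr_suml [RHS]big_mkcond /=; apply: eq_bigr => t _.
  rewrite /polar_coef; case: ifP => _; last by rewrite mul0r.
  by rewrite zpow_mul -/(tor _ _ _); field.
pose u' : V := \row_k (cR (cabs (u 0 k)) * phase (X k)).
have Bu' : B u'.
  apply: (ball_mono lat) Bu _ => k; rewrite mxE cabsM cabs_cR (ger0_norm (cabs_ge0 _)).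
  by apply: ler_piMr; [exact: cabs_ge0|exact: cabs_phase].
have := polarization lat Id hc hA Beta Bu'.
have -> : \sum_(k < n) u' 0 k * X k = cR (\sum_k cabs (u 0 k) * cabs (X k)).
  rewrite cR_sum; apply: eq_bigr => k _; rewrite mxE -mulrA phaseM.
  by rewrite -cRM.
rewrite cabs_cR ger0_norm; last by apply: sumr_ge0 => k _; rewrite mulr_ge0 ?cabs_ge0.
rewrite -mulrA => h.
have -> : \sum_k cabs (u 0 k) * cabs (tpoly (polar_coef k w) s) =
   (K%:R)^-1 * \sum_k cabs (u 0 k) * cabs (X k).
  rewrite mulr_sumr; apply: eq_bigr => k _; rewrite eX cabsM cabsV cabs_nat.
  by rewrite mulrA mulrC.
by rewrite ler_pdivrMl ?ltr0n.
Qed.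

(* Choosing the phases in [dual_coef] makes the double sum a value of a polynomial [D] whose
   restriction to [I] is controlled by [Q |D|], and [|D| <= L e A] by the bound on [P]. *)
Lemma duality_le (z : V) (s s' : {ffun 'I_n -> 'I_(2 ^ q)}) : B z ->
  \sum_k \sum_w cabs (tpoly (polar_coef k w) s) * cabs (tpoly (proj_coef z k w) s')
  <= Q * (L * (expR 1 * A)).
Proof.
move=> Bz; have A0 : 0 <= A by apply: le_trans (cabs_ge0 _) (hA (ball_0 n lat)).
have eA0 : 0 <= expR 1 * A by rewrite mulr_ge0 ?expR_ge0.
(* The factor [s'_k] completes [z_k] to the [k]-th coordinate of [zeta], so that the summands add up
   to the part of [D] in [I], evaluated at [zeta]. *)
pose x k w := tpt R s' 0 k * tpoly (proj_coef z k w) s'.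
pose g k w := cR (cabs (tpoly (polar_coef k w) s)) * phase (x k w).
pose zeta : V := \row_i (tpt R s' 0 i * z 0 i).
have Bzeta : B zeta by exact: ball_torus.
have cx k w : cabs (x k w) = cabs (tpoly (proj_coef z k w) s').
  by rewrite /x cabsM cabs_tpt mul1r.
have e1 : cR (\sum_k \sum_w cabs (tpoly (polar_coef k w) s) * cabs (tpoly (proj_coef z k w) s'))
   = peval I (dual_coef g) zeta.
  rewrite (peval_dual_coef _ _ Id) cR_sum; apply: eq_bigr => k _.
  rewrite cR_sum.
  transitivity (\sum_w g k w * x k w).
    apply: eq_bigr => w _; rewrite /g -mulrA phaseM -cRM cx //.
  under eq_bigr do rewrite /x /tpoly 2!mulr_sumr.
  rewrite exchange_big /= [RHS]big_mkcond /=; apply: eq_bigr => t _.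
  rewrite /proj_coef; case: eqP => /= [dt|_]; last first.
    by rewrite big1 // => w _; rewrite mul0r !mulr0.
  case: asboolP => _; last by rewrite big1 // => w _; rewrite mul0r !mulr0.
  rewrite mulr_suml; apply: eq_bigr => w _.
  by rewrite zpow_mul !zpow_incr /tor; ring.
have sup_dual : supported (Lambda n K) (dual_coef g).
  by move=> a da; rewrite /dual_coef ifF //; apply/negP => /eqP.
have -> : \sum_k \sum_w cabs (tpoly (polar_coef k w) s) * cabs (tpoly (proj_coef z k w) s')
   = cabs (peval I (dual_coef g) zeta).
  rewrite -e1 cabs_cR ger0_norm //; apply: sumr_ge0 => k _; apply: sumr_ge0 => w _.
  by rewrite mulr_ge0 ?cabs_ge0.
apply: le_trans (polynorm_ge lat _ Id Bzeta) _.
apply: le_trans (hQ sup_dual) _; apply: ler_wpM2l => //.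
apply: (polynorm_le lat) => u Bu.
rewrite (peval_dual_coef _ _ (@subset_refl _ _)).
(* For fixed [u], [D(u) = sum_w (sum_k u_k g_k(w)) p_w(u)]: a combination of the [p_w] covered by
   [coefW_le], with scalars bounded by [polar_coef_le]. *)
rewrite (_ : \sum_(k < n) _ = \sum_(t : mE n K | deg (emb t) == d)
    (\sum_w (\sum_k u 0 k * g k w) * coefW w t) * zpow u (emb t)); last first.
  rewrite exchange_big /=; apply: eq_bigr => t /eqP dt.
  transitivity (\sum_k (\sum_w g k w * coefW w t) * zpow u (incr (emb t) k)).
    apply: eq_bigr => k _; case: asboolP => // [[]].
    by rewrite /Lambda /= deg_incr dt.
  under [LHS]eq_bigr do rewrite zpow_incr mulrA.
  rewrite -mulr_suml; congr (_ * _).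
  under [RHS]eq_bigr do rewrite mulr_suml.
  rewrite [RHS]exchange_big /=; apply: eq_bigr => k _.
  by rewrite mulr_suml; apply: eq_bigr => w _; ring.
apply: coefW_le => // w; apply: le_trans (cabs_sum _ _ _) _; apply: le_trans (polar_coef_le w s Bu).
apply: ler_sum => k _; rewrite cabsM /g cabsM cabs_cR (ger0_norm (cabs_ge0 _)).
apply: ler_wpM2l; first exact: cabs_ge0.
by apply: ler_piMr; [exact: cabs_ge0|exact: cabs_phase].
Qed.

Lemma tavgZ (a : R) h : tavg (n := n) (q := q) (fun s => a * h s) = a * tavg h.
Proof. by rewrite /tavg -mulr_sumr mulrA. Qed.

Lemma tavg_sum (J : finType) (h : J -> {ffun 'I_n -> 'I_(2 ^ q)} -> R) :
  tavg (fun s => \sum_j h j s) = \sum_j tavg (h j).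
Proof. by rewrite /tavg exchange_big /= mulr_suml. Qed.

(** Khinchine gives, for each [k] and [w], a product of two averages. With independent variables [s]
    and [s'] this is a double average, and the sum inside is bounded pointwise by [duality_le]. *)
Lemma coef_duality (z : V) : B z ->
  \sum_k \sum_w \sum_t cabs (polar_coef k w t) * cabs (proj_coef z k w t)
  <= 4 ^+ d * (Q * (L * (expR 1 * A))).
Proof.
move=> Bz.
have dA k w t : polar_coef k w t != 0 -> deg (emb t) = d.
  by rewrite /polar_coef; case: (deg (emb t) =P d) => // _; rewrite eqxx.
have dB k w t : proj_coef z k w t != 0 -> deg (emb t) = d.
  by rewrite /proj_coef; case: (deg (emb t) =P d) => //= _; rewrite eqxx.
apply: (@le_trans _ _ (\sum_k \sum_w 4 ^+ d *
   (tavg (fun s => cabs (tpoly (q := q) (polar_coef k w) s)) *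
    tavg (fun s => cabs (tpoly (q := q) (proj_coef z k w) s))))).
  apply: ler_sum => k _; apply: ler_sum => w _.
  exact: (sum_le_tavg KN (dA k w) (dB k w)).
under eq_bigr do rewrite -mulr_sumr.
rewrite -mulr_sumr; apply: ler_wpM2l; first by rewrite exprn_ge0.
have -> : \sum_k \sum_w tavg (fun s => cabs (tpoly (q := q) (polar_coef k w) s)) *
    tavg (fun s => cabs (tpoly (q := q) (proj_coef z k w) s)) =
   tavg (fun s => tavg (fun s' => \sum_k \sum_w
     cabs (tpoly (q := q) (polar_coef k w) s) * cabs (tpoly (q := q) (proj_coef z k w) s'))).
  symmetry; transitivity (tavg (fun s : {ffun 'I_n -> 'I_(2 ^ q)} => \sum_k \sum_w
     tavg (fun s' => cabs (tpoly (q := q) (proj_coef z k w) s')) * cabs (tpoly (polar_coef k w) s))).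
    congr tavg; apply/funext => s; rewrite tavg_sum; apply: eq_bigr => k _.
    by rewrite tavg_sum; apply: eq_bigr => w _; rewrite tavgZ mulrC.
  rewrite tavg_sum; apply: eq_bigr => k _.
  by rewrite tavg_sum; apply: eq_bigr => w _; rewrite tavgZ mulrC.
by apply: tavg_le => s; apply: tavg_le => s'; exact: duality_le.
Qed.

End Duality.

(** * The unconditional bound from a given projection *)

Section UnconditionalBound.
Variables (R : realType) (inX : set (nat -> Cx R)) (nX : (nat -> Cx R) -> R) (n : nat).
Local Notation C := (Cx R).
Local Notation V := 'rV[C]_n.
Hypothesis lat : is_banach_seq_lattice inX nX.
Local Notation B := (ballXn nX n 1).
Variables (d : nat) (I : set (mi n)).
Hypothesis Id : I `<=` Lambda n d.+1.
Local Notation K := d.+1.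
Local Notation If := (flat K I).
Local Notation T := (@ball_type R nX n).
Local Notation Y := (bfun R T).

(** An index [a] of degree [K] is distributed over its variables with weights [a_k / K], which add
    up to 1. *)
Lemma sum_euler (F : mi n -> R) :
  \sum_(t : mE n K | deg (emb t) == K) F (emb t) =
  \sum_(k < n) \sum_(t : mE n K | deg (emb t) == d)
     (emb t k).+1%:R / K%:R * F (incr (emb t) k).
Proof.
transitivity (\sum_(t : mE n K | deg (emb t) == K) \sum_(k < n) (emb t k)%:R / K%:R * F (emb t)).
  apply: eq_bigr => t /eqP dt; rewrite -!mulr_suml -natr_sum -/(deg (emb t)) dt.
  by rewrite divff ?mul1r // pnatr_eq0.
rewrite exchange_big /=; apply: eq_bigr => k _.
transitivity (\sum_(t : mE n K | (deg (emb t) == K) && (0 < emb t k)%N)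
   (emb t k)%:R / K%:R * F (emb t)).
  rewrite [RHS]big_mkcondr /=; apply: eq_bigr => t _.
  by case: ifP => // /negbT; rewrite -eqn0Ngt => /eqP ->; rewrite !mul0r.
rewrite (sum_incr k (fun a => (a k)%:R / K%:R * F a) (ltnSn d)).
by apply: eq_bigr => t _; rewrite !ffunE eqxx addn1.
Qed.

(** A step function with values [g_w] has norm at most [max |g_w|], which gives the first part. For
    the second, [P] fixes the monomial [z^b], whose own coefficient is 1, while the step function
    with values [rep(w)^b] is within [e] of it; the error passes through [P] and [extract]. *)
Lemma bound_proj_coef_le (L r : R) (P : {linear Y -> Y}) q
    (hr : forall s : {ffun 'I_n -> 'I_(2 ^ q)}, B (cR r *: tpt R s))
    (W : finType) (cell : T -> W) (ind : W -> Y) :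
  bound_proj lat d I L P -> 0 < r -> 0 <= L -> (K < 2 ^ q)%N ->
  (forall w x, ind w x = (cell x == w)%:R) ->
  let ex y := extract (fun s => exist _ _ (hr s) : T) r d y in
  (forall (g : W -> C) (M : R) (u : V), 0 <= M -> B u -> (forall w, cabs (g w) <= M) ->
    cabs (\sum_(t : mE n K | deg (emb t) == d)
       (\sum_w g w * ex (P (ind w)) (emb t)) * zpow u (emb t)) <= L * M) /\
  (forall (e : R) (rep : W -> V) (t : mE n K), 0 <= e -> If (emb t) ->
    (forall x : T, cabs (zpow (sval x) (emb t) - zpow (rep (cell x)) (emb t)) <= e) ->
    1 <= \sum_w cabs (zpow (rep w) (emb t)) * cabs (ex (P (ind w)) (emb t)) + r^-1 ^+ d * (L * e)).
Proof.
move=> [hP1 hP2 hP3] r0 L0 KN hind ex.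
have fd := @flat_deg n d I.
have indS (g : W -> C) x : (\sum_w g w *: ind w) x = g (cell x).
  have term w : (g w *: ind w) x = g w * (cell x == w)%:R by rewrite bfunZ hind.
  rewrite bfun_sumE (eq_bigr _ (fun w _ => term w)) (bigD1 (cell x)) //= eqxx mulr1.
  by rewrite big1 ?addr0 // => w wx; rewrite eq_sym (negbTE wx) mulr0.
have exP (g : W -> C) b : ex (P (\sum_w g w *: ind w)) b = \sum_w g w * ex (P (ind w)) b.
  rewrite linear_sum /ex extract_sum; apply: eq_bigr => w _.
  by rewrite linearZ extractZ.
have exPe y (t : mE n K) : cabs (ex (P y) (emb t)) <= r^-1 ^+ d * (L * supnorm y).
  apply: le_trans (extract_le _ _ r0 _ _) _; apply: ler_wpM2l => //.
  by rewrite exprn_ge0 // invr_ge0 ltW.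
split=> [g M u M0 Bu gM|e rep t e0 It hrep].
  pose y := \sum_w g w *: ind w.
  have -> : \sum_(t : mE n K | deg (emb t) == d)
     (\sum_w g w * ex (P (ind w)) (emb t)) * zpow u (emb t) = P y (exist _ u Bu).
    have [c [hc ey]] := hP1 y.
    rewrite ey /= (peval_supported _ fd (leqnSn d) hc) big_mkcond /=; apply: eq_bigr => t _.
    case: eqP => [dt|dt]; last first.
      by rewrite hc ?mul0r // => /fd; rewrite /Lambda /=.
    by rewrite -exP -/y ey /ex pfun_extract.
  apply: le_trans (supnorm_ge _ _) _; apply: le_trans (hP3 y) _; apply: ler_wpM2l => //.
  by apply: supnorm_le => // x; rewrite indS.
pose c a : C := (a == emb t)%:R.
have hc : supported If c.
  by move=> a; rewrite /c; case: eqP => [->|].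
pose D := pfun lat d I c - \sum_w zpow (rep w) (emb t) *: ind w.
have Dle : supnorm D <= e.
  apply: supnorm_le => // x; rewrite bfunD bfunN indS.
  suff -> : pfun lat d I c x = zpow (sval x) (emb t) by exact: hrep.
  rewrite /= (peval_supported _ fd (leqnSn d) hc) (bigD1 t) //= /c eqxx mul1r.
  by rewrite big1 ?addr0 // => s st; rewrite (inj_eq (@emb_inj _ _)) (negbTE st) mul0r.
have exD : ex (P D) (emb t) = 1 - \sum_w zpow (rep w) (emb t) * ex (P (ind w)) (emb t).
  have exB y y' : ex (y - y') (emb t) = ex y (emb t) - ex y' (emb t).
    by rewrite /ex extractD -scaleN1r extractZ mulN1r.
  rewrite /D linearB exB exP hP2 // /ex pfun_extract //.
  by rewrite /c eqxx.
have -> : 1 = cabs (\sum_w zpow (rep w) (emb t) * ex (P (ind w)) (emb t) + ex (P D) (emb t)).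
  by rewrite exD addrC subrK cabs1.
apply: le_trans (cabsD _ _) _; apply: lerD.
  by apply: le_trans (cabs_sum _ _ _) _; apply: ler_sum => w _; rewrite cabsM.
apply: le_trans (exPe _ _) _; apply: ler_wpM2l; first by rewrite exprn_ge0 // invr_ge0 ltW.
exact: ler_wpM2l.
Qed.

(** Each summand [kap] is multiplied by the near partition of 1 from [bound_proj_coef_le]; its
    factors then regroup as [polar_coef] times [proj_coef], summed over the cells, and
    [coef_duality] applies. The accuracy [e / (G + 1)] makes the total error at most [e]. *)
Lemma unconditional_bound (L Q A : R) (P : {linear Y -> Y}) (c : mi n -> C) (z : V) :
  bound_proj lat d I L P -> 0 <= L -> 0 <= Q ->
  (forall c', supported (Lambda n K) c' ->
     polynorm nX I c' <= Q * polynorm nX (Lambda n K) c') ->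
  supported I c -> (forall z, B z -> cabs (peval I c z) <= A) -> B z ->
  \sum_(t : mE n K | deg (emb t) == K) cabs (c (emb t)) * cabs (zpow z (emb t))
  <= 4 ^+ d * (Q * (L * (expR 1 * A))).
Proof.
move=> hP L0 Q0 hQ hc hA Bz.
pose kap k (t : mE n K) : R :=
  (emb t k).+1%:R / K%:R * (cabs (c (incr (emb t) k)) * cabs (zpow z (incr (emb t) k))).
have kap0 k t : 0 <= kap k t by rewrite mulr_ge0 ?divr_ge0 ?mulr_ge0 ?cabs_ge0 ?ler0n.
rewrite (sum_euler (fun a => cabs (c a) * cabs (zpow z a))).
have [r r0 hr] := torus_radius n lat.
pose q := (K + K)%N; have KN : (K + K < 2 ^ q)%N by exact: ltn_expl.
have KN1 : (K < 2 ^ q)%N by apply: leq_ltn_trans KN; exact: leq_addr.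
pose S := \sum_(k < n) \sum_(t : mE n K | deg (emb t) == d) kap k t.
have S0 : 0 <= S by apply: sumr_ge0 => k _; exact: sumr_ge0.
apply/ler_addgt0Pr => e e0.
pose G := r^-1 ^+ d * L * S.
have G0 : 0 <= G by rewrite !mulr_ge0 // exprn_ge0 // invr_ge0 ltW.
have G1 : 0 < G + 1 by lra.
have [M M1 hM] := ball_bounded n lat.
have M0 : 0 <= M by lra.
have e10 : 0 < e / (G + 1) by rewrite divr_gt0.
have [|W [cell hcell]] := @complex_cells R T (mE n K)
    (fun t x => if deg (emb t) == d then zpow (sval x) (emb t) else 0) (M ^+ d) _ e10.
  move=> t x; case: eqP => [dt|_]; last by rewrite cabs0 exprn_ge0.
  by have := cabs_zpow_le (emb t) (hM _ (svalP x)); rewrite dt.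
have indb w : (fun x => (cell x == w)%:R : C) \in @sup_bounded R T.
  by apply/sup_boundedP; exists 1 => x; case: eqP => _; rewrite ?cabs1 ?cabs0.
pose ind w : Y := Bfun (indb w).
(* A nonempty cell is represented by one of its own points; an empty one gets some point of the
   ball, since [Brep] is required of every [w]. *)
have [rep' hrep'] : {rep' : W -> T & forall w, (exists x, cell x = w) -> cell (rep' w) = w}.
  apply: (@choice _ _ (fun w x => (exists x, cell x = w) -> cell x = w)) => w.
  have [[x xw]|nx] := pselect (exists x, cell x = w); first by exists x.
  by exists (exist _ 0 (ball_0 n lat)).
pose rep w := sval (rep' w).
have Brep w : B (rep w) by exact: svalP.
have [|H1 H2] := bound_proj_coef_le (hr q) (ind := ind) (cell := cell) hP r0 L0 KN1.
  by [].
pose coefW w (t : mE n K) := extract (fun s => exist _ _ (hr q s) : T) r d (P (ind w)) (emb t).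
have main := coef_duality lat Id hc hA Q0 hQ Brep (coefW := coefW) H1 KN Bz.
apply: (@le_trans _ _ (\sum_(k < n) \sum_(t : mE n K | deg (emb t) == d)
   (\sum_w cabs (polar_coef c rep k w t) * cabs (proj_coef I coefW z k w t)
     + kap k t * (r^-1 ^+ d * (L * (e / (G + 1))))))).
  apply: ler_sum => k _; apply: ler_sum => t dt; rewrite -/(kap k t).
  have p0 : 0 <= r^-1 ^+ d * (L * (e / (G + 1))).
    rewrite mulr_ge0 ?exprn_ge0 ?invr_ge0 ?(ltW r0) //.
    by apply: mulr_ge0 => //; exact: ltW.
  have [It|nIt] := pselect (I (incr (emb t) k)); last first.
    rewrite {1}/kap hc // cabs0 mul0r mulr0; apply: addr_ge0; last exact: mulr_ge0.
    by apply: sumr_ge0 => w _; rewrite mulr_ge0 ?cabs_ge0.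
  have Ift : If (emb t) by split; [exact/eqP|exists k].
  have hx x : cabs (zpow (sval x) (emb t) - zpow (rep (cell x)) (emb t)) <= e / (G + 1).
    have := hcell x (rep' (cell x)) (esym (hrep' _ (ex_intro _ x erefl))) t.
    by rewrite dt.
  have := H2 _ rep t (ltW e10) Ift hx => h.
  have -> : \sum_w cabs (polar_coef c rep k w t) * cabs (proj_coef I coefW z k w t) =
     kap k t * \sum_w cabs (zpow (rep w) (emb t)) * cabs (coefW w t).
    rewrite mulr_sumr; apply: eq_bigr => w _.
    rewrite /polar_coef /proj_coef dt asboolT //= !cabsM cabsV !cabs_nat /kap; ring.
  by rewrite -mulrDr -[X in X <= _]mulr1; apply: ler_wpM2l.
under eq_bigr do rewrite big_split -mulr_suml.
rewrite big_split /= -mulr_suml -/S; apply: lerD.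
  apply: le_trans main; apply: ler_sum => k _.
  rewrite [X in _ <= X]exchange_big /=; rewrite [X in X <= _]big_mkcond /=; apply: ler_sum => t _.
  by case: ifP => _ //; apply: sumr_ge0 => w _; rewrite mulr_ge0 ?cabs_ge0.
have -> : S * (r^-1 ^+ d * (L * (e / (G + 1)))) = G / (G + 1) * e.
  by rewrite /G; field; rewrite lt0r_neq0 // lt0r_neq0.
rewrite ler_piMl ?(ltW e0) // ler_pdivrMr //; lra.
Qed.

End UnconditionalBound.

(** * Projections of nearly minimal norm *)

Section ProjectionConstant.
Variables (R : realType) (inX : set (nat -> Cx R)) (nX : (nat -> Cx R) -> R) (n : nat).
Local Notation C := (Cx R).
Local Notation V := 'rV[C]_n.
Hypothesis lat : is_banach_seq_lattice inX nX.
Local Notation B := (ballXn nX n 1).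
Variables (d : nat) (I : set (mi n)).
Hypothesis Id : I `<=` Lambda n d.+1.
Local Notation K := d.+1.
Local Notation If := (flat K I).
Local Notation T := (@ball_type R nX n).
Local Notation Y := (bfun R T).

(** Keeping the discrete Fourier coefficients with index in [If] is a bounded projection. Its norm
    is irrelevant: it only shows that the infimum over projections is taken over a nonempty set. *)
Lemma bounded_projection_exists :
  exists (L : R) (P : {linear Y -> Y}), 0 <= L /\ bound_proj lat d I L P.
Proof.
have [r r0 hr] := torus_radius n lat.
pose q := (K + K)%N; have KN : (K < 2 ^ q)%N.
  by apply: (@leq_ltn_trans q); [exact: leq_addr|exact: ltn_expl].
have fd := @flat_deg n d I.
pose ex (y : Y) a := extract (fun s : {ffun 'I_n -> 'I_(2 ^ q)} => exist _ _ (hr q s) : T) r d y a.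
pose cf y a := if `[< If a >] then ex y a else 0.
pose P0 y := pfun lat d I (cf y).
have P0_linear : linear P0.
  move=> a y y'; rewrite /P0 -pfun_linear; congr (pfun lat d I _); apply/funext => b.
  rewrite /cf; case: asboolP => _; last by rewrite mulr0 addr0.
  by rewrite /ex extractD extractZ.
have [P eP] : exists P : {linear Y -> Y}, forall y, P y = P0 y.
  pose P : {linear Y -> Y} := HB.pack P0 (GRing.isLinear.Build C Y Y *:%R P0 P0_linear).
  by exists P.
have cf_supp y : supported If (cf y) by move=> a nIa; rewrite /cf asboolF.
have [M M1 hM] := ball_bounded n lat; have M0 : 0 <= M by lra.
pose G : R := \sum_(t : mE n K) r^-1 ^+ d * M ^+ deg (emb t).
have r1 : 0 <= r^-1 by rewrite invr_ge0 ltW.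
have G0 : 0 <= G by apply: sumr_ge0 => t _; rewrite mulr_ge0 // exprn_ge0.
exists G, P; split=> //; split=> [y|c hc|y].
- by exists (cf y); rewrite eP.
- rewrite eP /P0; congr (pfun lat d I _); apply/funext => a; rewrite /cf.
  case: asboolP => [Ia|/hc -> //].
  have da : deg a = d by exact: fd Ia.
  have -> : a = emb (mE_of K a) by rewrite emb_mE_of // da.
  by rewrite /ex pfun_extract.
rewrite eP; apply: supnorm_le => [|x]; first by rewrite mulr_ge0 ?supnorm_ge0.
rewrite /P0 /= (peval_supported _ fd (leqnSn d) (cf_supp y)).
apply: le_trans (cabs_sum _ _ _) _; rewrite /G mulr_suml; apply: ler_sum => t _.
rewrite cabsM mulrAC; apply: ler_pM; rewrite ?cabs_ge0 //.
  rewrite /cf; case: asboolP => _; last by rewrite cabs0 mulr_ge0 ?exprn_ge0 ?supnorm_ge0.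
  exact: extract_le.
exact/cabs_zpow_le/hM/svalP.
Qed.

(* A nonzero supremum or infimum rules out the junk value 0 of [sup] and [inf] at sets that
   are unbounded or empty; the same remark makes [normQ_le] true. *)
Lemma bounded_projection (L : R) : proj_const_P nX n If != 0 -> proj_const_P nX n If < L ->
  exists P : {linear Y -> Y}, bound_proj lat d I L P.
Proof.
rewrite /proj_const_P; set E := (X in sup X) => E0 EL.
have hE : has_sup E by apply: contrapT => nE; move: E0; rewrite sup_out ?eqxx.
pose jE : (mi n -> C) -> Y := pfun lat d I.
have rE : E (rel_proj_const If jE).
  exists Y, jE; split=> [t c c' _ _|]; first exact: pfun_linear.
  by split=> [c _|//]; exact: pfun_norm.
have rL : rel_proj_const If jE < L by apply: le_lt_trans EL; apply: ub_le_sup => //; case: hE.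
have [L1 [P1 [L10 [h1 h2 h3]]]] := bounded_projection_exists.
move: rL; rewrite /rel_proj_const; set S := [set D : R | _] => rL.
have hS : has_inf S.
  split; last by exists 0 => D [].
  exists L1; split=> //; exists P1; split; first exact: h1.
  by split; [exact: h2|move=> y; rewrite !bfun_normE; exact: h3].
have eps0 : 0 < L - inf S by rewrite subr_gt0.
have [D [D0 [P [k1 [k2 k3]]]] DL] := inf_adherent eps0 hS.
exists P; split=> // y; apply: le_trans (k3 y) _; rewrite bfun_normE /=.
by apply: ler_wpM2r; [exact: supnorm_ge0|move: DL; lra].
Qed.

Lemma proj_const_ge0 : 0 <= proj_const_P nX n If.
Proof.
rewrite /proj_const_P; set E := [set l : R | _].
have [hE|/sup_out -> //] := pselect (has_sup E).
have [[l El] ubE] := hE; apply: le_trans (ub_le_sup ubE El).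
have [Z [j [_ [_ ->]]]] := El; rewrite /rel_proj_const; set S := [set D : R | _].
have [S0|/set0P/negP/negPn/eqP ->] := pselect (S !=set0); last by rewrite inf0.
by apply: lb_le_inf => // D [].
Qed.

Lemma normQ_ge0 : 0 <= normQ nX n (Lambda n K) I.
Proof.
rewrite /normQ; set S := [set D : R | _].
have [S0|/set0P/negP/negPn/eqP ->] := pselect (S !=set0); last by rewrite inf0.
by apply: lb_le_inf => // D [].
Qed.

Lemma normQ_le c : normQ nX n (Lambda n K) I != 0 -> supported (Lambda n K) c ->
  polynorm nX I c <= normQ nX n (Lambda n K) I * polynorm nX (Lambda n K) c.
Proof.
rewrite /normQ; set S := [set D : R | _] => S0 hc.
have [Sn|/set0P/negP/negPn/eqP e] := pselect (S !=set0); last by rewrite e inf0 eqxx in S0.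
have p0 : 0 <= polynorm nX (Lambda n K) c by exact: (polynorm_ge0 lat (d := K)).
have [p00|pn] := eqVneq (polynorm nX (Lambda n K) c) 0.
  by have [D [_ /(_ c hc)]] := Sn; rewrite p00 !mulr0.
have pp : 0 < polynorm nX (Lambda n K) c by rewrite lt_def pn.
rewrite -ler_pdivrMr //; apply: lb_le_inf => // D [_ /(_ c hc) h].
by rewrite ler_pdivrMr.
Qed.

Local Notation lam := (proj_const_P nX n If).
Local Notation Q := (normQ nX n (Lambda n K) I).

(** Projections are available for every norm bound above [lam]; the excess [e / (G + 1)] adds at
    most [e] to the result. *)
Lemma unconditional_le (A : R) (c : mi n -> C) (z : V) : Q != 0 -> lam != 0 ->
  supported I c -> (forall z, B z -> cabs (peval I c z) <= A) -> B z ->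
  \sum_(t : mE n K | deg (emb t) == K) cabs (c (emb t)) * cabs (zpow z (emb t))
  <= 4 ^+ d * (expR 1 * Q * lam) * A.
Proof.
move=> Qn ln hc hA Bz.
have A0 : 0 <= A by apply: le_trans (cabs_ge0 _) (hA _ (ball_0 n lat)).
pose G := 4 ^+ d * (expR 1 * Q) * A.
have G0 : 0 <= G.
  by rewrite mulr_ge0 // mulr_ge0 ?exprn_ge0 // mulr_ge0 ?expR_ge0 // normQ_ge0.
apply/ler_addgt0Pr => e e0; have G1 : 0 < G + 1 by lra.
have e1 : 0 < e / (G + 1) by rewrite divr_gt0.
have [P hP] := @bounded_projection (lam + e / (G + 1)) ln ltac:(by rewrite ltrDl).
have L0 : 0 <= lam + e / (G + 1) by rewrite addr_ge0 ?proj_const_ge0 // ltW.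
apply: le_trans (unconditional_bound Id hP L0 normQ_ge0 (fun c' => normQ_le Qn) hc hA Bz) _.
have -> : 4 ^+ d * (Q * ((lam + e / (G + 1)) * (expR 1 * A))) =
   4 ^+ d * (expR 1 * Q * lam) * A + G / (G + 1) * e.
  by rewrite /G; field; exact: lt0r_neq0.
by rewrite lerD2l ler_piMl ?(ltW e0) // ler_pdivrMr //; lra.
Qed.

(** Test on a single monomial, for which the unconditional sum is its own modulus; its norm is
    positive because the ball contains a torus. This will keep the candidate radius below 1. *)
Lemma constants_ge1 : I !=set0 -> Q != 0 -> lam != 0 -> 1 <= 4 ^+ d * (expR 1 * Q * lam).
Proof.
move=> [a Ia] Qn ln; have da : deg a = K by exact: Id Ia.
pose c b : C := (b == a)%:R.
have hc : supported I c by move=> b nb; rewrite /c; case: eqP => // e; rewrite e in nb.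
have ca (t : mE n K) : c (emb t) = (t == mE_of K a)%:R.
  have ea : emb (mE_of K a) = a by rewrite emb_mE_of ?da.
  by rewrite /c -{1}ea (inj_eq (@emb_inj _ _)).
have pc z : peval I c z = zpow z a.
  rewrite (peval_supported _ Id (leqnn K) hc) (bigD1 (mE_of K a)) //= ca eqxx mul1r.
  rewrite emb_mE_of ?da // big1 ?addr0 // => t ta.
  by rewrite ca (negbTE ta) mul0r.
have [r r0 hr] := torus_radius n lat.
pose s0 : {ffun 'I_n -> 'I_(2 ^ 0)} := [ffun=> ord0].
have p0 : 0 < polynorm nX I c.
  apply: lt_le_trans (polynorm_ge lat c Id (hr 0%N s0)).
  by rewrite pc zpowZ cabsM cabsX -/(tor _ _ _) cabs_tor mulr1 cabs_cR exprn_gt0 ?gtr0_norm.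
rewrite -(@ler_pM2r _ (polynorm nX I c)) // mul1r; apply: (polynorm_le lat) => z Bz.
have hA y : B y -> cabs (peval I c y) <= polynorm nX I c.
  exact: (polynorm_ge lat c Id).
apply: le_trans (unconditional_le Qn ln hc hA Bz).
rewrite (bigD1 (mE_of K a)) /=; last by rewrite emb_mE_of ?da.
rewrite ca eqxx cabs1 mul1r emb_mE_of ?da // pc lerDl.
by apply: sumr_ge0 => t _; rewrite mulr_ge0 ?cabs_ge0.
Qed.

End ProjectionConstant.

(** * The Bohr radius *)

Section Bohr.
Variables (R : realType) (inX : set (nat -> Cx R)) (nX : (nat -> Cx R) -> R) (n : nat).
Local Notation C := (Cx R).
Local Notation V := 'rV[C]_n.
Hypothesis lat : is_banach_seq_lattice inX nX.
Local Notation B := (ballXn nX n 1).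
Variable J : set (mi n).

Lemma Jm_Lambda m : Jm J m `<=` Lambda n m.
Proof. by move=> a []. Qed.

(** If one of the constants were 0, so would be its root and, as [0^-1 = 0], the whole term, against
    [b > 0]. The inequality is then the power of exponent [d.+1] of the assumed one. *)
Lemma bound_term_le d (b : R) : 0 < b -> b <= bound_term nX n J d.+1 ->
  let Q := normQ nX n (Lambda n d.+1) (Jm J d.+1) in
  let lam := proj_const_P nX n (flat d.+1 (Jm J d.+1)) in
  [/\ Q != 0, lam != 0 & expR 1 * Q * lam * b ^+ d.+1 <= 1].
Proof.
move=> b0 hb Q lam.
have m0 : (d.+1%:R : R) != 0 by rewrite pnatr_eq0.
have mV0 : (d.+1%:R : R)^-1 != 0 by rewrite invr_eq0.
have Q0 : 0 <= Q := normQ_ge0 _ _ _.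
have lam0 : 0 <= lam := proj_const_ge0 _ _ _.
move: hb; rewrite /bound_term -/Q -/lam => hb.
have Qn : Q != 0.
  apply/negP => /eqP e; move: hb; rewrite e mulr0 powR0 // invr0 mul0r.
  by rewrite leNgt b0.
have ln : lam != 0.
  apply/negP => /eqP e; move: hb; rewrite e powR0 // invr0 mulr0.
  by rewrite leNgt b0.
split=> //.
have eQ : 0 < expR 1 * Q by rewrite mulr_gt0 ?expR_gt0 // lt_def Qn.
have lp : 0 < lam by rewrite lt_def ln.
have root (x : R) : 0 < x -> (x `^ (d.+1%:R)^-1) ^+ d.+1 = x.
  by move=> x0; rewrite -powR_mulrn ?powR_ge0 // -powRrM mulVf // powRr1 // ltW.
set X := (expR 1 * Q) `^ _ in hb; set Y := lam `^ _ in hb.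
have X0 : 0 < X by rewrite powR_gt0.
have Y0 : 0 < Y by rewrite powR_gt0.
have h : X * Y * b <= 1.
  move: hb; rewrite -invfM -[X in _ <= X]mul1r ler_pdivlMr ?mulr_gt0 //.
  by rewrite mulrC.
rewrite -(root _ eQ) -(root _ lp) -/X -/Y -!exprMn.
by apply: exprn_ile1 => //; rewrite !mulr_ge0 // ltW.
Qed.

(** The full series sums to exactly 1. With [x] in place of 6 it would be [2 / (x - 4)], which is
    where the constant 6 comes from. *)
Lemma sum_geometric_bound k :
  \sum_(m < k) (4 ^+ m / 6 ^+ m.+1 : R) * 2 <= 1.
Proof.
suff -> : \sum_(m < k) (4 ^+ m / 6 ^+ m.+1 : R) * 2 = 1 - (4 / 6) ^+ k.
  by rewrite gerBl exprn_ge0.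
elim: k => [|k IH]; first by rewrite big_ord0 expr0 subrr.
rewrite big_ord_recr /= IH [6 ^+ k.+1]exprS invfM mulrCA -expr_div_n [(4 / 6) ^+ k.+1]exprS.
by field.
Qed.

Section Function.
Variables (f : V -> C) (M : R).
Hypothesis f_hol : holomorphic_on B f.
Hypothesis f_coef : forall a, ~ J a -> taylor_coef f a = 0.
Hypothesis f_le : forall w, B w -> cabs (f w) <= M.

Lemma f_has_fder : hol B f.
Proof. by move=> z /f_hol df; eexists; exact: differentiable_has_fder. Qed.

Lemma homogeneous_part_le m z : (0 < m)%N -> B z ->
  cabs (peval (Jm J m) (taylor_coef f) z) <= 2 * (M - cabs (f 0)).
Proof.
move=> m0 Bz; have [rho rho1 hrho] := ball_line lat Bz.
have := homog_wiener (ball_nopen lat) f_has_fder rho1 hrho f_le m0.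
suff -> : hpart m m f z = peval (Jm J m) (taylor_coef f) z by lra.
rewrite (pevalE _ _ (@Jm_Lambda m) (leqnn m)) /hpart big_mkcond /=; apply: eq_bigr => t _.
case: asboolP => [[_ /eqP ->] //|nJ]; rewrite mul0r; case: eqP => // dt.
by rewrite f_coef ?mul0r // => Jt; apply: nJ.
Qed.

(** Scaling [z] back to the unit ball releases the factor [(b / 6)^(d+1)], in which [b^(d+1)]
    absorbs [e Q lam]. Degrees with empty [J(m)] contribute nothing, so [b] is compared with the
    other terms only. *)
Lemma homogeneous_sum_le d (b : R) z : 0 < b ->
  (Jm J d.+1 !=set0 -> b <= bound_term nX n J d.+1) -> ballXn nX n (6^-1 * b) z ->
  \sum_(t : mE n d.+1 | deg (emb t) == d.+1) cabs (taylor_coef f (emb t) * zpow z (emb t))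
  <= 4 ^+ d / 6 ^+ d.+1 * 2 * (M - cabs (f 0)).
Proof.
move=> b0 hb Bz; have fM : 0 <= M - cabs (f 0).
  by rewrite subr_ge0; apply: f_le; exact: (ball_0 _ lat).
have [Jne|/set0P/negP/negPn/eqP Je] := pselect (Jm J d.+1 !=set0); last first.
  rewrite big1 => [|t dt].
    by rewrite mulr_ge0 // mulr_ge0 // mulr_ge0 ?exprn_ge0 // invr_ge0 exprn_ge0.
  rewrite f_coef ?mul0r ?cabs0 // => Jt.
  have : Jm J d.+1 (emb t) by split=> //; exact/eqP.
  by rewrite Je.
have [Qn ln] := bound_term_le b0 (hb Jne).
set Q := normQ _ _ _ _ in Qn *; set lam := proj_const_P _ _ _ in ln *; move=> hQl.
(* The Taylor coefficients of other degrees are cut off, as the unconditional bound asks for support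
   in [J(m)]. *)
pose c a := if `[< Jm J d.+1 a >] then taylor_coef f a else 0.
have hc : supported (Jm J d.+1) c by move=> a na; rewrite /c asboolF.
have r0 : 0 < 6^-1 * b by rewrite mulr_gt0 // invr_gt0.
have cr0 : cR (6^-1 * b) != 0 :> C by rewrite -cabs_gt0 cabs_cR normr_gt0 lt0r_neq0.
pose z' := (cR (6^-1 * b))^-1 *: z.
have Bz' : B z'.
  move: Bz; rewrite /ballXn /= => Bz.
  by rewrite /z' (normXnZ lat) cabsV cabs_cR (gtr0_norm r0) ltr_pdivrMl // mulr1.
have hA y : B y -> cabs (peval (Jm J d.+1) c y) <= 2 * (M - cabs (f 0)).
  move=> By; suff -> : peval (Jm J d.+1) c y = peval (Jm J d.+1) (taylor_coef f) y.
    exact: homogeneous_part_le.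
  rewrite !(pevalE _ _ (@Jm_Lambda _) (leqnn _)); apply: eq_bigr => t _; rewrite /c.
  by case: asboolP.
have := unconditional_le lat (@Jm_Lambda d.+1) Qn ln hc hA Bz'.
set S := \sum_(t | _) _; set D := 4 ^+ d * _ * _ => hS.
have -> : \sum_(t : mE n d.+1 | deg (emb t) == d.+1)
    cabs (taylor_coef f (emb t) * zpow z (emb t)) = (6^-1 * b) ^+ d.+1 * S.
  rewrite /S mulr_sumr; apply: eq_bigr => t dt; rewrite cabsM.
  have -> : z = cR (6^-1 * b) *: z' by rewrite scalerA divff // scale1r.
  rewrite zpowZ (eqP dt) cabsM cabsX cabs_cR (gtr0_norm r0) mulrCA; congr (_ * (_ * _)).
  rewrite /c; case: asboolP => // nJ; rewrite f_coef // => Jt.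
  by apply: nJ; split=> //; exact/eqP.
apply: le_trans (ler_wpM2l _ hS) _; first by rewrite exprn_ge0 // ltW.
have -> : (6^-1 * b) ^+ d.+1 * D =
   (expR 1 * Q * lam * b ^+ d.+1) * (4 ^+ d / 6 ^+ d.+1 * 2 * (M - cabs (f 0))).
  rewrite /D exprMn exprVn -/Q -/lam; move: (6 ^- d.+1) (b ^+ d.+1) (4 ^+ d) (expR 1 * Q * lam) (M - cabs (f 0)).
  by clear => u v w x y; ring.
rewrite ler_piMl // mulr_ge0 // mulr_ge0 // mulr_ge0 ?exprn_ge0 // invr_ge0 exprn_ge0 //.
Qed.

Lemma sum_degree_le (G : mi n -> R) (s : seq (mi n)) m : (forall a, 0 <= G a) -> uniq s ->
  \sum_(a <- s | deg a == m) G a <= \sum_(t : mE n m | deg (emb t) == m) G (emb t).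
Proof.
move=> G0 us.
rewrite -[X in _ <= X](big_map (@emb n m) (fun a => deg a == m) G).
rewrite -[X in X <= _]big_filter -[X in _ <= X]big_filter; set s1 := [seq _ <- s | _]; set s2 := [seq _ <- _ | _].
have u2 : uniq s2 by rewrite filter_uniq // (map_inj_uniq (@emb_inj n m)) index_enum_uniq.
have u1 : uniq s1 by rewrite filter_uniq.
have sub : {subset s1 <= s2}.
  move=> a; rewrite !mem_filter => /andP[da _]; rewrite da /=.
  apply/mapP; exists (mE_of m a); first by rewrite mem_index_enum.
  by rewrite emb_mE_of // (eqP da).
have s12 : perm_eq s1 [seq a <- s2 | a \in s1].
  apply: uniq_perm => //; first exact: filter_uniq.
  by move=> a; rewrite mem_filter; case: (boolP (a \in s1)) => //= /sub ->.
by rewrite (perm_big _ s12) big_filter [X in _ <= X](bigID (mem s1)) /= lerDl sumr_ge0.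
Qed.

Lemma bohr_sum_le (b : R) z : 0 < b ->
  (forall m, (0 < m)%N -> Jm J m !=set0 -> b <= bound_term nX n J m) ->
  ballXn nX n (6^-1 * b) z ->
  (\esum_(a in J) (cabs (taylor_coef f a * zpow z a))%:E <= M%:E)%E.
Proof.
move=> b0 hb Bz; apply: ge_ereal_sup => _ [X [finX XJ] <-].
rewrite fsbig_finite //= sumEFin lee_fin.
have := finmap.fset_uniq (fset_set X); move: (finmap.enum_fset _) => s us; pose G a := cabs (taylor_coef f a * zpow z a).
have G0 a : 0 <= G a by exact: cabs_ge0.
have fM : 0 <= M - cabs (f 0) by rewrite subr_ge0; apply: f_le; exact: (ball_0 _ lat).
pose N := (\max_(a <- s) deg a).+1.
apply: (@le_trans _ _ (\sum_(m < N) \sum_(a <- s | deg a == m) G a)).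
  rewrite (exchange_big_dep xpredT) //= big_seq [X in _ <= X]big_seq; apply: ler_sum => a sa.
  have aN : (deg a < N)%N by rewrite /N ltnS; exact: leq_bigmax_seq.
  by rewrite (bigD1 (Ordinal aN)) //= lerDl sumr_ge0.
apply: (@le_trans _ _ (\sum_(m < N) \sum_(t : mE n m | deg (emb t) == m) G (emb t))).
  by apply: ler_sum => m _; apply: sum_degree_le.
rewrite big_ord_recl /=.
(* The term of degree 0 is set apart: the other degrees share what remains, [M - |f(0)|]. *)
have -> : \sum_(t : mE n 0 | deg (emb t) == 0%N) G (emb t) = cabs (f 0).
  have e0 : emb ([ffun=> ord0] : mE n 0) = [ffun=> 0%N] by apply/ffunP => i; rewrite !ffunE.
  rewrite (big_pred1 [ffun=> ord0]) => [|t].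
    rewrite e0 /G taylor_coef0 /zpow big1 ?mulr1 // => i _; by rewrite ffunE.
  have -> : t = [ffun=> ord0] by apply/ffunP => i; rewrite ffunE; exact: ord1.
  rewrite e0 /deg big1 /= ?eqxx // => i _; by rewrite ffunE.
rewrite -lerBrDl.
apply: (@le_trans _ _ (\sum_(m < \max_(a <- s) deg a) 4 ^+ m / 6 ^+ m.+1 * 2 * (M - cabs (f 0)))).
  apply: ler_sum => m _; apply: (homogeneous_sum_le b0 _ Bz); exact: hb.
by rewrite -mulr_suml ler_piMl // sum_geometric_bound.
Qed.

End Function.

End Bohr.

(** For empty [J(m)] the norm of [Q] is 0 and the term formally infinite, whereas [0^-1 = 0] would
    make it 0; so such degrees are left out. The index of nonzero degree in [J] keeps the extended
    infimum below [+oo]. *)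
Theorem theorem2p30 (R : realType) (inX : set (nat -> Cx R)) (nX : (nat -> Cx R) -> R)
    (n : nat) (J : set (mi n)) :
  is_banach_seq_lattice inX nX ->
  (exists a, J a /\ deg a <> 0%N) ->
  ((6^-1 : R)%:E *
     ereal_inf [set (bound_term nX n J m)%:E
               | m in [set m : nat | (0 < m)%N /\ Jm J m !=set0]]
   <= (bohr_radius nX n J)%:E)%E.
Proof.
move=> lat [a0 [Ja0 /eqP da0]]; set S := [set _ | _ in _].
have bohr_ge0 : 0 <= bohr_radius nX n J.
  rewrite /bohr_radius; set E := [set r : R | _].
  have [hE|/sup_out -> //] := pselect (has_sup E).
  have [[r Er] ubE] := hE; apply: le_trans (ub_le_sup ubE Er).
  by case: Er => /andP[/ltW].
have m0 : (0 < deg a0)%N /\ Jm J (deg a0) !=set0 by split; [rewrite lt0n|exists a0].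
have S0 : S (bound_term nX n J (deg a0))%:E by exists (deg a0).
have beta_le m : (0 < m)%N -> Jm J m !=set0 -> (ereal_inf S <= (bound_term nX n J m)%:E)%E.
  by move=> mp Jm0; apply: ereal_inf_lbound; exists m.
(* A nonpositive infimum, including every case of degenerate constants, is settled by [bohr_ge0]. *)
have [beta0|beta0] := leP (ereal_inf S) 0%E.
  apply: le_trans (_ : 0 <= _)%E; last by rewrite lee_fin.
  by apply: mule_ge0_le0; rewrite ?lee_fin ?invr_ge0.
have := beta_le _ m0.1 m0.2; move: beta0 beta_le; case: (ereal_inf S) => [b| |] //.
rewrite lte_fin => b0 beta_le _; rewrite -EFinM lee_fin.
have hb m : (0 < m)%N -> Jm J m !=set0 -> b <= bound_term nX n J m.
  by move=> mp /(beta_le _ mp); rewrite lee_fin.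
(* Radii in the definition of the Bohr radius are below 1. With [E = e Q lam] in some degree [m]
   with nonempty [J(m)], [b >= 6] would give [6^m E <= b^m E <= 1 <= 4^(m-1) E < 6^m E]. *)
have b6 : 6^-1 * b < 1.
  case: (deg a0) m0 => [[]//|d] [_ Jne].
  have [Qn ln h] := bound_term_le b0 (hb d.+1 isT Jne).
  have := constants_ge1 lat (@Jm_Lambda n J d.+1) Jne Qn ln; move: h.
  set E := expR 1 * _ * _ => h1 h2.
  rewrite ltr_pdivrMl // mulr1 ltNge; apply/negP => b6.
  have E0 : 0 < E by rewrite -(@pmulr_rgt0 _ (4 ^+ d)) ?exprn_gt0 // (lt_le_trans ltr01).
  have : 6 ^+ d.+1 <= b ^+ d.+1 by rewrite lerXn2r ?nnegrE // ltW.
  move=> /(ler_wpM2l (ltW E0)) h3; have h4 := le_trans h3 h1.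
  have : (4 : R) ^+ d < 6 ^+ d.+1.
    apply: (@le_lt_trans _ _ (6 ^+ d)); first by rewrite lerXn2r ?nnegrE // ler_nat.
    by rewrite exprS ltr_pMl ?exprn_gt0 // ltr1n.
  move=> h5; have : 4 ^+ d * E < 6 ^+ d.+1 * E by rewrite ltr_pM2r.
  by move=> h6; have := lt_le_trans (le_lt_trans h2 h6) (eq_ler (mulrC _ _)); lra.
rewrite /bohr_radius; apply: ub_le_sup.
  by exists 1 => r [/andP[_ /ltW]].
split; first by rewrite b6 andbT mulr_gt0 // invr_gt0.
move=> f fhol _ fcoef M fM z Bz.
exact: (bohr_sum_le lat fhol fcoef fM b0 hb Bz).
Qed.
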